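(* Let $A\to A'$ be a faithfully flat extension of normal noetherian domains $A$ and $A'$. Suppose that the pull-back map $p^*: Cl\, A\to Cl\, A'$ is surjective. Then $ACl\, A = ACl\, A'$.
   Context: $p:\operatorname{Spec} A'\to\operatorname{Spec} A$ is the induced morphism and $p^*$ is the (flat) pull-back of Weil divisors. A normal scheme means a noetherian separated irreducible reduced normal scheme. A divisor is a Weil divisor; it is called trivial if it is principal. The complement of an effective divisor is the complement of its support. Let $X$ be a normal scheme. A divisor $D$ on $X$ is coaffine if for every effective divisor $E$ linearly equivalent to $D$ the complement of $E$ is an affine scheme. $D$ is strongly coaffine if for every $n\in\mathbb{Z}$ the divisor $nD$ is coaffine or trivial. $D$ is affine trivial if for every strongly coaffine divisor $E$ the divisor $D+E$ is again strongly coaffine. The affine trivial divisors form a subgroup of $\operatorname{Div} X$ containing the principal divisors; the affine class group $ACl\, X$ is the group of divisors modulo the affine trivial divisors (a quotient of the divisor class group $Cl\, X$). For a normal noetherian domain $A$ put $Cl\, A=Cl(\operatorname{Spec} A)$ and $ACl\, A = ACl(\operatorname{Spec} A)$. The equality $ACl\, A=ACl\, A'$ means that $p^*$ induces an isomorphism between these groups. *)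

(* Defs.v *)
From HB Require Import structures.
From mathcomp Require Import all_boot all_order all_algebra.
From mathcomp Require Import ring_quotient generic_quotient.
From mathcomp Require Import all_classical topology.
From mathcomp Require Export freeg.
From mathcomp Require Import ring.

Set Implicit Arguments.
Unset Strict Implicit.
Unset Printing Implicit Defensive.

Import GRing.Theory.

Local Open Scope classical_set_scope.
Local Open Scope ring_scope.
Local Open Scope quotient_scope.

(* The ideals of ring_quotient.v are proper ideals of nonzero rings; here the
   unit ideal and the zero ring (sections over the empty set) are needed. *)
Definition is_ideal (R : comPzRingType) (I : set R) : Prop :=
  [/\ I 0, forall x y, I x -> I y -> I (x + y) & forall a x, I x -> I (a * x)].

Definition ideal_gen (R : comPzRingType) (S : set R) : set R :=
  smallest (@is_ideal R) S.

Definition is_prime_ideal (R : comPzRingType) (I : set R) : Prop :=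
  [/\ is_ideal I, ~ I 1 & forall x y, I (x * y) -> I x \/ I y].

Record Spec (R : comPzRingType) : Type := MkSpec {
  pideal :> set R;
  pidealP : is_prime_ideal pideal
}.

HB.instance Definition _ (R : comPzRingType) := gen_eqMixin (Spec R).
HB.instance Definition _ (R : comPzRingType) := gen_choiceMixin (Spec R).

Section Zariski.
Variable R : comPzRingType.

Definition zariski_open (U : set (Spec R)) : Prop :=
  exists S : set R, U = [set x : Spec R | ~ (S `<=` x)].

Lemma zariski_openT : zariski_open setT.
Proof.
exists setT; apply/seteqP; split=> x //= _ sub.
by case: (pidealP x) => _ + _; apply; apply: sub.
Qed.

Lemma zariski_openI : setI_closed zariski_open.
Proof.
move=> _ _ [S ->] [T ->].
exists [set z | exists s t, [/\ S s, T t & z = s * t]].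
apply/seteqP; split=> x /=.
- case=> /existsNP[s /not_implyP[Ss xs]] /existsNP[t /not_implyP[Tt xt]] sub.
  case: (pidealP x) => _ _ /(_ s t) []//.
  by apply: sub; exists s, t.
- move=> nsub; split=> sub; apply: nsub => _ [s [t [Ss Tt ->]]];
    case: (pidealP x) => -[_ _ xM] _ _.
  + by rewrite mulrC; apply: xM; apply: sub.
  + by apply: xM; apply: sub.
Qed.

Lemma zariski_open_bigU (I : Type) (f : I -> set (Spec R)) :
  (forall i, zariski_open (f i)) -> zariski_open (\bigcup_i f i).
Proof.
move=> fo; exists (\bigcup_i [set s | exists S : set R,
  f i = [set x : Spec R | ~ (S `<=` x)] /\ S s]).
apply/seteqP; split=> x /=.
- case=> i _ fix_ sub; have [S fE] := fo i.
  move: fix_; rewrite fE /=; apply=> s Ss.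
  by apply: sub; exists i => //; exists S.
- move=> nsub; apply: contrapT => nU; apply: nsub => s [i _ [S [fE Ss]]].
  apply: contrapT => xs; apply: nU; exists i => //.
  by rewrite fE /= => /(_ s Ss).
Qed.

HB.instance Definition _ := isOpenTopological.Build (Spec R)
  zariski_openT zariski_openI zariski_open_bigU.

End Zariski.

Section Localization.
Variables (R : comPzRingType) (x : Spec R).

Record denom : Type := SubDenom {
  denom_val :> R;
  _ : `[< ~ pideal x denom_val >]
}.

HB.instance Definition _ := [isSub for denom_val].
HB.instance Definition _ := [Choice of denom by <:].

Definition MkDenom (f : R) (xf : ~ pideal x f) : denom := SubDenom (asboolT xf).

Lemma denomP (f : denom) : ~ pideal x f.
Proof. exact/asboolP/(valP f). Qed.

Lemma denom1P : ~ pideal x 1. Proof. by case: (pidealP x). Qed.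

Lemma denomMP (f g : denom) : ~ pideal x (denom_val f * denom_val g).
Proof. by case: (pidealP x) => _ _ xM /xM[] /denomP. Qed.

Definition denom1 := MkDenom denom1P.
Definition denomM f g := MkDenom (@denomMP f g).

Definition frac_eq (u v : R * denom) : bool :=
  `[< exists w : denom,
        denom_val w * (u.1 * denom_val v.2) = denom_val w * (v.1 * denom_val u.2) >].

Lemma frac_eq_equiv : equiv_class_of frac_eq.
Proof.
split=> [u|u v|v u w].
- by apply/asboolP; exists denom1.
- by apply/asboolP/asboolP => -[c e]; exists c; rewrite e.
- move=> /asboolP[c e] /asboolP[d e']; apply/asboolP.
  exists (denomM (denomM c d) v.2) => /=.
  transitivity (denom_val d * denom_val w.2 * (denom_val c * (u.1 * denom_val v.2))); first by ring.
  rewrite e.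
  transitivity (denom_val c * denom_val u.2 * (denom_val d * (v.1 * denom_val w.2))); first by ring.
  by rewrite e'; ring.
Qed.

Canonical frac_eq_rel := EquivRelPack frac_eq_equiv.
Canonical frac_eq_encModRel := defaultEncModRel frac_eq.

Definition loc : Type := {eq_quot frac_eq}.
HB.instance Definition _ := Choice.on loc.
HB.instance Definition _ : EqQuotient _ frac_eq loc := EqQuotient.on loc.

Definition frac (a : R) (f : R) (xf : ~ pideal x f) : loc := \pi_loc (a, MkDenom xf).
Definition loc_inj (a : R) : loc := frac a denom1P.

Definition loc_add (u v : loc) : loc :=
  \pi_loc ((repr u).1 * denom_val (repr v).2 + (repr v).1 * denom_val (repr u).2,
           denomM (repr u).2 (repr v).2).
Definition loc_opp (u : loc) : loc := \pi_loc (- (repr u).1, (repr u).2).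
Definition loc_mul (u v : loc) : loc :=
  \pi_loc ((repr u).1 * (repr v).1, denomM (repr u).2 (repr v).2).

Lemma loc_eqP (u v : R * denom) :
  \pi_loc u = \pi_loc v <->
  exists w : denom, denom_val w * (u.1 * denom_val v.2) = denom_val w * (v.1 * denom_val u.2).
Proof. by split=> [/eqmodP/asboolP|e]//; apply/eqmodP/asboolP. Qed.

Lemma repr_loc (u : R * denom) : exists w : denom,
  denom_val w * ((repr (\pi_loc u)).1 * denom_val u.2) =
  denom_val w * (u.1 * denom_val (repr (\pi_loc u)).2).
Proof. by apply/loc_eqP; rewrite reprK. Qed.

Lemma loc_addE (a b : R) (f g : denom) :
  loc_add (\pi_loc (a, f)) (\pi_loc (b, g)) =
  \pi_loc (a * denom_val g + b * denom_val f, denomM f g).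
Proof.
apply/loc_eqP; have [c e] := repr_loc (a, f); have [d e'] := repr_loc (b, g).
move: (repr (\pi_loc (a, f))) (repr (\pi_loc (b, g))) e e' => [p r] [q s] /=.
move=> e e'; exists (denomM c d) => /=.
transitivity (denom_val d * denom_val s * denom_val g * (denom_val c * (p * denom_val f)) +
              denom_val c * denom_val r * denom_val f * (denom_val d * (q * denom_val g))); first by ring.
by rewrite e e'; ring.
Qed.

Lemma loc_oppE (a : R) (f : denom) :
  loc_opp (\pi_loc (a, f)) = \pi_loc (- a, f).
Proof.
apply/loc_eqP; have [c e] := repr_loc (a, f).
move: (repr (\pi_loc (a, f))) e => [p r] /= e; exists c.
by rewrite !mulNr !mulrN e.
Qed.

Lemma loc_mulE (a b : R) (f g : denom) :
  loc_mul (\pi_loc (a, f)) (\pi_loc (b, g)) = \pi_loc (a * b, denomM f g).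
Proof.
apply/loc_eqP; have [c e] := repr_loc (a, f); have [d e'] := repr_loc (b, g).
move: (repr (\pi_loc (a, f))) (repr (\pi_loc (b, g))) e e' => [p r] [q s] /=.
move=> e e'; exists (denomM c d) => /=.
transitivity ((denom_val c * (p * denom_val f)) * (denom_val d * (q * denom_val g))); first by ring.
by rewrite e e'; ring.
Qed.

Lemma locP (u : loc) : exists a f, u = \pi_loc (a, f).
Proof. by exists (repr u).1, (repr u).2; rewrite -surjective_pairing reprK. Qed.

Lemma loc_addA : associative loc_add.
Proof.
move=> u v w; have [a [f ->]] := locP u; have [b [g ->]] := locP v.
have [c [h ->]] := locP w; rewrite !loc_addE.
by apply/loc_eqP; exists denom1 => /=; ring.
Qed.

Lemma loc_addC : commutative loc_add.
Proof.
move=> u v; have [a [f ->]] := locP u; have [b [g ->]] := locP v.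
by rewrite !loc_addE; apply/loc_eqP; exists denom1 => /=; ring.
Qed.

Lemma loc_add0 : left_id (loc_inj 0) loc_add.
Proof.
move=> u; have [a [f ->]] := locP u.
by rewrite loc_addE; apply/loc_eqP; exists denom1 => /=; ring.
Qed.

Lemma loc_addN : left_inverse (loc_inj 0) loc_opp loc_add.
Proof.
move=> u; have [a [f ->]] := locP u.
by rewrite loc_oppE loc_addE; apply/loc_eqP; exists denom1 => /=; ring.
Qed.

HB.instance Definition _ :=
  GRing.isZmodule.Build loc loc_addA loc_addC loc_add0 loc_addN.

Lemma loc_mulA : associative loc_mul.
Proof.
move=> u v w; have [a [f ->]] := locP u; have [b [g ->]] := locP v.
have [c [h ->]] := locP w; rewrite !loc_mulE.
by apply/loc_eqP; exists denom1 => /=; ring.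
Qed.

Lemma loc_mulC : commutative loc_mul.
Proof.
move=> u v; have [a [f ->]] := locP u; have [b [g ->]] := locP v.
by rewrite !loc_mulE; apply/loc_eqP; exists denom1 => /=; ring.
Qed.

Lemma loc_mul1 : left_id (loc_inj 1) loc_mul.
Proof.
move=> u; have [a [f ->]] := locP u.
by rewrite loc_mulE; apply/loc_eqP; exists denom1 => /=; ring.
Qed.

Lemma loc_mulDl : left_distributive loc_mul +%R.
Proof.
move=> u v w; have [a [f ->]] := locP u; have [b [g ->]] := locP v.
have [c [h ->]] := locP w; rewrite -[LHS]/(loc_mul (loc_add _ _) _).
rewrite -[RHS]/(loc_add (loc_mul _ _) (loc_mul _ _)) loc_addE !loc_mulE loc_addE.
by apply/loc_eqP; exists denom1 => /=; ring.
Qed.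

HB.instance Definition _ := GRing.Zmodule_isComPzRing.Build loc
  loc_mulA loc_mulC loc_mul1 loc_mulDl.

End Localization.

Section StructureSheaf.
Variables (R : comPzRingType) (U : set (Spec R)).

Definition germs : Type := forall x : Spec R, U x -> loc x.

HB.instance Definition _ := gen_eqMixin germs.
HB.instance Definition _ := gen_choiceMixin germs.

Lemma germsP (s t : germs) : (forall x Ux, s x Ux = t x Ux) -> s = t.
Proof.
by move=> st; apply/functional_extensionality_dep => x;
  apply/functional_extensionality_dep.
Qed.

Definition germs_add (s t : germs) : germs := fun x Ux => s x Ux + t x Ux.
Definition germs_opp (s : germs) : germs := fun x Ux => - s x Ux.
Definition germs_mul (s t : germs) : germs := fun x Ux => s x Ux * t x Ux.
Definition germs0 : germs := fun _ _ => 0.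
Definition germs1 : germs := fun _ _ => 1.

Lemma germs_addA : associative germs_add.
Proof. by move=> r s t; apply: germsP => x Ux; apply: addrA. Qed.
Lemma germs_addC : commutative germs_add.
Proof. by move=> s t; apply: germsP => x Ux; apply: addrC. Qed.
Lemma germs_add0 : left_id germs0 germs_add.
Proof. by move=> s; apply: germsP => x Ux; apply: add0r. Qed.
Lemma germs_addN : left_inverse germs0 germs_opp germs_add.
Proof. by move=> s; apply: germsP => x Ux; apply: addNr. Qed.

HB.instance Definition _ := GRing.isZmodule.Build germs
  germs_addA germs_addC germs_add0 germs_addN.

Lemma germs_mulA : associative germs_mul.
Proof. by move=> r s t; apply: germsP => x Ux; apply: mulrA. Qed.
Lemma germs_mulC : commutative germs_mul.
Proof. by move=> s t; apply: germsP => x Ux; apply: mulrC. Qed.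
Lemma germs_mul1 : left_id germs1 germs_mul.
Proof. by move=> s; apply: germsP => x Ux; apply: mul1r. Qed.
Lemma germs_mulDl : left_distributive germs_mul +%R.
Proof. by move=> r s t; apply: germsP => x Ux; apply: mulrDl. Qed.

HB.instance Definition _ := GRing.Zmodule_isComPzRing.Build germs
  germs_mulA germs_mulC germs_mul1 germs_mulDl.

Definition locally_fraction (s : germs) : Prop :=
  forall x, U x -> exists W : set (Spec R), [/\ open W, W x &
    exists a f : R, forall y (Uy : U y), W y ->
      exists yf : ~ pideal y f, s y Uy = frac a yf].

Definition regular : {pred germs} := fun s => `[< locally_fraction s >].

Lemma regular_subring : subring_closed regular.
Proof.
split.
- apply/asboolP => x Ux; exists setT; split=> //; first exact: openT.
  by exists 1, 1 => y Uy _; exists (denom1P (x := y)).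
- move=> s t /asboolP rs /asboolP rt; apply/asboolP => x Ux.
  have [V [oV Vx [a [f sE]]]] := rs x Ux; have [W [oW Wx [b [g tE]]]] := rt x Ux.
  exists (V `&` W); split=> //; first exact: openI.
  exists (a * g - b * f), (f * g) => y Uy [Vy Wy].
  have [yf sEy] := sE y Uy Vy; have [yg tEy] := tE y Uy Wy.
  have yfg : ~ pideal y (f * g) by case: (pidealP y) => _ _ yM /yM[].
  exists yfg; rewrite -[LHS]/(s y Uy - t y Uy) sEy tEy.
  rewrite -[LHS]/(loc_add _ (loc_opp _)) loc_oppE loc_addE.
  by apply/loc_eqP; exists (denom1 y) => /=; ring.
- move=> s t /asboolP rs /asboolP rt; apply/asboolP => x Ux.
  have [V [oV Vx [a [f sE]]]] := rs x Ux; have [W [oW Wx [b [g tE]]]] := rt x Ux.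
  exists (V `&` W); split=> //; first exact: openI.
  exists (a * b), (f * g) => y Uy [Vy Wy].
  have [yf sEy] := sE y Uy Vy; have [yg tEy] := tE y Uy Wy.
  have yfg : ~ pideal y (f * g) by case: (pidealP y) => _ _ yM /yM[].
  exists yfg; rewrite -[LHS]/(s y Uy * t y Uy) sEy tEy.
  rewrite -[LHS]/(loc_mul _ _) loc_mulE.
  by apply/loc_eqP; exists (denom1 y) => /=; ring.
Qed.

HB.instance Definition _ := GRing.isSubringClosed.Build germs regular
  regular_subring.

Record sections : Type := MkSections {
  section_germs :> germs;
  section_regular : section_germs \in regular
}.

HB.instance Definition _ := [isSub for section_germs].
HB.instance Definition _ := [Choice of sections by <:].
HB.instance Definition _ := GRing.SubChoice_isSubComPzRing.Build germs regular
  sections regular_subring.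

End StructureSheaf.

Section Restriction.
Variables (R : comPzRingType) (U V : set (Spec R)) (VU : V `<=` U).

Definition germs_res (s : germs U) : germs V := fun x Vx => s x (VU Vx).

Lemma germs_res_regular (s : sections U) : germs_res s \in @regular R V.
Proof.
apply/asboolP => x Vx; have /asboolP/(_ x (VU Vx)) := section_regular s.
move=> [W [oW Wx [a [f sE]]]]; exists W; split=> //.
by exists a, f => y Vy Wy; apply: sE.
Qed.

Definition section_res (s : sections U) : sections V :=
  MkSections (germs_res_regular s).

Lemma section_res_zmod : zmod_morphism section_res.
Proof. by move=> s t; apply: val_inj. Qed.
Lemma section_res_monoid : monoid_morphism section_res.
Proof. by split=> [|s t]; apply: val_inj. Qed.

HB.instance Definition _ := GRing.isZmodMorphism.Build (sections U) (sections V)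
  section_res section_res_zmod.
HB.instance Definition _ := GRing.isMonoidMorphism.Build (sections U) (sections V)
  section_res section_res_monoid.

End Restriction.

(* A space with a presheaf of commutative rings.  Only the values of [osec] on
   open sets are meaningful; they are the only ones used in [ringed_iso].  The
   spaces considered below are open subspaces of spectra, on which the presheaf
   is a sheaf with local stalks. *)
Record ringedSpace : Type := RingedSpace {
  points : topologicalType;
  osec : set points -> comPzRingType;
  ores : forall U V : set points, V `<=` U -> {rmorphism osec U -> osec V};
  ores_id : forall (U : set points) (UU : U `<=` U) s, ores UU s = s;
  ores_comp : forall (U V W : set points) (VU : V `<=` U) (WV : W `<=` V)
    (WU : W `<=` U) s, ores WV (ores VU s) = ores WU s
}.
Arguments osec : clear implicits.
Arguments ores X {U V} VU : rename.

Section SpecScheme.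
Variable R : comPzRingType.

Definition spec_res (U V : set (Spec R)) (VU : V `<=` U) :
  {rmorphism sections U -> sections V} := section_res VU.

Lemma spec_res_id (U : set (Spec R)) (UU : U `<=` U) s : spec_res UU s = s.
Proof.
apply: val_inj; apply/functional_extensionality_dep => x.
apply/functional_extensionality_dep => Ux /=.
by rewrite /germs_res (Prop_irrelevance (UU x Ux) Ux).
Qed.

Lemma spec_res_comp (U V W : set (Spec R)) (VU : V `<=` U) (WV : W `<=` V)
  (WU : W `<=` U) s : spec_res WV (spec_res VU s) = spec_res WU s.
Proof.
apply: val_inj; apply/functional_extensionality_dep => x.
apply/functional_extensionality_dep => Wx /=.
by rewrite /germs_res (Prop_irrelevance (VU x (WV x Wx)) (WU x Wx)).
Qed.

Definition SpecScheme : ringedSpace := RingedSpace spec_res_id spec_res_comp.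

End SpecScheme.

Section OpenSubscheme.
Variables (X : ringedSpace) (U : set (points X)).

Definition open_img (V : set U) : set (points X) := set_val @` V.

Definition sub_res (V W : set U) (WV : W `<=` V) :
  {rmorphism osec X (open_img V) -> osec X (open_img W)} := ores X (image_subset set_val WV).

Lemma sub_res_id (V : set U) (VV : V `<=` V) s : sub_res VV s = s.
Proof. exact: ores_id. Qed.

Lemma sub_res_comp (V W Z : set U) (WV : W `<=` V) (ZW : Z `<=` W) (ZV : Z `<=` V) s :
  sub_res ZW (sub_res WV s) = sub_res ZV s.
Proof. exact: ores_comp. Qed.

Definition open_subscheme : ringedSpace := RingedSpace sub_res_id sub_res_comp.

End OpenSubscheme.

(* Between locally ringed spaces, an isomorphism of ringed spaces is
   automatically an isomorphism of locally ringed spaces. *)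
Definition ringed_iso (X Y : ringedSpace) : Prop :=
  exists (f : points X -> points Y) (g : points Y -> points X)
         (h : forall V : set (points Y), open V ->
                {rmorphism osec Y V -> osec X (f @^-1` V)}),
  [/\ cancel f g, cancel g f, continuous f & continuous g] /\
  [/\ forall V (oV : open V), bijective (h V oV) &
      forall (V W : set (points Y)) (oV : open V) (oW : open W) (WV : W `<=` V) s,
        h W oW (ores Y WV s) = ores X (preimage_subset WV) (h V oV s)].

Definition affine_scheme (X : ringedSpace) : Prop :=
  exists B : comPzRingType, ringed_iso X (SpecScheme B).

Definition noetherian (R : comPzRingType) : Prop :=
  forall I : set R, is_ideal I -> exists s : seq R, I = ideal_gen [set` s].

Definition normal_domain (A : idomainType) : Prop :=
  forall z : {fraction A},
    integralOver (@tofrac A) z -> exists a : A, z = tofrac a.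

Definition height_one (R : comPzRingType) : set (Spec R) :=
  [set x : Spec R | (exists y : Spec R, y `<` x) /\
                    ~ (exists y z : Spec R, z `<` y /\ y `<` x)].

Definition ideal_chain (R : comPzRingType) (I : set R) (n : nat) : Prop :=
  exists c : nat -> set R,
    [/\ c 0%N = I, c n = setT &
        forall i, (i < n)%N -> is_ideal (c i) /\ c i `<` c i.+1].

(* The length of the R-module R / I; it is 0 by convention if infinite. *)
Definition colength (R : comPzRingType) (I : set R) : nat :=
  xget 0%N [set n | ideal_chain I n /\ forall m, ideal_chain I m -> (m <= n)%N].

(* The length of R_x / S R_x. *)
Definition mult (R : comPzRingType) (x : Spec R) (S : set R) : nat :=
  colength (ideal_gen (@loc_inj R x @` S)).

Section Divisors.
Variable A : idomainType.

Definition prime_divisor : Type := set_type (@height_one A).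
HB.instance Definition _ := Choice.on prime_divisor.

Definition Div := {freeg prime_divisor / int}.

Definition effective (D : Div) : Prop := forall Y : prime_divisor, 0 <= coeff Y D.

(* [\sum_(Y \in _)] is 0 by convention if infinitely many terms are nonzero;
   this does not happen for a noetherian A and a != 0. *)
Definition div_elt (a : A) : Div :=
  \sum_(Y \in [set: prime_divisor]) << (mult (set_val Y) [set a])%:Z *g Y >>.

Definition principal (D : Div) : Prop :=
  exists a b : A, [/\ a != 0, b != 0 & D = div_elt a - div_elt b].

Definition lin_equiv (D E : Div) : Prop := principal (D - E).

Definition complement (D : Div) : set (Spec A) :=
  [set x | forall Y : prime_divisor, coeff Y D != 0 -> ~ (set_val Y `<=` x)].

Definition coaffine (D : Div) : Prop :=
  forall E, effective E -> lin_equiv E D ->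
    affine_scheme (@open_subscheme (SpecScheme A) (complement E)).

Definition strongly_coaffine (D : Div) : Prop :=
  forall n : int, coaffine (D *~ n) \/ principal (D *~ n).

Definition affine_trivial (D : Div) : Prop :=
  forall E, strongly_coaffine E -> strongly_coaffine (D + E).

Definition affine_trivial_pred : {pred Div} := fun D => `[< affine_trivial D >].

Lemma strongly_coaffineN (D : Div) : strongly_coaffine D -> strongly_coaffine (- D).
Proof. by move=> sD n; rewrite mulNrz -mulrNz; apply: sD. Qed.

Lemma affine_trivial_zmod : zmod_closed affine_trivial_pred.
Proof.
split; first by apply/asboolP => E; rewrite add0r.
move=> D D' /asboolP aD /asboolP aD'; apply/asboolP => E sE.
rewrite -addrA; apply: aD; rewrite -[_ + _]opprK opprD opprK.
by apply: strongly_coaffineN; apply: aD'; apply: strongly_coaffineN.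
Qed.

HB.instance Definition _ := GRing.isZmodClosed.Build Div affine_trivial_pred
  affine_trivial_zmod.

Definition AffCl : zmodType := Quotient.quot affine_trivial_pred.

Definition affcl (D : Div) : AffCl := \pi_(Quotient.quot affine_trivial_pred) D.

End Divisors.

Section Pullback.
Variables (A A' : idomainType) (phi : {rmorphism A -> A'}).

(* The cycle of p^{-1}(Y), Y = V(P): the coefficient of Z = V(Q) is the length
   of A'_Q / P A'_Q, which is 0 unless Z lies in p^{-1}(Y).  By flatness every
   component of p^{-1}(Y) has codimension one, and there are finitely many when
   A' is noetherian, so no component is missed by this sum. *)
Definition pullback_prime (Y : prime_divisor A) : Div A' :=
  \sum_(Z \in [set: prime_divisor A'])
     << (mult (set_val Z) (phi @` set_val Y))%:Z *g Z >>.

Definition pullback (D : Div A) : Div A' := fglift pullback_prime D.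

End Pullback.

Section Tensor.
Variables (R : comNzRingType) (M N : lmodType R).

Local Notation F := {freeg (M * N)%type / int}.

Definition tensor_rel : set F :=
  [set z | (exists m m' n, z = << (m + m', n) >> - << (m, n) >> - << (m', n) >>) \/
           (exists m n n', z = << (m, n + n') >> - << (m, n) >> - << (m, n') >>) \/
           (exists a m n, z = << (a *: m, n) >> - << (m, a *: n) >>)].

Definition tensor_null : {pred F} :=
  fun z => `[< forall S : {pred F},
    zmod_closed S -> (forall r, tensor_rel r -> r \in S) -> z \in S >].

Lemma tensor_null_zmod : zmod_closed tensor_null.
Proof.
split; first by apply/asboolP => S [].
move=> u v /asboolP uS /asboolP vS; apply/asboolP => S SP relS.
by case: (SP) => _; apply; [apply: uS|apply: vS].
Qed.

HB.instance Definition _ := GRing.isZmodClosed.Build F tensor_null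
  tensor_null_zmod.

Definition tensor : zmodType := Quotient.quot tensor_null.

Definition tensor_class (z : F) : tensor := \pi_(Quotient.quot tensor_null) z.

End Tensor.

Section TensorMap.
Variables (R : comNzRingType) (M N N' : lmodType R) (f : {linear N -> N'}).

Definition tensor_fun (z : {freeg (M * N)%type / int}) :
    {freeg (M * N')%type / int} :=
  fglift (fun k => << (k.1, f k.2) >>) z.

Definition tensor_map (u : tensor M N) : tensor M N' :=
  tensor_class (tensor_fun (repr u)).

Lemma tensor_funB : {morph tensor_fun : u v / u - v}.
Proof. exact: lift_is_additive. Qed.

Lemma tensor_fun1 m n : tensor_fun << (m, n) >> = << (m, f n) >>.
Proof. by rewrite /tensor_fun liftU scale1r. Qed.

Lemma tensor_fun_null z :
  z \in @tensor_null R M N -> tensor_fun z \in @tensor_null R M N'.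
Proof.
move=> /asboolP zP; apply: (zP (fun z => tensor_fun z \in @tensor_null R M N')).
- have [n0 nB] := tensor_null_zmod M N'; split=> [|u v uP vP].
    by rewrite unfold_in -(subrr 0) tensor_funB subrr.
  by rewrite unfold_in tensor_funB; apply: nB.
- move=> _ [[m [m' [n ->]]]|[[m [n [n' ->]]]|[a [m [n ->]]]]];
    rewrite unfold_in !tensor_funB !tensor_fun1; apply/asboolP => S _; apply.
  + by left; exists m, m', (f n).
  + by right; left; exists m, (f n), (f n'); rewrite linearD.
  + by right; right; exists a, m, (f n); rewrite linearZ.
Qed.

Lemma tensor_mapE z : tensor_map (tensor_class z) = tensor_class (tensor_fun z).
Proof.
apply/eqP; rewrite -Quotient.idealrBE -tensor_funB.
by apply: tensor_fun_null; rewrite Quotient.idealrBE reprK.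
Qed.

End TensorMap.

Definition exact (L M N : zmodType) (f : L -> M) (g : M -> N) : Prop :=
  forall y : M, g y = 0 <-> exists x : L, f x = y.

(* A sequence of modules is exact if and only if its tensor product with M is. *)
Definition faithfully_flat_module (R : comNzRingType) (M : lmodType R) : Prop :=
  forall (N1 N2 N3 : lmodType R) (f : {linear N1 -> N2}) (g : {linear N2 -> N3}),
    exact f g <-> exact (@tensor_map R M _ _ f) (@tensor_map R M _ _ g).

Definition restrict_scalars (A A' : comNzRingType) (phi : {rmorphism A -> A'}) :
  Type := A'.

Section RestrictScalars.
Variables (A A' : comNzRingType) (phi : {rmorphism A -> A'}).

HB.instance Definition _ := GRing.Zmodule.on (restrict_scalars phi).

Definition restrict_scale (a : A) (x : restrict_scalars phi) :
  restrict_scalars phi := phi a * (x : A').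

Lemma restrict_scaleA a b v :
  restrict_scale a (restrict_scale b v) = restrict_scale (a * b) v.
Proof. by rewrite /restrict_scale rmorphM mulrA. Qed.
Lemma restrict_scale1 : left_id 1 restrict_scale.
Proof. by move=> v; rewrite /restrict_scale rmorph1 mul1r. Qed.
Lemma restrict_scaleDr : right_distributive restrict_scale +%R.
Proof. by move=> a u v; apply: mulrDr. Qed.
Lemma restrict_scaleDl v : {morph restrict_scale^~ v : a b / a + b}.
Proof. by move=> a b; rewrite /restrict_scale rmorphD mulrDl. Qed.

HB.instance Definition _ := GRing.Zmodule_isLmodule.Build A
  (restrict_scalars phi) restrict_scaleA restrict_scale1 restrict_scaleDr
  restrict_scaleDl.

End RestrictScalars.

Definition faithfully_flat (A A' : comNzRingType) (phi : {rmorphism A -> A'}) :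
  Prop := faithfully_flat_module (restrict_scalars phi).

(* Main.v *)
(** For a divisor [D] of a normal domain [A] put [M_n = H^0(Spec A, O(nD))].  The
    effective divisors linearly equivalent to [D] are the divisors of the sections
    [s] of [M_1], and the complement of [div s] is affine if and only if [s ^ n]
    lies in [M_(-1) M_(n+1)] for some [n >= 0].  The [M_(-1) M_(n+1)] form an ideal
    of the graded ring of the [M_n], so [D] is coaffine if and only if [M_1] lies
    in the radical of this ideal, which can be tested on generators of [M_1].  In
    particular principal divisors are coaffine.  As [A'] is flat over [A], the
    sections of the pull-back of [nD] are [M_n A'], so the condition ascends to
    [A']; it descends because ideals of [A] are contracted from [A'].  Hence [D] is
    strongly coaffine if and only if its pull-back is, and since every divisor of
    [A'] is linearly equivalent to a pull-back, the same holds for affine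
    triviality. *)

From HB Require Import structures.
From mathcomp Require Import all_boot all_order all_algebra.
From mathcomp Require Import ring_quotient generic_quotient.
From mathcomp Require Import all_classical topology.
From mathcomp Require Import finmap ring zify.
Require Import Defs.

Set Implicit Arguments.
Unset Strict Implicit.
Unset Printing Implicit Defensive.

Import GRing.Theory Num.Theory Order.TTheory.

Local Open Scope classical_set_scope.
Local Open Scope ring_scope.


(** * Ideals and prime ideals *)

(** An effective divisor linearly equivalent to a pull-back need not be a pull-back, so coaffineness
    cannot be compared one effective divisor at a time: base change of an affine complement only
    reaches the sections coming from [A]. Collecting all sections in one radical condition removes
    this obstacle, the elements satisfying it being an ideal and [M_1 A'] being generated by [M_1].
    Only ideals of [A] are used, no fractional ones. For this [D] is traded for an effective [F]
    linearly equivalent to [-D], so that [M_n] is, up to isomorphism, the ideal of [n F] for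
    [n >= 0], and [M_(-1)] is multiplied by an element [b] of the ideal of [F]. Normality enters
    through [A] being the intersection of its localizations at height one primes. It makes the ideal
    of [F] the colon ideal of [b] by the ideal of [div b - F]; a colon ideal is cut out by finitely
    many linear equations, which is why it commutes with flat extension. The same fact shows that a
    height one prime of [A'] contracts to zero or to a height one prime, so that orders on [A']
    restrict to multiples of orders on [A]. *)

Lemma properI_elt (T : Type) (I J : set T) a :
  I `<=` J -> J a -> ~ I a -> I `<` J.
Proof. by move=> IJ Ja Ia; split=> // /(_ a Ja). Qed.

Section Ideals.
Variable R : comPzRingType.
Implicit Types (I J S : set R) (x : Spec R).

Lemma ideal0 I : is_ideal I -> I 0. Proof. by case. Qed.
Lemma idealD I a b : is_ideal I -> I a -> I b -> I (a + b).
Proof. by case=> _ h _; apply: h. Qed.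
Lemma idealMl I a b : is_ideal I -> I b -> I (a * b).
Proof. by case=> _ _ h; apply: h. Qed.
Lemma idealMr I a b : is_ideal I -> I a -> I (a * b).
Proof. by rewrite mulrC; apply: idealMl. Qed.
Lemma ideal_sum I (T : Type) (r : seq T) (P : pred T) (F : T -> R) :
  is_ideal I -> (forall i, P i -> I (F i)) -> I (\sum_(i <- r | P i) F i).
Proof.
by move=> iI h; apply: (big_ind I); [apply: ideal0|move=> a b; apply: idealD|].
Qed.

Lemma pideal_ideal x : is_ideal x. Proof. by case: (pidealP x). Qed.
Lemma pideal_0 x : pideal x 0. Proof. exact: ideal0 (pideal_ideal x). Qed.
Lemma pideal_1 x : ~ pideal x 1. Proof. by case: (pidealP x). Qed.
Lemma pideal_M x a b : pideal x (a * b) -> pideal x a \/ pideal x b.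
Proof. by case: (pidealP x) => _ _; apply. Qed.
Lemma pideal_NM x a b : ~ pideal x a -> ~ pideal x b -> ~ pideal x (a * b).
Proof. by move=> na nb /pideal_M[]. Qed.
Lemma pideal_NX x a n : ~ pideal x a -> ~ pideal x (a ^+ n).
Proof.
move=> na; elim: n => [|n ih]; first by rewrite expr0; apply: pideal_1.
by rewrite exprS; apply: pideal_NM.
Qed.

Lemma Spec_eq (P Q : Spec R) : (forall a, pideal P a <-> pideal Q a) -> P = Q.
Proof.
case: P Q => [P Pp] [Q Qp] /= PQ.
have e : P = Q by apply/seteqP; split=> a /PQ.
by subst Q; congr MkSpec; apply: Prop_irrelevance.
Qed.

Lemma ideal_gen_ideal S : is_ideal (ideal_gen S).
Proof.
split=> [I [iI _]|a b Sa Sb I SI|a b Sb I SI]; first exact: ideal0.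
- by apply: idealD; [case: SI|apply: Sa|apply: Sb].
- by apply: idealMl; [case: SI|apply: Sb].
Qed.

Lemma sub_ideal_gen S : S `<=` ideal_gen S.
Proof. by move=> a Sa I [_]; apply. Qed.

Lemma ideal_gen_min S I : is_ideal I -> S `<=` I -> ideal_gen S `<=` I.
Proof. by move=> iI SI a; apply. Qed.

Lemma ideal_genS S S' : S `<=` S' -> ideal_gen S `<=` ideal_gen S'.
Proof.
move=> SS'; apply: ideal_gen_min; first exact: ideal_gen_ideal.
by move=> a /SS'; apply: sub_ideal_gen.
Qed.

Lemma ideal_genP S a : ideal_gen S a -> exists n (c s : 'I_n -> R),
  (forall i, S (s i)) /\ a = \sum_i c i * s i.
Proof.
apply: (ideal_gen_min (I := [set a | exists n (c s : 'I_n -> R),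
  (forall i, S (s i)) /\ a = \sum_i c i * s i])); last first.
  move=> s Ss; exists 1%N, (fun=> 1), (fun=> s).
  by rewrite big_ord1 mul1r.
split=> [|_ _ [n [c [s [Ss ->]]]] [m [d [t [St ->]]]]|r _ [n [c [s [Ss ->]]]]].
- by exists 0%N, (fun=> 0), (fun=> 0); split=> [[]|]//; rewrite big_ord0.
- exists (n + m)%N.
  exists (fun i => match fintype.split i with inl j => c j | inr j => d j end).
  exists (fun i => match fintype.split i with inl j => s j | inr j => t j end).
  split=> [i|]; first by case: (fintype.split i).
  rewrite big_split_ord /=; congr (_ + _); apply: eq_bigr => i _.
    by rewrite (unsplitK (inl i)).
  by rewrite (unsplitK (inr i)).
- exists n, (fun i => r * c i), s; split=> //.
  by rewrite big_distrr /=; apply: eq_bigr => i _; rewrite mulrA.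
Qed.

Lemma ideal_bigcup (F : set (set R)) : F !=set0 ->
  (forall I, F I -> is_ideal I) -> total_on F subset -> is_ideal (\bigcup_(I in F) I).
Proof.
move=> [I0 FI0] iF tF; split.
- by exists I0 => //; exact: (ideal0 (iF _ FI0)).
- move=> a b [I FI Ia] [J FJ Jb]; case: (tF _ _ FI FJ) => sub.
    by exists J => //; apply: idealD => //; [apply: iF|apply: sub].
  by exists I => //; apply: idealD => //; [apply: iF|apply: sub].
- by move=> a b [I FI Ib]; exists I => //; apply: idealMl => //; apply: iF.
Qed.

Lemma ideal_add_elt I a : is_ideal I ->
  is_ideal [set b | exists i r, I i /\ b = i + r * a].
Proof.
move=> iI; split.
- by exists 0, 0; split; [apply: ideal0|ring].
- move=> _ _ [i [r [Ii ->]]] [j [s [Ij ->]]].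
  by exists (i + j), (r + s); split; [apply: idealD|ring].
- move=> c _ [i [r [Ii ->]]]; exists (c * i), (c * r).
  by split; [apply: idealMl|ring].
Qed.

(** An ideal maximal among those containing [I] and missing the multiplicative set [S] is prime. *)
Lemma prime_avoiding I S : is_ideal I -> S 1 ->
  (forall a b, S a -> S b -> S (a * b)) -> (forall a, S a -> ~ I a) ->
  exists x : Spec R, I `<=` x /\ forall s, S s -> ~ pideal x s.
Proof.
move=> iI S1 SM SI.
pose P := [set J : set R | J = set0 \/
  [/\ is_ideal J, I `<=` J & forall a, S a -> ~ J a]].
have [F FP totF|M [PM Mmax]] := @Zorn_bigcup _ P.
  have [F0|/existsNP[J /not_implyP[FJ J0]]] :=
    pselect (forall J, F J -> J = set0).
    left; apply/seteqP; split=> // a [J FJ]; by rewrite (F0 _ FJ).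
  right; pose F' := [set K | F K /\ K !=set0].
  have F'F : F' `<=` F by move=> K [].
  have UE : \bigcup_(K in F) K = \bigcup_(K in F') K.
    apply/seteqP; split=> a [K FK Ka]; exists K => //; first by split=> //; exists a.
    by case: FK.
  have F'P K : F' K -> [/\ is_ideal K, I `<=` K & forall a, S a -> ~ K a].
    by case=> FK [a Ka]; case: (FP _ FK) => // K0; move: Ka; rewrite K0.
  have F'J : F' J by split=> //; apply/set0P/eqP.
  rewrite UE; split.
  - apply: ideal_bigcup => [|K F'K|K L F'K F'L]; first by exists J.
      by case: (F'P _ F'K).
    by apply: totF; apply: F'F.
  - by move=> a Ia; exists J => //; case: (F'P _ F'J) => _ + _; apply.
  - by move=> a Sa [K F'K Ka]; case: (F'P _ F'K) => _ _ /(_ a Sa); apply.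
case: PM => [M0|[iM IM MS]].
  have : M `<` I.
    by rewrite M0; apply: (properI_elt (a := 0)) => //; apply: ideal0.
  by move=> /Mmax[]; right; split.
have big a : ~ M a -> exists s m r, [/\ S s, M m & s = m + r * a].
  move=> nMa; pose J := [set b | exists i r, M i /\ b = i + r * a].
  have : M `<` J.
    apply: (properI_elt (a := a)) => // [m Mm|].
      by exists m, 0; split=> //; ring.
    by exists 0, 1; split; [apply: ideal0|ring].
  move=> /Mmax nPJ; apply: contrapT => no; apply: nPJ; right; split.
  - exact: ideal_add_elt.
  - by move=> b /IM Mb; exists b, 0; split=> //; ring.
  - by move=> s Ss [m [r [Mm sE]]]; apply: no; exists s, m, r.
have pM : is_prime_ideal M.
  split=> //; first exact: MS.
  move=> a b Mab; apply: contrapT => /not_orP[nMa nMb].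
  have [s [m [r [Ss Mm sE]]]] := big a nMa.
  have [t [n [q [St Mn tE]]]] := big b nMb.
  apply: (MS (s * t)); first exact: SM.
  have -> : s * t = m * t + (r * a * n + r * q * (a * b)) by rewrite sE tE; ring.
  apply: idealD => //; first exact: idealMr.
  by apply: idealD => //; apply: idealMl.
by exists (MkSpec pM).
Qed.

(** The union of a chain is finitely generated, and its generators already lie in one member of the
    chain, which is therefore the union. The empty set joins the family only to serve the empty
    chain. *)
Lemma noetherian_max (F : set (set R)) : noetherian R -> F !=set0 ->
  (forall I, F I -> is_ideal I) ->
  exists I, F I /\ forall J, F J -> I `<=` J -> J = I.
Proof.
move=> nR [I0 FI0] iF.
pose P := [set J | J = set0 \/ F J].
have [G GP totG|M [PM Mmax]] := @Zorn_bigcup _ P.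
  have [G0|/existsNP[J /not_implyP[GJ J0]]] :=
    pselect (forall J, G J -> J = set0).
    left; apply/seteqP; split=> // a [J GJ]; by rewrite (G0 _ GJ).
  right; pose G' := [set K | G K /\ K !=set0].
  have UE : \bigcup_(K in G) K = \bigcup_(K in G') K.
    apply/seteqP; split=> a [K GK Ka]; exists K => //; first by split=> //; exists a.
    by case: GK.
  have G'F K : G' K -> F K.
    by case=> GK [a Ka]; case: (GP _ GK) => // K0; move: Ka; rewrite K0.
  have G'J : G' J by split=> //; apply/set0P/eqP.
  rewrite UE; set U := \bigcup_(_ in _) _.
  have totG' : total_on G' subset by move=> K L [GK _] [GL _]; apply: totG.
  have iU : is_ideal U.
    by apply: ideal_bigcup => //; [exists J|move=> K /G'F/iF].
  have [s sE] := nR _ iU.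
  have sU a : a \in s -> U a by move=> sa; rewrite sE; apply: sub_ideal_gen.
  have [K G'K sK] : exists2 K, G' K & forall a, a \in s -> K a.
    elim: s sU {sE} => [|a s ih] sU; first by exists J.
    have [K G'K sK] : exists2 K, G' K & forall a, a \in s -> K a.
      by apply: ih => b sb; apply: sU; rewrite in_cons sb orbT.
    have [L G'L La] := sU a (mem_head _ _).
    case: (totG' _ _ G'K G'L) => sub; [exists L|exists K] => // b;
      rewrite in_cons => /orP[/eqP->|/sK]//; [exact: sub|exact: sub].
  suff -> : U = K by apply: G'F.
  apply/seteqP; split=> [|a Ka]; last by exists K.
  by rewrite sE; apply: ideal_gen_min => //; apply/iF/G'F.
case: PM => [M0|FM].
  have : M `<` I0.
    by rewrite M0; apply: (properI_elt (a := 0)) => //; exact: (ideal0 (iF _ FI0)).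
  by move=> /Mmax[]; right.
exists M; split=> // J FJ MJ; apply: contrapT => JM.
apply: (Mmax J); last by right.
by rewrite properEneq; split=> //; apply/eqP => e; apply: JM.
Qed.

End Ideals.

(** * Normal noetherian domains *)

Definition divides (A : idomainType) (b a : A) : Prop := exists c, a = c * b.

Section Domain.
Variable A : idomainType.
Implicit Types (P : Spec A) (a b c x y p q : A).

Lemma divides_ideal b : is_ideal [set a | divides b a].
Proof.
split=> [|_ _ [c ->] [d ->]|r _ [c ->]]; first by exists 0; rewrite mul0r.
- by exists (c + d); rewrite mulrDl.
- by exists (r * c); rewrite mulrA.
Qed.

Lemma colon_ideal b a : is_ideal [set c | divides b (c * a)].
Proof.
split=> [|r s [c e] [d e']|r s [c e]].
- by exists 0; rewrite !mul0r.
- by exists (c + d); rewrite !mulrDl e e'.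
- by exists (r * c); rewrite -!mulrA e.
Qed.

Lemma zero_prime : is_prime_ideal [set 0 : A].
Proof.
split=> [|/eqP|a b /= /eqP]; last 2 first.
- by rewrite oner_eq0.
- by rewrite mulf_eq0 => /orP[]/eqP; [left|right].
split=> [|a b -> ->|r a ->]//=; first by rewrite addr0.
by rewrite mulr0.
Qed.

Definition generic : Spec A := MkSpec zero_prime.

Lemma generic_proper P a : pideal P a -> a != 0 -> generic `<` P.
Proof.
move=> Pa a0; apply: (properI_elt (a := a)) => //= [_ ->|/eqP].
  exact: pideal_0.
by apply/negP.
Qed.

Lemma height_one_neq0 P : height_one P -> exists2 b, pideal P b & b != 0.
Proof.
case=> -[Q [QP PQ]] _; apply: contrapT => no; apply: PQ => b Pb.
have [->|b0] := eqVneq b 0; first exact: pideal_0.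
by case: no; exists b.
Qed.

Lemma height_one_sub (P Q : Spec A) : height_one P -> Q `<=` P ->
  (exists2 b, pideal Q b & b != 0) -> Q = P.
Proof.
case=> _ no QP [b Qb b0]; apply: Spec_eq => a; split=> [/QP//|Pa].
apply: contrapT => nQa; apply: no; exists Q, generic; split.
  exact: generic_proper Qb b0.
exact: properI_elt Pa nQa.
Qed.

Hypotheses (noethA : noetherian A) (normA : normal_domain A).

(* If [a / b] is almost integral then it is integral, the powers of [a / b]
   lying in the finite module [x^-1 A]. *)
Lemma almost_integral a b x : b != 0 -> x != 0 ->
  (forall n, exists y, a ^+ n * x = b ^+ n * y) -> divides b a.
Proof.
move=> b0 x0 /choice[y yE].
(* Here [y i] is [(a / b) ^ i x]. A maximal [J N] contains [y N], and dividing this relation by [x]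
   gives a monic equation for [a / b]. *)
pose J N := [set r | exists c : nat -> A, r = \sum_(i < N) c i * y i].
have iJ N : is_ideal (J N).
  split=> [|_ _ [c ->] [d ->]|r _ [c ->]].
  - by exists (fun=> 0); rewrite big1// => i _; rewrite mul0r.
  - exists (fun i => c i + d i); rewrite -big_split /=.
    by apply: eq_bigr => i _; rewrite mulrDl.
  - exists (fun i => r * c i); rewrite big_distrr /=.
    by apply: eq_bigr => i _; rewrite mulrA.
have [|_ [N _ <-]|_ [[N _ <-] Nmax]] := @noetherian_max _ [set J N | N in setT] noethA.
- by exists (J 0%N), 0%N.
- exact: iJ.
have : J N (y N).
  rewrite -(Nmax (J N.+1)); last 2 first.
  - by exists N.+1.
  - move=> _ [c ->]; exists (fun i => if (i < N)%N then c i else 0).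
    rewrite big_ord_recr /= ltnn mul0r addr0.
    by apply: eq_bigr => i _; rewrite ltn_ord.
  exists (fun i => (i == N)%:R); rewrite big_ord_recr /= eqxx mul1r big1 ?add0r//.
  by move=> i _; rewrite ltn_eqF// mul0r.
move=> [c yN].
pose f : {rmorphism A -> {fraction A}} := @tofrac A; pose z := f a / f b.
have fb0 : f b != 0 by rewrite tofrac_eq0.
have fx0 : f x != 0 by rewrite tofrac_eq0.
have yz n : f (y n) = z ^+ n * f x.
  apply: (mulfI (expf_neq0 n fb0)); rewrite mulrA -exprMn [f b * z]mulrC.
  by rewrite /z divfK// -!rmorphXn -!rmorphM mulrC yE mulrC.
have zN : z ^+ N = \sum_(i < N) f (c i) * z ^+ i.
  apply: (mulIf fx0); rewrite -yz yN rmorph_sum big_distrl /=.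
  by apply: eq_bigr => i _; rewrite rmorphM yz mulrA.
have [|d zd] := normA (z := z).
  exists ('X^N - \poly_(i < N) c i).
    rewrite monicE lead_coefDl ?lead_coefXn// size_polyN size_polyXn ltnS.
    exact: size_poly.
  rewrite /root poly_def rmorphB /= map_polyXn rmorph_sum /= hornerD hornerN.
  rewrite hornerXn horner_sum zN subr_eq0; apply/eqP/eq_bigr => i _.
  by rewrite map_polyZ map_polyXn hornerZ hornerXn.
exists d; apply/eqP; rewrite -(tofrac_eq a) rmorphM /=; apply/eqP.
by rewrite -[RHS]/(f d * f b) -[f d]zd /z divfK.
Qed.


(** Multiplication by [a / b] maps [I] to itself, so all [(a / b) ^ n q] lie in [I] and [a / b] is
    almost integral with common denominator [q]. *)
Lemma stable_divides (I : set A) a b q : b != 0 -> I q -> q != 0 ->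
  (forall r, I r -> exists2 s, I s & a * r = b * s) -> divides b a.
Proof.
move=> b0 Iq q0 stab; apply: (almost_integral b0 q0) => n.
suff [y _ e] : exists2 y, I y & a ^+ n * q = b ^+ n * y by exists y.
elim: n => [|n [y Iy e]]; first by exists q; rewrite ?expr0.
have [s Is e'] := stab y Iy; exists s => //.
by rewrite !exprS -mulrA e mulrCA e' mulrCA mulrA.
Qed.

(** The ideal [(a / b) P] of [A] is not contained in [P]: otherwise [a / b] would stabilize [P],
    hence lie in [A], and [P] would contain 1. The resulting [p] generates [P A_P], for [r a = s b]
    implies [u r = s p]. *)
Lemma colon_uniformizer P a b : b != 0 ->
  (forall c, pideal P c <-> divides b (c * a)) ->
  exists p u, [/\ pideal P p, ~ pideal P u & a * p = u * b].
Proof.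
move=> b0 PE; apply: contrapT => no.
have Pb : pideal P b by apply/PE; exists a; rewrite mulrC.
apply: (@pideal_1 _ P); apply/PE; rewrite mul1r.
apply: (stable_divides b0 Pb b0) => r Pr.
have [s e] := (PE r).1 Pr; exists s; last by rewrite mulrC e mulrC.
apply: contrapT => Ps; apply: no; exists r, s; split=> //.
by rewrite mulrC.
Qed.

(** Let [Q] be a nonzero prime strictly below [P]. It misses [p], because [u r = s p] whenever
    [r a = s b]; the same equation then shows that [a / b] stabilizes [Q], so that [a / b] lies in
    [A] and [P] contains 1. *)
Lemma colon_height_one P a b : b != 0 ->
  (forall c, pideal P c <-> divides b (c * a)) -> height_one P.
Proof.
move=> b0 PE.
have Pb : pideal P b by apply/PE; exists a; rewrite mulrC.
split; first by exists generic; apply: generic_proper Pb b0.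
have [p [u [Pp Pu e]]] := colon_uniformizer b0 PE.
case=> Q [Z [[ZQ nQZ] [QP nPQ]]].
have [q Qq q0] : exists2 q, pideal Q q & q != 0.
  apply: contrapT => no; apply: nQZ => q Qq.
  have [->|q0] := eqVneq q 0; first exact: pideal_0.
  by case: no; exists q.
have nQp : ~ pideal Q p.
  move=> Qp; apply: nPQ => r Pr; have [s e'] := (PE r).1 Pr.
  have : pideal Q (u * r).
    suff -> : u * r = s * p by apply: idealMl => //; apply: pideal_ideal.
    apply: (mulIf b0); transitivity (r * a * p); last by rewrite e'; ring.
    by rewrite -mulrA e; ring.
  by case/pideal_M => // /QP.
apply: (@pideal_1 _ P); apply/PE; rewrite mul1r.
apply: (stable_divides b0 Qq q0) => r Qr.
have [s e'] := (PE r).1 (QP r Qr); exists s; last by rewrite mulrC e' mulrC.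
have : pideal Q (s * p).
  suff -> : s * p = u * r by apply: idealMl => //; apply: pideal_ideal.
  apply: (mulIf b0); transitivity (r * a * p); first by rewrite e'; ring.
  by rewrite -mulrA e; ring.
by case/pideal_M.
Qed.

(* A maximal colon ideal [(b : a)] among those with [a] not in [b A_P] is prime. *)
Lemma height_one_colon P b : height_one P -> pideal P b -> b != 0 ->
  exists a, forall c, pideal P c <-> divides b (c * a).
Proof.
move=> hP Pb b0.
pose loc_div a := exists2 t, ~ pideal P t & divides b (t * a).
pose F := [set I | exists2 a, ~ loc_div a & I = [set c | divides b (c * a)]].
have [||I [[a na ->] Imax]] := @noetherian_max _ F noethA.
- exists [set c | divides b (c * 1)], 1 => // -[t Pt [c]].
  by rewrite mulr1 => e; apply: Pt; rewrite e; apply: idealMl => //; apply: pideal_ideal.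
- by move=> _ [a _ ->]; apply: colon_ideal.
have Imax' c J : F J -> [set c | divides b (c * a)] `<=` J -> J c -> divides b (c * a).
  by move=> FJ sub; rewrite (Imax J FJ sub).
have pI : is_prime_ideal [set c | divides b (c * a)].
  split; first exact: colon_ideal.
    by move=> d; apply: na; exists 1 => //; apply: pideal_1.
  move=> x y /= dxy; apply: contrapT => /not_orP[nx ny]; apply: nx.
  (* Either some [t] outside [P] brings [y a] into [b A], and then by maximality
     [(b : t a) = (b : a)], which contains [y]; or [(b : y a)] belongs to the family, equals
     [(b : a)] and contains [x]. *)
  have [[t Pt [d e]]|ny'] := pselect (loc_div (y * a)).
    case: ny; apply: (Imax' y [set c | divides b (c * (t * a))]).
    - exists (t * a) => // -[s Ps [d' e']]; apply: na.
      by exists (s * t); [apply: pideal_NM|exists d'; rewrite -e' mulrA].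
    - by move=> c [d' e']; exists (t * d'); rewrite mulrCA e' mulrA.
    - by exists d; rewrite -e; ring.
  apply: (Imax' x [set c | divides b (c * (y * a))]); first by exists (y * a).
    by move=> c [d' e']; exists (y * d'); rewrite mulrCA e' mulrA.
  by rewrite /= mulrA.
have PE : MkSpec pI = P.
  apply: height_one_sub => //.
    move=> c /= dc; apply: contrapT => nPc; apply: na; by exists c.
  by exists b => //=; exists a; rewrite mulrC.
by exists a => c; rewrite -PE.
Qed.

(* The equation says that [x] is [p ^+ n] times a unit of [A_P]. *)
Lemma dvr P : height_one P -> exists2 p, pideal P p & forall x, x != 0 ->
  exists n t y, [/\ ~ pideal P t, ~ pideal P y & t * x = p ^+ n * y].
Proof.
move=> hP; have [b Pb b0] := height_one_neq0 hP.
have [a PE] := height_one_colon hP Pb b0.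
have [p [u [Pp Pu e]]] := colon_uniformizer b0 PE.
exists p => // x x0.
(* As [a / b = u / p], multiplying [x] by [a / b] divides it by [p] up to a unit. The result leaves
   [P] at some stage, since otherwise [a / b] would be almost integral with denominator [x]. *)
have [n [y Py e']] : exists n, exists2 y, ~ pideal P y & a ^+ n * x = b ^+ n * y.
  apply: contrapT => no; apply: (@pideal_1 _ P); apply/PE; rewrite mul1r.
  apply: (almost_integral b0 x0) => n.
  suff [y _ e'] : exists2 y, pideal P y & a ^+ n * x = b ^+ n * y by exists y.
  elim: n => [|n [y Py e']].
    exists x; last by rewrite !expr0.
    by apply: contrapT => Px; apply: no; exists 0%N, x; rewrite ?expr0.
  have [s es] := (PE y).1 Py.
  have e'' : a ^+ n.+1 * x = b ^+ n.+1 * s.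
    by rewrite !exprS -mulrA e' mulrCA (mulrC a) es; ring.
  by exists s => //; apply: contrapT => Ps; apply: no; exists n.+1, s.
exists n, (u ^+ n), y; split=> //; first exact: pideal_NX.
apply: (mulfI (expf_neq0 n b0)).
transitivity ((u * b) ^+ n * x); first by rewrite exprMn; ring.
by rewrite -e exprMn mulrAC e'; ring.
Qed.

(* A maximal proper ideal of the form [(x : y c)] is prime. *)
Lemma divides_colon x y : x != 0 -> ~ divides x y ->
  exists (P : Spec A) c, height_one P /\ forall r, pideal P r <-> divides x (r * (c * y)).
Proof.
move=> x0 nxy.
pose F := [set I | exists2 c, ~ divides x (c * y) &
                              I = [set r | divides x (r * (c * y))]].
have [||I [[c nc ->] Imax]] := @noetherian_max _ F noethA.
- by exists [set r | divides x (r * (1 * y))], 1; rewrite ?mul1r.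
- by move=> _ [a _ ->]; apply: colon_ideal.
have Imax' r J : F J -> [set r | divides x (r * (c * y))] `<=` J -> J r ->
  divides x (r * (c * y)) by move=> FJ sub; rewrite (Imax J FJ sub).
have pI : is_prime_ideal [set r | divides x (r * (c * y))].
  split; [exact: colon_ideal|by rewrite /= mul1r|].
  move=> r s /= drs; have [ns|ns] := pselect (divides x (s * (c * y))); first by right.
  left; apply: (Imax' r [set r | divides x (r * (s * c * y))]).
  - by exists (s * c) => //; rewrite -mulrA.
  - by move=> q [d e]; exists (s * d); rewrite -!mulrA [q * _]mulrCA e.
  - by rewrite /= !mulrA in drs *.
exists (MkSpec pI), c; split=> //; exact: (@colon_height_one _ (c * y) x).
Qed.

(** Noetherian induction. A nonzero ideal maximal among those below infinitely many height one
    primes is not prime, since a nonzero prime inside a height one prime equals it. If it contains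
    [x y] but neither factor, the primes above it lie above one of the larger ideals obtained by
    adding [x] or [y]. *)
Lemma finite_height_one a : a != 0 ->
  finite_set [set Y : prime_divisor A | pideal (set_val Y) a].
Proof.
move=> a0.
pose V (I : set A) := [set Y : prime_divisor A | I `<=` set_val Y].
apply: contrapT => nfin.
pose F := [set I : set A | [/\ is_ideal I, exists2 b, I b & b != 0 & ~ finite_set (V I)]].
have [||I [[iI [b Ib b0] nfI] Imax]] := @noetherian_max _ F noethA.
- exists [set c | divides a c]; split; first exact: divides_ideal.
    by exists a => //; exists 1; rewrite mul1r.
  apply: contra_not nfin; apply: sub_finite_set => Y Ya c [d ->].
  by apply: idealMl => //; apply: pideal_ideal.
- by move=> I [].
have Iadd x : ~ I x -> finite_set (V [set c | exists i r, I i /\ c = i + r * x]).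
  move=> nIx; apply: contrapT => nf; apply: nIx.
  suff <- : [set c | exists i r, I i /\ c = i + r * x] = I.
    by exists 0, 1; split; [apply: ideal0|ring].
  apply: Imax.
  - split=> //; first exact: ideal_add_elt.
    by exists b => //; exists b, 0; split=> //; ring.
  - by move=> c Ic; exists c, 0; split=> //; ring.
apply: nfI; have [I1|I1] := pselect (I 1).
  rewrite [V I](_ : _ = set0); first exact: finite_set0.
  by apply/seteqP; split=> // Y /(_ 1 I1) /pideal_1.
have [pI|npI] := pselect (is_prime_ideal I).
  have [hI|hI] := pselect (height_one (MkSpec pI)); last first.
    rewrite [V I](_ : _ = set0); first exact: finite_set0.
    apply/seteqP; split=> // Y IY; apply: hI.
    have -> : MkSpec pI = set_val Y; last exact: set_valP.
    by apply: height_one_sub => //; [apply: set_valP|exists b].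
  apply: (sub_finite_set (B := [set (SigSub (mem_set hI) : prime_divisor A)]));
    last exact: finite_set1.
  move=> Y IY /=; apply: val_inj => /=; apply/esym.
  by apply: height_one_sub => //; [apply: set_valP|exists b].
have [x [y [Ixy nIx nIy]]] : exists x y, [/\ I (x * y), ~ I x & ~ I y].
  apply: contrapT => no; apply: npI; split=> // x y Ixy.
  by apply: contrapT => /not_orP[nx ny]; apply: no; exists x, y.
apply: sub_finite_set (_ : finite_set (V [set c | exists i r, I i /\ c = i + r * x] `|`
    V [set c | exists i r, I i /\ c = i + r * y])); last first.
  by rewrite finite_setU; split; apply: Iadd.
move=> Y IY; case: (pideal_M (IY _ Ixy)) => Yx; [left|right] => _ [i [r [Ii ->]]];
  (apply: idealD; [exact: pideal_ideal|exact: IY|]);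
  by apply: idealMl => //; apply: pideal_ideal.
Qed.

End Domain.

(** * Multiplicities and discrete valuations *)

Section LocalizationTheory.
Variables (R : comPzRingType) (P : Spec R).

Lemma fracM a b f g (Pf : ~ pideal P f) (Pg : ~ pideal P g) :
  frac a Pf * frac b Pg = frac (a * b) (pideal_NM Pf Pg).
Proof.
rewrite -[LHS]/(loc_mul _ _) /frac loc_mulE.
by apply/loc_eqP; exists (denom1 P).
Qed.

Lemma fracD a b f g (Pf : ~ pideal P f) (Pg : ~ pideal P g) :
  frac a Pf + frac b Pg = frac (a * g + b * f) (pideal_NM Pf Pg).
Proof.
rewrite -[LHS]/(loc_add _ _) /frac loc_addE.
by apply/loc_eqP; exists (denom1 P).
Qed.

Lemma fracP (u : loc P) : exists a f (Pf : ~ pideal P f), u = frac a Pf.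
Proof.
have [a [f ->]] := locP u; exists a, f, (@denomP _ _ f).
by apply/loc_eqP; exists (denom1 P).
Qed.

Lemma frac_eqP a b f g (Pf : ~ pideal P f) (Pg : ~ pideal P g) :
  frac a Pf = frac b Pg <-> exists2 w, ~ pideal P w & w * (a * g) = w * (b * f).
Proof.
rewrite /frac loc_eqP /=; split=> [[w e]|[w Pw e]].
  by exists w => //; apply: denomP.
by exists (MkDenom Pw).
Qed.

Lemma loc_injM a b : loc_inj P (a * b) = loc_inj P a * loc_inj P b.
Proof. by rewrite fracM; apply/frac_eqP; exists 1; [apply: pideal_1|ring]. Qed.

Lemma loc_injD a b : loc_inj P (a + b) = loc_inj P a + loc_inj P b.
Proof. by rewrite fracD; apply/frac_eqP; exists 1; [apply: pideal_1|ring]. Qed.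

Lemma loc_inj1 : loc_inj P 1 = 1. Proof. by []. Qed.

End LocalizationTheory.

Lemma frac_eqE (A : idomainType) (P : Spec A) a b f g
    (Pf : ~ pideal P f) (Pg : ~ pideal P g) :
  frac a Pf = frac b Pg <-> a * g = b * f.
Proof.
split=> [/frac_eqP[w Pw /mulfI]|e]; last by apply/frac_eqP; exists 1; [apply: pideal_1|rewrite e].
by apply; apply/eqP => w0; apply: Pw; rewrite w0; apply: pideal_0.
Qed.

Lemma colengthE (R : comPzRingType) (I : set R) n : ideal_chain I n ->
  (forall m, ideal_chain I m -> (m <= n)%N) -> colength I = n.
Proof.
move=> In Imax; apply: xget_unique => // m [Im mmax].
by apply/eqP; rewrite eqn_leq Imax//= mmax.
Qed.

Section Valuation.
Variables (A : idomainType) (P : Spec A) (p : A).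
Hypotheses (Pp : pideal P p) (dvrp : forall x, x != 0 ->
  exists n t y, [/\ ~ pideal P t, ~ pideal P y & t * x = p ^+ n * y]).

Definition has_val n x := exists t y, [/\ ~ pideal P t, ~ pideal P y & t * x = p ^+ n * y].

Lemma pideal_neq0 t : ~ pideal P t -> t != 0.
Proof. by move=> Pt; apply/eqP => t0; apply: Pt; rewrite t0; apply: pideal_0. Qed.

Lemma uniformizer_neq0 : (exists2 b, pideal P b & b != 0) -> p != 0.
Proof.
case=> b Pb b0; have [n [t [y [Pt Py e]]]] := dvrp b0.
case: n e => [|n] e.
  by case: Py; rewrite expr0 mul1r in e; rewrite -e; apply: idealMl => //; apply: pideal_ideal.
apply/eqP => p0; move/eqP: e; rewrite p0 exprS !mul0r mulf_eq0 (negbTE b0) orbF.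
by apply/negP/pideal_neq0.
Qed.

Hypothesis p0 : p != 0.

Lemma has_val_le n m x t y : has_val n x -> ~ pideal P t -> t * x = p ^+ m * y -> (m <= n)%N.
Proof.
move=> [s [z [Ps Pz e]]] Pt e'; rewrite leqNgt; apply/negP => nm.
apply: (pideal_NM Pt Pz).
have -> : t * z = p * (s * y * p ^+ (m - n).-1).
  apply: (mulfI (expf_neq0 n p0)).
  transitivity (t * (p ^+ n * z)); first by ring.
  rewrite -e; transitivity (s * (t * x)); first by ring.
  rewrite e'; have -> : m = (n + (m - n).-1.+1)%N by lia.
  rewrite exprD exprS; have -> : ((n + (m - n).-1.+1) - n).-1 = (m - n).-1 by lia.
  by ring.
by apply: idealMr => //; apply: pideal_ideal.
Qed.

Lemma has_val_inj n m x : has_val n x -> has_val m x -> n = m.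
Proof.
move=> nx mx; apply/eqP; rewrite eqn_leq; apply/andP; split.
  by case: nx => t [y [Pt _ e]]; apply: has_val_le mx Pt e.
by case: mx => t [y [Pt _ e]]; apply: has_val_le nx Pt e.
Qed.

Lemma loc_proper_pow n w : loc_inj P (p ^+ n) <> w * loc_inj P (p ^+ n.+1).
Proof.
have [a [f [Pf ->]]] := fracP w; rewrite fracM => /frac_eqE.
rewrite exprS !mulr1 => e; apply: Pf.
have -> : f = p * a; last by apply: idealMr => //; apply: pideal_ideal.
by apply: (mulfI (expf_neq0 n p0)); rewrite e; ring.
Qed.

Definition pow_ideal n : set (loc P) := [set u | exists w, u = w * loc_inj P (p ^+ n)].

Lemma pow_ideal_ideal n : is_ideal (pow_ideal n).
Proof.
split=> [|_ _ [w ->] [v ->]|r _ [w ->]]; first by exists 0; rewrite mul0r.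
- by exists (w + v); rewrite mulrDl.
- by exists (r * w); rewrite mulrA.
Qed.

Lemma loc_val (u : loc P) : u != 0 -> exists n w w',
  u = w * loc_inj P (p ^+ n) /\ loc_inj P (p ^+ n) = w' * u.
Proof.
have [a [f [Pf ->]]] := fracP u => u0.
have a0 : a != 0.
  by apply: contra u0 => /eqP->; apply/eqP/frac_eqE; rewrite !mul0r.
have [n [t [y [Pt Py e]]]] := dvrp a0.
exists n, (frac y (pideal_NM Pf Pt)), (frac (f * t) Py); split.
  by rewrite fracM; apply/frac_eqE; transitivity (t * a * f); [ring|rewrite e; ring].
rewrite fracM; apply/frac_eqE.
by transitivity (f * (t * a)); [rewrite e; ring|ring].
Qed.

(** [I] contains all elements of value at least [n], so an element of the second ideal outside [I]
    has a value [k < n], and the second ideal contains [p ^ k]. *)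
Lemma chain_bound (I : set (loc P)) n m : is_ideal I -> I (loc_inj P (p ^+ n)) ->
  ideal_chain I m -> (m <= n)%N.
Proof.
move=> iI; elim: m n I iI => [//|m ih] n I iI In [c [c0 cm cS]].
have [iI' [II' nI'I]] := cS 0%N isT; rewrite c0 in nI'I II'.
(* A chain does not assert that its last term is an ideal; for [m = 0] this term is the unit
   ideal. *)
have iJ : is_ideal (c 1%N).
  case: (m) cm cS => [|m'] cm cS; last by case: (cS 1%N isT).
  by rewrite cm.
have [k kn Jk] : exists2 k, (k < n)%N & c 1%N (loc_inj P (p ^+ k)).
  apply: contrapT => no; apply: nI'I => u Ju.
  have [->|u0] := eqVneq u 0; first exact: ideal0.
  have [k [w [w' [e e']]]] := loc_val u0.
  have nk : (n <= k)%N.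
    rewrite leqNgt; apply/negP => kn; apply: no; exists k => //.
    by rewrite e'; apply: idealMl.
  rewrite e; apply: idealMl => //; rewrite -(subnK nk) exprD loc_injM.
  exact: idealMl.
apply: leq_trans kn; rewrite ltnS; apply: (ih _ (c 1%N)) => //.
exists (fun i => c i.+1); split=> // i im; exact: cS.
Qed.

Lemma colength_pow n : colength (pow_ideal n) = n.
Proof.
apply: colengthE; last first.
  move=> m; apply: chain_bound; first exact: pow_ideal_ideal.
  by exists 1; rewrite mul1r.
exists (fun i => pow_ideal (n - i)); split; first by rewrite subn0.
  apply/seteqP; split=> // u _; exists u.
  by rewrite subnn expr0 loc_inj1 mulr1.
move=> i ni; split; first exact: pow_ideal_ideal.
have -> : (n - i)%N = (n - i.+1).+1 by lia.
split=> [_ [w ->]|sub].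
  by exists (w * loc_inj P p); rewrite exprS loc_injM mulrA.
have [|w e] := sub (loc_inj P (p ^+ (n - i.+1))); first by exists 1; rewrite mul1r.
exact: loc_proper_pow e.
Qed.

(** In a discrete valuation ring an element of least value generates the ideal generated by [S]. The
    element 0 has no value and imposes no condition. *)
Lemma mult_val (S : set A) s n : S s -> has_val n s ->
  (forall s' m, S s' -> has_val m s' -> (n <= m)%N) -> mult P S = n.
Proof.
move=> Ss [t [y [Pt Py e]]] Smin; rewrite -[RHS]colength_pow; congr colength.
apply/seteqP; split.
  apply: ideal_gen_min; first exact: pow_ideal_ideal.
  move=> _ [s' Ss' <-]; have [->|s0] := eqVneq s' 0.
    by exists 0; rewrite mul0r.
  have [m [t' [y' [Pt' Py' e']]]] := dvrp s0.
  have nm : (n <= m)%N by apply: Smin Ss' _; exists t', y'.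
  exists (frac (p ^+ (m - n) * y') Pt'); rewrite fracM; apply/frac_eqE.
  rewrite -(subnK nm) exprD in e'.
  by rewrite !mulr1 mulrC e'; ring.
have iS := @ideal_gen_ideal _ (@loc_inj _ P @` S).
move=> _ [w ->]; apply: (idealMl _ iS).
have -> : loc_inj P (p ^+ n) = frac t Py * loc_inj P s.
  by rewrite fracM; apply/frac_eqE; rewrite !mulr1 e mulrC.
apply: (idealMl _ iS).
by apply: sub_ideal_gen; exists s.
Qed.

End Valuation.

(** * Divisorial ideals *)

(** For [P] of height one in a normal noetherian domain this is the valuation of [A_P]. At 0 it
    takes the default 0 of an infinite length, whence the nonvanishing hypotheses below. It is
    locked to keep simplification from unfolding the length. *)
Definition ord (A : idomainType) (P : Spec A) (x : A) : nat := locked (mult P [set x]).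

Lemma ordE (A : idomainType) (P : Spec A) x : ord P x = mult P [set x].
Proof. by rewrite /ord -lock. Qed.

Section NormalDomain.
Variable A : idomainType.
Hypotheses (noethA : noetherian A) (normA : normal_domain A).
Implicit Types (P : Spec A) (x y a b : A).

Section Prime.
Variable P : Spec A.
Hypothesis hP : height_one P.

Lemma ord_uniformizer : exists p, [/\ pideal P p, p != 0 &
  (forall x, x != 0 -> has_val P p (ord P x) x) /\
  (forall x, x != 0 -> exists n t y, [/\ ~ pideal P t, ~ pideal P y & t * x = p ^+ n * y])].
Proof.
have [p Pp dvrp] := dvr noethA normA hP; exists p.
have p0 := uniformizer_neq0 dvrp (height_one_neq0 hP).
split=> //; split=> // x x0; have [n xn] := dvrp x x0.
rewrite ordE (mult_val Pp dvrp p0 (s := x) (n := n))//.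
by move=> s m -> xm; rewrite (has_val_inj Pp p0 xn xm).
Qed.

Lemma mult_ord (S : set A) s : S s -> s != 0 ->
  (forall s', S s' -> s' != 0 -> (ord P s <= ord P s')%N) -> mult P S = ord P s.
Proof.
move=> Ss s0 Smin; have [p [Pp p0 [ordp dvrp]]] := ord_uniformizer.
apply: (mult_val Pp dvrp p0 Ss (ordp s s0)) => s' m Ss' vm.
have s'0 : s' != 0.
  case: vm => t [y [Pt Py e]]; apply/eqP => s'0; move/eqP: e.
  rewrite s'0 mulr0 eq_sym mulf_eq0 expf_eq0 (negbTE p0) andbF orFb.
  exact/negP/(pideal_neq0 Py).
by rewrite (has_val_inj Pp p0 vm (ordp s' s'0)); apply: Smin.
Qed.

Lemma ordM x y : x != 0 -> y != 0 -> ord P (x * y) = (ord P x + ord P y)%N.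
Proof.
move=> x0 y0; have [p [Pp p0 [ordp dvrp]]] := ord_uniformizer.
apply: (has_val_inj Pp p0 (ordp _ (mulf_neq0 x0 y0))).
have [t [z [Pt Pz e]]] := ordp x x0; have [s [w [Ps Pw e']]] := ordp y y0.
exists (t * s), (z * w); split; [exact: pideal_NM|exact: pideal_NM|].
move: e e'; move: (ord P x) (ord P y) => n m e e'.
by rewrite mulrACA e e' exprD; ring.
Qed.

Lemma ord_one : ord P 1 = 0%N.
Proof.
have := ordM (oner_neq0 A) (oner_neq0 A); rewrite mulr1.
by move/eqP; rewrite -{1}[ord P 1]addn0 eqn_add2l => /eqP.
Qed.

Lemma ordX x n : x != 0 -> ord P (x ^+ n) = (n * ord P x)%N.
Proof.
move=> x0; elim: n => [|n ih]; first by rewrite expr0 ord_one.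
by rewrite exprS ordM ?expf_neq0// ih mulSn.
Qed.

Lemma ordD n x y : x != 0 -> y != 0 -> x + y != 0 ->
  (n <= ord P x)%N -> (n <= ord P y)%N -> (n <= ord P (x + y))%N.
Proof.
move=> x0 y0 xy0 nx ny; have [p [Pp p0 [ordp dvrp]]] := ord_uniformizer.
have [t [z [Pt Pz e]]] := ordp x x0; have [s [w [Ps Pw e']]] := ordp y y0.
apply: (has_val_le Pp p0 (ordp _ xy0) (pideal_NM Pt Ps)
  (y := s * p ^+ (ord P x - n) * z + t * p ^+ (ord P y - n) * w)).
move: (ord P x) (ord P y) nx ny e e' => i j nx ny e e'.
rewrite mulrDr -(mulrA t s y) e' mulrAC e.
by rewrite -{1}(subnK nx) -{1}(subnK ny) !exprD; ring.
Qed.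

Lemma ord_gt0 x : x != 0 -> (0 < ord P x)%N <-> pideal P x.
Proof.
move=> x0; have [p [Pp p0 [ordp dvrp]]] := ord_uniformizer.
have [t [z [Pt Pz]]] := ordp x x0; case: (ord P x) => [|n] e; split=> //.
- move=> Px; case: Pz; move: e; rewrite expr0 mul1r => <-.
  by apply: idealMl => //; apply: pideal_ideal.
- move=> _; have : pideal P (t * x).
    by rewrite e exprS -mulrA; apply: idealMr => //; apply: pideal_ideal.
  by case/pideal_M.
Qed.

Lemma ord_notin x : ~ pideal P x -> ord P x = 0%N.
Proof.
move=> Px; have x0 := pideal_neq0 Px.
by apply/eqP; rewrite eqn0Ngt; apply/negP => /(ord_gt0 x0).
Qed.

Lemma ord_eq1 : exists2 p, p != 0 & ord P p = 1%N.
Proof.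
have [p [Pp p0 [ordp dvrp]]] := ord_uniformizer; exists p => //.
apply: (has_val_inj Pp p0 (ordp p p0)); exists 1, 1; split; try exact: pideal_1.
by rewrite mul1r mulr1 expr1.
Qed.

Lemma ord_le_divides x y : x != 0 -> y != 0 -> (ord P x <= ord P y)%N ->
  exists2 t, ~ pideal P t & divides x (t * y).
Proof.
move=> x0 y0 le; have [p [Pp p0 [ordp dvrp]]] := ord_uniformizer.
have [t [z [Pt Pz e]]] := ordp x x0; have [s [w [Ps Pw e']]] := ordp y y0.
exists (z * s); first exact: pideal_NM.
move: (ord P x) (ord P y) le e e' => i j le e e'.
exists (w * t * p ^+ (j - i)).
apply: (mulfI (expf_neq0 i p0)); rewrite -!mulrA e'.
transitivity (p ^+ (j - i) * p ^+ i * w * (p ^+ i * z)).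
  by rewrite -exprD subnK//; ring.
by rewrite -e; ring.
Qed.

Lemma le_ord_divides x y : x != 0 -> y != 0 -> divides x y -> (ord P x <= ord P y)%N.
Proof.
move=> x0 y0 [c e]; move: y0; rewrite e mulf_eq0 => /norP[c0 _].
by rewrite ordM// leq_addl.
Qed.

End Prime.

(** This is [A] as the intersection of the [A_P]. If [x] did not divide [y], some [(x : c y)] would
    be a height one prime [P], but the inequality of orders at [P] yields an element of this colon
    ideal outside [P]. *)
Lemma ord_divides x y : x != 0 -> y != 0 ->
  (forall P, height_one P -> (ord P x <= ord P y)%N) -> divides x y.
Proof.
move=> x0 y0 le; apply: contrapT => nxy.
have [P [c [hP PE]]] := divides_colon noethA normA x0 nxy.
have [t Pt [d e]] := ord_le_divides hP x0 y0 (le P hP).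
by apply: Pt; apply/PE; exists (c * d); rewrite mulrCA e mulrA.
Qed.

End NormalDomain.

Section FiniteSupport.
Variables (K : choiceType) (m : K -> int).
Hypothesis fin : finite_set [set k | m k != 0].

Lemma coeff_fsum k : coeff k (\sum_(i \in [set: K]) << m i *g i >> : {freeg K / int}) = m k.
Proof.
have Sm i : (i \in fset_set [set k | m k != 0]) = (m i != 0).
  by rewrite in_fset_set//; apply/idP/idP; [move/set_mem|move=> h; apply/mem_set].
rewrite (fsbigTE (fset_set [set k | m k != 0])) => [|i]; last first.
  by rewrite Sm negbK => /eqP ->; rewrite freegU0.
rewrite raddf_sum /=.
have [k0|k0] := boolP (m k != 0).
  rewrite (bigD1_seq k) ?Sm ?fset_uniq//= coeffU eqxx mulr1 big1 ?addr0//.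
  by move=> i ik; rewrite coeffU (negbTE ik) mulr0.
rewrite big_seq_cond big1 => [|i]; first by apply/esym/eqP; rewrite -[_ == _]negbK.
rewrite andbT Sm coeffU => mi; have [ik|_] := eqVneq i k; last by rewrite mulr0.
by move: k0; rewrite -ik mi.
Qed.
End FiniteSupport.

Section Divisors.
Variable A : idomainType.
Hypotheses (noethA : noetherian A) (normA : normal_domain A).
Implicit Types (x y a b : A) (D E F G H : Div A) (Y : prime_divisor A).

Local Notation ordY Y x := (ord (set_val Y) x).

Lemma prime_divisorP Y : height_one (set_val Y). Proof. exact: set_valP. Qed.
Hint Resolve prime_divisorP : core.

(** The sum defining [div_elt] defaults to 0, so its coefficients become available only because
    finitely many height one primes contain [a]. *)
Lemma coeff_div_elt Y a : a != 0 -> coeff Y (div_elt a) = (ordY Y a)%:Z.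
Proof.
move=> a0; rewrite ordE /div_elt (@coeff_fsum _ (fun Y => (mult (set_val Y) [set a])%:Z))//.
apply: sub_finite_set (finite_height_one noethA a0) => Z /= h.
apply/(ord_gt0 noethA normA (prime_divisorP Z) a0).
by move: h; rewrite ordE; case: (mult _ _).
Qed.

Lemma Div_eqP D E : (forall Y, coeff Y D = coeff Y E) -> D = E.
Proof. by move=> h; apply/eqP/freeg_eqP. Qed.

Lemma div_eltM a b : a != 0 -> b != 0 -> div_elt (a * b) = div_elt a + div_elt b.
Proof.
move=> a0 b0; apply: Div_eqP => Y.
by rewrite coeffD !coeff_div_elt ?mulf_neq0// ordM// PoszD.
Qed.

Lemma div_elt1 : div_elt (1 : A) = 0.
Proof.
have := div_eltM (oner_neq0 A) (oner_neq0 A); rewrite mulr1.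
by move/eqP; rewrite -{1}[div_elt 1]addr0 (inj_eq (addrI _)) => /eqP.
Qed.

Lemma div_eltX a n : a != 0 -> div_elt (a ^+ n) = div_elt a *+ n.
Proof.
move=> a0; elim: n => [|n ih]; first by rewrite expr0 mulr0n div_elt1.
by rewrite exprS div_eltM ?expf_neq0// ih mulrS.
Qed.

Lemma divides_div_elt a b : a != 0 -> b != 0 ->
  divides a b <-> effective (div_elt b - div_elt a).
Proof.
move=> a0 b0; split=> [d Y|e].
  by rewrite coeffB !coeff_div_elt// subr_ge0 lez_nat; apply: le_ord_divides.
apply: ord_divides => // P hP.
have := e (SigSub (mem_set hP)); rewrite coeffB !coeff_div_elt// subr_ge0 lez_nat.
by [].
Qed.

Lemma effective_principal D : principal D -> effective D ->
  exists2 c, c != 0 & D = div_elt c.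
Proof.
move=> [a [b [a0 b0 ->]]] /(divides_div_elt b0 a0)[c e].
have c0 : c != 0 by apply: contra_neq a0 => c0; rewrite e c0 mul0r.
by exists c => //; rewrite e div_eltM// addrK.
Qed.

Lemma principal_div_elt c : c != 0 -> @principal A (div_elt c).
Proof.
by move=> c0; exists c, 1; split; rewrite ?oner_neq0// div_elt1 subr0.
Qed.

Lemma principal0 : @principal A 0.
Proof. by rewrite -div_elt1; apply/principal_div_elt/oner_neq0. Qed.

Lemma principalN D : principal D -> principal (- D).
Proof. by move=> [a [b [a0 b0 ->]]]; exists b, a; rewrite opprB. Qed.

Lemma principalD D E : principal D -> principal E -> principal (D + E).
Proof.
move=> [a [b [a0 b0 ->]]] [c [d [c0 d0 ->]]].
exists (a * c), (b * d); split; rewrite ?mulf_neq0// !div_eltM//.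
by rewrite opprD addrACA.
Qed.

Lemma principalMz D (n : int) : principal D -> principal (D *~ n).
Proof.
move=> pD; have pn m : principal (D *+ m).
  by elim: m => [|m ih]; [exact: principal0|rewrite mulrS; apply: principalD].
by case: n => n; [exact: pn|rewrite NegzE mulrNz; apply/principalN/pn].
Qed.

Lemma lin_equiv_sym D E : lin_equiv D E -> lin_equiv E D.
Proof. by move/principalN; rewrite opprB. Qed.

Lemma lin_equiv_trans D E F : lin_equiv D E -> lin_equiv E F -> lin_equiv D F.
Proof. by move=> h /(principalD h); rewrite subrKA. Qed.

(* [H^0(X, O(-D))] for [X = Spec A], a divisorial ideal when [D] is effective. *)
Definition ideal_of D : set A :=
  [set x | x = 0 \/ forall Y, coeff Y D <= (ordY Y x)%:Z].

Lemma ideal_ofP D x : x != 0 -> ideal_of D x <-> effective (div_elt x - D).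
Proof.
move=> x0; split=> [[/eqP|h Y]|h]; first by rewrite (negbTE x0).
  by rewrite coeffB coeff_div_elt// subr_ge0.
by right=> Y; have := h Y; rewrite coeffB coeff_div_elt// subr_ge0.
Qed.

Lemma ideal_of0 D : ideal_of D 0. Proof. by left. Qed.

Lemma ideal_of_ideal D : is_ideal (ideal_of D).
Proof.
split; first exact: ideal_of0.
  move=> x y; have [->|x0] := eqVneq x 0; first by rewrite add0r.
  have [->|y0] := eqVneq y 0; first by rewrite addr0.
  have [->|xy0] := eqVneq (x + y) 0; first by left.
  move=> [/eqP|hx]; first by rewrite (negbTE x0).
  move=> [/eqP|hy]; first by rewrite (negbTE y0).
  right=> Y; have := hx Y; have := hy Y; case: (coeff Y D) => n //.
  by rewrite !lez_nat => hn hm; apply: ordD.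
move=> r x [->|hx]; first by rewrite mulr0; left.
have [->|r0] := eqVneq r 0; first by rewrite mul0r; left.
have [->|x0] := eqVneq x 0; first by rewrite mulr0; left.
by right=> Y; apply: (le_trans (hx Y)); rewrite lez_nat ordM// leq_addl.
Qed.

Lemma ideal_ofM D E x y : ideal_of D x -> ideal_of E y -> ideal_of (D + E) (x * y).
Proof.
have [->|x0] := eqVneq x 0; first by rewrite mul0r; left.
have [->|y0] := eqVneq y 0; first by rewrite mulr0; left.
move=> /(ideal_ofP _ x0) hx /(ideal_ofP _ y0) hy; apply/ideal_ofP; first exact: mulf_neq0.
by move=> Y; rewrite div_eltM// opprD addrACA coeffD addr_ge0.
Qed.

Lemma ideal_ofX D x n : ideal_of D x -> ideal_of (D *+ n) (x ^+ n).
Proof.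
move=> Dx; elim: n => [|n ih]; last by rewrite exprS mulrS; apply: ideal_ofM.
by right=> Y; rewrite mulr0n coeff0.
Qed.

Lemma ideal_of_div a x : a != 0 -> ideal_of (div_elt a) x <-> divides a x.
Proof.
move=> a0; have [->|x0] := eqVneq x 0.
  by split=> _; [exists 0; rewrite mul0r|left].
by rewrite ideal_ofP// divides_div_elt.
Qed.

Lemma ideal_of_neq0 D : exists2 b, b != 0 & ideal_of D b.
Proof.
suff [b b0 bP] : exists2 b, b != 0 & forall Y, Y \in dom D -> coeff Y D <= (ordY Y b)%:Z.
  exists b => //; right=> Y; have [/bP//|nY] := boolP (Y \in dom D).
  by rewrite coeff_outdom.
elim: (dom D) => [|Y s [b b0 bP]]; first by exists 1; rewrite ?oner_neq0.
have [p p0 p1] := ord_eq1 noethA normA (prime_divisorP Y).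
have pn0 : p ^+ `|coeff Y D|%N != 0 by apply: expf_neq0.
exists (p ^+ `|coeff Y D|%N * b); first exact: mulf_neq0.
move=> Z; rewrite in_cons => /orP[/eqP->|/bP h].
  by rewrite ordM// ordX// p1 muln1; lia.
by apply: (le_trans h); rewrite ordM// lez_nat leq_addl.
Qed.

(** If every component of [D] had an element outside [x], a product of powers of these elements
    would lie in [ideal_of D] but not in [x]. *)
Lemma ideal_of_prime D (x : Spec A) : effective D -> ideal_of D `<=` x ->
  exists2 Y, coeff Y D != 0 & set_val Y `<=` x.
Proof.
move=> eD Dx; apply: contrapT => no.
suff [b xb bP] : exists2 b, ~ pideal x b & forall Y, Y \in dom D -> coeff Y D <= (ordY Y b)%:Z.
  apply: xb; apply: Dx; right=> Y; have [/bP//|nY] := boolP (Y \in dom D).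
  by rewrite coeff_outdom.
have sub Y : Y \in dom D -> coeff Y D != 0 by rewrite mem_dom.
elim: (dom D) sub => [|Y s ih] sub; first by exists 1 => //; apply: pideal_1.
have [b xb bP] : exists2 b, ~ pideal x b & forall Y, Y \in s -> coeff Y D <= (ordY Y b)%:Z.
  by apply: ih => Z Zs; apply: sub; rewrite in_cons Zs orbT.
have [p Yp xp] : exists2 p, pideal (set_val Y) p & ~ pideal x p.
  apply: contrapT => no'; apply: no; exists Y; first exact/sub/mem_head.
  by move=> p Yp; apply: contrapT => xp; apply: no'; exists p.
have p0 := pideal_neq0 xp; have b0 := pideal_neq0 xb.
have pn0 : p ^+ `|coeff Y D|%N != 0 by apply: expf_neq0.
exists (p ^+ `|coeff Y D|%N * b); first by apply: pideal_NM => //; apply: pideal_NX.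
move=> Z; rewrite in_cons => /orP[/eqP->|/bP h].
  have /(ord_gt0 noethA normA (prime_divisorP Y) p0) := Yp.
  by rewrite ordM// ordX//; nia.
by apply: (le_trans h); rewrite ordM// lez_nat leq_addl.
Qed.

End Divisors.

(** * Sections as functions with values in a field *)

Lemma spec_openP (R : comPzRingType) (W : set (Spec R)) :
  open W <-> exists S : set R, W = [set x : Spec R | ~ (S `<=` x)].
Proof. by []. Qed.

Lemma spec_open_D (R : comPzRingType) (a : R) : open [set x : Spec R | ~ pideal x a].
Proof.
apply/spec_openP; exists [set a]; apply/seteqP; split=> x /= nxa.
  by move=> sub; apply: nxa; apply: sub.
by move=> xa; apply: nxa => _ ->.
Qed.

Section FractionValues.
Variables (R : comPzRingType) (K : fieldType) (theta : {rmorphism R -> K}).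
Hypothesis theta_inj : injective theta.
Implicit Types (x : Spec R) (V W : set (Spec R)).

Lemma theta_eq0 a : theta a = 0 -> a = 0.
Proof. by move=> h; apply: theta_inj; rewrite h rmorph0. Qed.

Lemma theta_neq0 x a : ~ pideal x a -> theta a != 0.
Proof.
by move=> xa; apply/eqP => /theta_eq0 a0; apply: xa; rewrite a0; apply: pideal_0.
Qed.

(** The field is arbitrary because sections over [Spec A] and over the spectrum of a ring of regular
    functions are both compared inside the fraction field of [A]. *)
Definition vloc x (u : loc x) : K := theta (repr u).1 / theta (denom_val (repr u).2).

Lemma vloc_frac x a f (xf : ~ pideal x f) : vloc (frac a xf) = theta a / theta f.
Proof.
rewrite /vloc; have [w] := repr_loc (a, MkDenom xf).
rewrite -/(frac a xf); case: (repr (frac a xf)) => b g /= e.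
have f0 := theta_neq0 xf; have g0 := theta_neq0 (@denomP _ _ g).
have w0 := theta_neq0 (@denomP _ _ w).
apply/eqP; rewrite eqr_div//; apply/eqP/(mulfI w0).
by rewrite -!rmorphM e.
Qed.

Lemma vloc_inj x : injective (@vloc x).
Proof.
move=> u v; have [a [f [xf ->]]] := fracP u; have [b [g [xg ->]]] := fracP v.
rewrite !vloc_frac => /eqP; rewrite eqr_div ?(theta_neq0 xf) ?(theta_neq0 xg)//.
rewrite -!rmorphM => /eqP/theta_inj e.
by apply/frac_eqP; exists 1; [apply: pideal_1|rewrite e].
Qed.

Lemma vlocM x (u v : loc x) : vloc (u * v) = vloc u * vloc v.
Proof.
have [a [f [xf ->]]] := fracP u; have [b [g [xg ->]]] := fracP v.
by rewrite fracM !vloc_frac !rmorphM mulf_div.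
Qed.

Lemma vlocD x (u v : loc x) : vloc (u + v) = vloc u + vloc v.
Proof.
have [a [f [xf ->]]] := fracP u; have [b [g [xg ->]]] := fracP v.
rewrite fracD !vloc_frac rmorphD !rmorphM.
by rewrite addf_div ?(theta_neq0 xf) ?(theta_neq0 xg).
Qed.

Lemma vloc_loc_inj x a : vloc (loc_inj x a) = theta a.
Proof. by rewrite vloc_frac rmorph1 divr1. Qed.

Lemma vloc1 x : vloc (1 : loc x) = 1.
Proof. by rewrite -loc_inj1 vloc_loc_inj rmorph1. Qed.

Lemma vlocB x (u v : loc x) : vloc (u - v) = vloc u - vloc v.
Proof. by apply/eqP; rewrite -(inj_eq (addIr (vloc v))) -vlocD !subrK. Qed.

(** Being total, with default 0 outside [V], the value can be compared between open sets without
    transporting membership proofs. *)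
Definition secval V (s : germs V) x : K :=
  if pselect (V x) is left Vx then vloc (s x Vx) else 0.

Lemma secvalE V (s : germs V) x (Vx : V x) : secval s x = vloc (s x Vx).
Proof.
by rewrite /secval; case: pselect => // Vx'; rewrite (Prop_irrelevance Vx Vx').
Qed.

Lemma secval_inj V (s t : sections V) : (forall x, V x -> secval s x = secval t x) -> s = t.
Proof.
move=> st; apply: val_inj; apply: germsP => x Vx.
by apply: vloc_inj; have := st x Vx; rewrite !(secvalE _ Vx).
Qed.

Lemma secvalM V (s t : sections V) x : secval (s * t : sections V) x = secval s x * secval t x.
Proof.
rewrite /secval; case: pselect => [Vx|]; last by rewrite mulr0.
exact: vlocM.
Qed.

Lemma secvalB V (s t : sections V) x : secval (s - t : sections V) x = secval s x - secval t x.
Proof.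
rewrite /secval; case: pselect => [Vx|]; last by rewrite subr0.
exact: vlocB.
Qed.

Lemma secval1 V x : V x -> secval (1 : sections V) x = 1.
Proof. by move=> Vx; rewrite (secvalE _ Vx); apply: vloc1. Qed.

Lemma secval_res V W (WV : W `<=` V) (s : sections V) x :
  W x -> secval (section_res WV s) x = secval s x.
Proof. by move=> Wx; rewrite (secvalE _ Wx) (secvalE _ (WV x Wx)). Qed.

Definition regfun V (k : Spec R -> K) : Prop := forall x, V x ->
  exists W, [/\ open W, W x & exists a f, forall y, V y -> W y ->
    ~ pideal y f /\ k y = theta a / theta f].

Lemma secval_regfun V (s : sections V) : regfun V (secval s).
Proof.
move=> x Vx; have /asboolP/(_ x Vx)[W [oW Wx [a [f h]]]] := section_regular s.
exists W; split=> //; exists a, f => y Vy Wy; have [yf e] := h y Vy Wy.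
by split=> //; rewrite (secvalE _ Vy) e vloc_frac.
Qed.

Lemma section_of V k : regfun V k -> exists s : sections V, forall x, V x -> secval s x = k x.
Proof.
move=> rk.
have kP x : V x -> exists u : loc x, vloc u = k x.
  move=> Vx; have [W [oW Wx [a [f h]]]] := rk x Vx.
  have [xf ->] := h x Vx Wx; exists (frac a xf).
  by rewrite vloc_frac.
pose s : germs V := fun x Vx => projT1 (cid (kP x Vx)).
have sE x Vx : vloc (s x Vx) = k x by rewrite /s; case: cid.
have sr : s \in @regular R V.
  apply/asboolP => x Vx; have [W [oW Wx [a [f h]]]] := rk x Vx.
  exists W; split=> //; exists a, f => y Vy Wy; have [yf e] := h y Vy Wy.
  by exists yf; apply: vloc_inj; rewrite sE e vloc_frac.
by exists (MkSections sr) => x Vx; rewrite (secvalE _ Vx) /= sE.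
Qed.

End FractionValues.

Section ConstantSections.
Variables (R : comPzRingType) (V : set (Spec R)).

Definition const_germs (a : R) : germs V := fun x _ => loc_inj x a.

Lemma const_germs_regular a : const_germs a \in @regular R V.
Proof.
apply/asboolP => x Vx; exists setT; split=> //; first exact: openT.
by exists a, 1 => y Vy _; exists (denom1P (x := y)).
Qed.

Definition const_section a : sections V := MkSections (const_germs_regular a).

Lemma const_section_zmod : zmod_morphism const_section.
Proof.
move=> a b; apply/(addIr (const_section b)); rewrite subrK.
apply: val_inj; apply: germsP => x Vx.
by rewrite -[LHS]/(loc_inj x (a - b) + loc_inj x b) -loc_injD subrK.
Qed.

Lemma const_section_monoid : monoid_morphism const_section.
Proof.
split; first exact: val_inj.
by move=> a b; apply: val_inj; apply: germsP => x Vx; apply: loc_injM.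
Qed.

HB.instance Definition _ := GRing.isZmodMorphism.Build R (sections V)
  const_section const_section_zmod.
HB.instance Definition _ := GRing.isMonoidMorphism.Build R (sections V)
  const_section const_section_monoid.

End ConstantSections.

Lemma secval_const (R : comPzRingType) (K : fieldType) (theta : {rmorphism R -> K})
    (theta_inj : injective theta) (V : set (Spec R)) a x :
  V x -> secval theta (const_section V a) x = theta a.
Proof. by move=> Vx; rewrite (secvalE _ _ Vx) vloc_loc_inj. Qed.

Section DomainSections.
Variable A : idomainType.

Lemma open_generic (W : set (Spec A)) x : open W -> W x -> W (generic A).
Proof.
move=> [S ->] /= nSx Sg; apply: nSx => a /Sg ->; exact: pideal_0.
Qed.

(** A fraction representing [s] near [x] also represents it at the generic point, which lies in
    every nonempty open set. So a section is a single element of the fraction field. *)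
Lemma secval_generic (V : set (Spec A)) (s : sections V) x : V (generic A) -> V x ->
  secval (@tofrac A) s x = secval (@tofrac A) s (generic A).
Proof.
move=> Vg Vx; have tofrac_inj : injective (@tofrac A).
  by move=> a b /eqP; rewrite tofrac_eq => /eqP.
have [W [oW Wx [a [f h]]]] := secval_regfun tofrac_inj s Vx.
have [_ ->] := h x Vx Wx.
by have [_ ->] := h _ Vg (open_generic oW Wx).
Qed.

End DomainSections.

Lemma tofrac_inj (A : idomainType) : injective (@tofrac A).
Proof. by move=> a b /eqP; rewrite tofrac_eq => /eqP. Qed.

(** The intersection of the local rings at the points of [U] inside the fraction field; it stands
    for the ring of sections over a nonempty open [U]. *)
Definition regular_on (A : idomainType) (U : set (Spec A)) (z : {fraction A}) : Prop :=
  forall x, U x -> exists e t, ~ pideal x t /\ tofrac e = tofrac t * z.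

Section RegularOn.
Variables (A : idomainType) (U : set (Spec A)).
Local Notation f := (@tofrac A).

Lemma regfun_of (k : Spec A -> {fraction A}) z :
  regular_on U z -> (forall x, U x -> k x = z) -> regfun f U k.
Proof.
move=> rz kz x Ux; have [e [t [xt E]]] := rz x Ux.
exists [set y | ~ pideal y t]; split=> //; first exact: spec_open_D.
exists e, t => y Uy yt; split=> //; rewrite kz//.
by rewrite /= E mulrC mulKf// (theta_neq0 (@tofrac_inj A) yt).
Qed.

Lemma regular_on_secval (V : set (Spec A)) (s : sections V) : U `<=` V -> V (generic A) ->
  regular_on U (secval f s (generic A)).
Proof.
move=> UV Vg x /UV Vx.
have [W [oW Wx [a [t h]]]] := secval_regfun (@tofrac_inj A) s Vx.
have [xt E] := h x Vx Wx; exists a, t; split=> //.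
by rewrite -(secval_generic s Vg Vx) E mulrC divfK// (theta_neq0 (@tofrac_inj A) xt).
Qed.

Lemma regular_on_tofrac a : regular_on U (f a).
Proof.
by move=> x _; exists a, 1; split; [apply: pideal_1|rewrite rmorph1 mul1r].
Qed.

End RegularOn.

(** If [b] is nonzero, its annihilator lies in a prime, and the germ of [b] at this prime is
    nonzero. *)
Lemma const_section_inj (B : comPzRingType) (b : B) :
  const_section [set: Spec B] b = 0 -> b = 0.
Proof.
move=> b0; pose N := [set w | w * b = 0].
have iI : is_ideal N.
  split=> [|v w /= v0 w0|v w /= w0]; first by rewrite /N /= mul0r.
    by rewrite /N /= mulrDl v0 w0 addr0.
  by rewrite /N /= -mulrA w0 mulr0.
have [|I1] := pselect (N 1); first by rewrite /N /= mul1r.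
have [||_ -> //|m [Im _]] := @prime_avoiding _ N [set 1] iI; first by [].
  by move=> _ _ -> ->; rewrite mulr1.
have : loc_inj m b = loc_inj m 0 :=
  congr1 (fun s : sections [set: Spec B] => @section_germs _ _ s m I) b0.
move=> /frac_eqP[w mw]; rewrite mul0r !mulr0 mulr1 => e.
by case: mw; apply: Im.
Qed.

(** As [B] embeds in a field, a section has one value [z], read off at the zero ideal. The
    denominators of [z] form an ideal contained in no prime, hence containing 1. *)
Lemma global_section (B : comPzRingType) (K : fieldType) (theta : {rmorphism B -> K})
    (theta_inj : injective theta) (s : sections [set: Spec B]) :
  exists b, s = const_section _ b.
Proof.
have p0 : is_prime_ideal [set 0 : B].
  split=> [|/= h|a b /= ab0].
  - by split=> [|a b -> ->|r a ->]//=; [rewrite addr0|rewrite mulr0].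
  - by move: (congr1 theta h); rewrite rmorph1 rmorph0 => /eqP; rewrite oner_eq0.
  - have /eqP : theta a * theta b = 0 by rewrite -rmorphM ab0 rmorph0.
    by rewrite mulf_eq0 => /orP[]/eqP/(theta_eq0 theta_inj); [left|right].
pose g := MkSpec p0; pose z := secval theta s g.
have sz x : exists a t, ~ pideal x t /\ secval theta s x = z /\ theta a = theta t * z.
  have [W [oW Wx [a [t h]]]] := secval_regfun theta_inj s (I : [set: Spec B] x).
  have [xt E] := h x I Wx.
  have Wg : W g.
    case: oW Wx => S -> /= nSx Sg; apply: nSx => c /Sg ->; exact: pideal_0.
  have [_ Eg] := h g I Wg.
  exists a, t; split=> //; rewrite /z E Eg; split=> //.
  by rewrite mulrC divfK// (theta_neq0 theta_inj xt).
pose J := [set t | exists a, theta a = theta t * z].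
have iJ : is_ideal J.
  split=> [|t u [a e] [b e']|t u [a e]].
  - by exists 0; rewrite !rmorph0 mul0r.
  - by exists (a + b); rewrite !rmorphD mulrDl e e'.
  - by exists (t * a); rewrite !rmorphM e mulrA.
have [[b]|J1] := pselect (J 1).
  rewrite rmorph1 mul1r => e; exists b; apply: (secval_inj theta_inj) => x _.
  by rewrite secval_const// e; have [a [t [_ [-> _]]]] := sz x.
have [||_ -> //|m [Jm _]] := @prime_avoiding _ J [set 1] iJ; first by [].
  by move=> _ _ -> ->; rewrite mulr1.
have [a [t [mt [_ e]]]] := sz m; case: mt; apply: Jm; by exists a.
Qed.

Section GenericValue.
Variables (A : idomainType) (V : set (Spec A)) (Vg : V (generic A)).

(** The membership proof is an argument for the sake of the morphism structures: without it the
    value would be the default 0 and the unit would not be preserved. *)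
Definition generic_value of V (generic A) := fun s : sections V =>
  secval (@tofrac A) s (generic A).

Lemma generic_value_zmod : zmod_morphism (generic_value Vg).
Proof. by move=> s t; apply: secvalB; apply: tofrac_inj. Qed.

Lemma generic_value_monoid : monoid_morphism (generic_value Vg).
Proof.
by split=> [|s t]; [exact: (secval1 (@tofrac_inj A) Vg)|apply: secvalM; apply: tofrac_inj].
Qed.

HB.instance Definition _ := GRing.isZmodMorphism.Build (sections V) {fraction A}
  (generic_value Vg) generic_value_zmod.
HB.instance Definition _ := GRing.isMonoidMorphism.Build (sections V) {fraction A}
  (generic_value Vg) generic_value_monoid.

Lemma generic_value_inj : injective (generic_value Vg).
Proof.
move=> s t e; apply: (secval_inj (@tofrac_inj A)) => x Vx.
by rewrite !(secval_generic _ Vg Vx).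
Qed.

End GenericValue.

(** * The affineness of an open subscheme *)

Lemma subscheme_openP (A : idomainType) (U : set (Spec A))
    (O : set (points (@open_subscheme (SpecScheme A) U))) :
  open O <-> exists2 V : set (Spec A), open V & O = set_val @^-1` V.
Proof. by split=> [[V oV <-]|[V oV ->]]; exists V. Qed.

Section AffineOpenNecessary.
Variables (A : idomainType) (U : set (Spec A)).
Local Notation f := (@tofrac A).
Local Notation X := (@open_subscheme (SpecScheme A) U).
Local Notation g := (generic A).

(* If [X] is the spectrum of [B], then [T] restricts to an ideal of [B].  It lies in
   no prime of [B]: an element of [J] not vanishing at the corresponding point of
   [U] is invertible near this point. *)
Lemma affine_unit (T : set {fraction A}) (J : set A) : U g ->
  (forall x, U x -> exists2 j, J j & ~ pideal x j) ->
  T 0 -> (forall z w, T z -> T w -> T (z + w)) ->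
  (forall z w, regular_on U z -> T w -> T (z * w)) ->
  (forall j, J j -> T (f j)) -> affine_scheme X -> T 1.
Proof.
move=> Ug UJ T0 TD TM TJ [B [F [G [h [[FG GF cF cG] [hbij hres]]]]]].
pose sB V (oV : open V) : {rmorphism sections V -> sections (open_img (F @^-1` V))} := h V oV.
have sBbij V oV : bijective (sB V oV) := hbij V oV.
have sBres V W oV oW (WV : W `<=` V) s :
  sB W oW (section_res WV s) = section_res (image_subset set_val (preimage_subset WV)) (sB V oV s).
  exact: hres.
(* [UT] is [U] in the form in which [h] presents the sections over the whole space. *)
pose UT := open_img (F @^-1` [set: Spec B]).
have UTE x : UT x <-> U x.
  split=> [[u _ <-]|Ux]; first exact: set_valP.
  by exists (SigSub (mem_set Ux)).
have UTg : UT g by apply/UTE.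
have UUT : U `<=` UT by move=> x /UTE.
pose hT := sB setT openT.
have hTinj : injective hT := bij_inj (sBbij _ _).
(* [chi] identifies [B] with the functions regular on [U]. Its injectivity embeds [B] in a field, so
   that [global_section] applies and gives surjectivity. *)
pose chi : {rmorphism B -> {fraction A}} :=
  generic_value UTg \o hT \o @const_section B setT.
have chi_inj : injective chi.
  move=> a b e; have ab := hTinj _ _ (generic_value_inj e); apply/eqP; rewrite -subr_eq0.
  apply/eqP/const_section_inj; rewrite rmorphB; apply/eqP; rewrite subr_eq0.
  by apply/eqP; exact: ab.
have chi_reg b : regular_on U (chi b) by apply: regular_on_secval.
have chi_surj z : regular_on U z -> exists b, chi b = z.
  move=> rz; have [|s sE] := section_of (@tofrac_inj A) (V := UT) (k := fun=> z).
    by apply: (regfun_of (z := z)) => // x /UTE; apply: rz.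
  have [hTinv hTK hTinvK] := sBbij setT openT.
  have [b bE] := global_section chi_inj (hTinv s); exists b.
  by rewrite -(sE g UTg) /chi /= -bE /hT hTinvK.
have chiE b x : UT x -> secval f (hT (const_section setT b)) x = chi b.
  by move=> Ux; rewrite (secval_generic _ UTg Ux).
clearbody chi; pose N := [set b | T (chi b)].
have iN : is_ideal N.
  split=> [|b c Nb Nc|b c Nc]; rewrite /N /=.
  - by rewrite rmorph0.
  - by rewrite rmorphD; apply: TD.
  - by rewrite rmorphM; apply: TM.
apply: contrapT => T1.
have [||b ->|m [Nm _]] := @prime_avoiding _ N [set 1] iN; first by [].
- by move=> _ _ -> ->; rewrite mulr1.
- by rewrite /N /= rmorph1.
pose u : points X := G m; have Ux : U (set_val u) by exact: set_valP.
have [j Jj xj] := UJ _ Ux.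
have [b bE] := chi_surj _ (@regular_on_tofrac A U j).
have mb : pideal m b by apply: Nm; rewrite /N /= bE; apply: TJ.
pose W : set (points X) := [set v | ~ pideal (set_val v) j].
have oW : open W.
  by apply/subscheme_openP; exists [set x | ~ pideal x j] => //; apply: spec_open_D.
pose V := G @^-1` W.
have oV : open V by move/continuousP: cG; apply.
have VUT : open_img (F @^-1` V) `<=` UT by move=> _ [v _ <-]; exists v.
pose Z := open_img (F @^-1` V).
have ZE x : Z x -> ~ pideal x j.
  by move=> [v Vv <-]; move: Vv; rewrite /V /W /= FG.
have [|r rE] := section_of (@tofrac_inj A) (V := Z) (k := fun=> (f j)^-1).
  move=> x Zx; exists [set y | ~ pideal y j]; split.
  - exact: spec_open_D.
  - exact: ZE.
  - by exists 1, j => y _ yj; rewrite rmorph1 div1r.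
have [hVinv hVK hVinvK] := sBbij V oV.
have VT : V `<=` setT by [].
(* Near [m], where [j] does not vanish, [b] has the inverse [1 / j]; so the germ of [b] at [m] is a
   unit although [m] contains [b]. *)
have e : section_res VT (const_section setT b) * hVinv r = 1.
  apply: (can_inj hVK); rewrite rmorphM rmorph1 hVinvK (sBres _ _ openT).
  apply: (secval_inj (@tofrac_inj A)) => x Zx.
  rewrite (secvalM (@tofrac_inj A)) (rE x Zx) (secval1 (@tofrac_inj A) Zx).
  rewrite (secval_res _ _ _ Zx) (chiE _ _ (VUT x Zx)) bE.
  by rewrite divff// (theta_neq0 (@tofrac_inj A) (ZE x Zx)).
have Vm : V m by [].
have := congr1 (fun s : sections V => @section_germs _ _ s m Vm) e.
rewrite -[LHS]/(loc_inj m b * @section_germs _ _ (hVinv r) m Vm).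
have [a [t [mt ->]]] := fracP (@section_germs _ _ (hVinv r) m Vm).
rewrite fracM => /frac_eqP[w mw]; rewrite !mul1r mulr1 => E.
apply: (pideal_NM mw mt); rewrite -E.
by apply: idealMl; [exact: pideal_ideal|apply: idealMr => //; exact: pideal_ideal].
Qed.

End AffineOpenNecessary.

(** * The ring of regular functions on an open set *)

Section RegularRing.
Variables (A : idomainType) (U : set (Spec A)).
Local Notation f := (@tofrac A).

Definition regular_pred : {pred {fraction A}} := fun z => `[< regular_on U z >].

Lemma regular_pred_subring : subring_closed regular_pred.
Proof.
split; first by apply/asboolP; rewrite -(rmorph1 f); apply: regular_on_tofrac.
- move=> z w /asboolP rz /asboolP rw; apply/asboolP => x Ux.
  have [e [t [xt E]]] := rz x Ux; have [e' [t' [xt' E']]] := rw x Ux.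
  exists (e * t' - e' * t), (t * t'); split; first exact: pideal_NM.
  by rewrite rmorphB !rmorphM /= E E'; ring.
- move=> z w /asboolP rz /asboolP rw; apply/asboolP => x Ux.
  have [e [t [xt E]]] := rz x Ux; have [e' [t' [xt' E']]] := rw x Ux.
  exists (e * e'), (t * t'); split; first exact: pideal_NM.
  by rewrite !rmorphM /= E E'; ring.
Qed.

HB.instance Definition _ := GRing.isSubringClosed.Build {fraction A} regular_pred
  regular_pred_subring.

Record regular_ring : Type := MkRegular {
  regular_val :> {fraction A};
  regular_valP : regular_val \in regular_pred
}.

HB.instance Definition _ := [isSub for regular_val].
HB.instance Definition _ := [Choice of regular_ring by <:].
HB.instance Definition _ := GRing.SubChoice_isSubComPzRing.Build {fraction A}
  regular_pred regular_ring regular_pred_subring.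

Definition val_mor : {rmorphism regular_ring -> {fraction A}} := val.

Arguments val_mor : simpl never.

Lemma val_mor_inj : injective val_mor. Proof. exact: val_inj. Qed.

Lemma regular_ringP (b : regular_ring) : regular_on U (val_mor b).
Proof. exact/asboolP/(regular_valP b). Qed.

Definition regular_of z (rz : regular_on U z) : regular_ring :=
  MkRegular (asboolT rz).

Definition iota (a : A) : regular_ring := regular_of (@regular_on_tofrac A U a).

Lemma val_iota a : val_mor (iota a) = f a. Proof. by []. Qed.

Lemma iota_zmod : zmod_morphism iota.
Proof. by move=> a b; apply: val_mor_inj; rewrite rmorphB !val_iota rmorphB. Qed.
Lemma iota_monoid : monoid_morphism iota.
Proof.
split=> [|a b]; apply: val_mor_inj.
  by rewrite val_iota !rmorph1.
by rewrite rmorphM !val_iota rmorphM.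
Qed.
HB.instance Definition _ := GRing.isZmodMorphism.Build A regular_ring iota iota_zmod.
HB.instance Definition _ := GRing.isMonoidMorphism.Build A regular_ring iota iota_monoid.

End RegularRing.

(** * Affineness from functions generating the unit ideal *)

Section AffineOpenSufficient.
Variables (A : idomainType) (U : set (Spec A)).
Local Notation f := (@tofrac A).
Local Notation X := (@open_subscheme (SpecScheme A) U).
Local Notation B := (regular_ring U).
Local Notation iota := (@iota A U).
Local Notation theta := (@val_mor A U).
Local Notation finj := (@tofrac_inj A).
Local Notation vinj := (@val_mor_inj A U).

Variables (n : nat) (j : 'I_n -> A) (beta : 'I_n -> {fraction A}).
Hypotheses (jU : forall k x, ~ pideal x (j k) -> U x)
  (beta_reg : forall k, regular_on U (beta k))
  (unit_sum : 1 = \sum_k f (j k) * beta k)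
  (Ug : U (generic A)).

Lemma contract_prime (q : Spec B) : is_prime_ideal [set a | pideal q (iota a)].
Proof.
split=> [||a b]; rewrite /= ?rmorph1 ?rmorphM.
- split=> [|a b /= qa qb|a b /= qb]; rewrite /= ?rmorph0 ?rmorphD ?rmorphM.
  + exact: pideal_0.
  + by apply: idealD => //; apply: pideal_ideal.
  + by apply: idealMl => //; apply: pideal_ideal.
- exact: pideal_1.
- exact: pideal_M.
Qed.

Definition contract (q : Spec B) : Spec A := MkSpec (contract_prime q).

Lemma contract_pick (q : Spec B) : exists k, ~ pideal q (iota (j k)).
Proof.
apply: contrapT => no; apply: (@pideal_1 _ q).
have -> : 1 = \sum_k iota (j k) * regular_of (beta_reg k).
  apply: vinj; rewrite rmorph1 rmorph_sum unit_sum.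
  by apply: eq_bigr => k _; rewrite rmorphM.
apply: ideal_sum; first exact: pideal_ideal.
move=> k _; apply: idealMr; first exact: pideal_ideal.
by apply: contrapT => qj; apply: no; exists k.
Qed.

Lemma contractU q : U (contract q).
Proof. by have [k qk] := contract_pick q; apply: (jU (k := k)). Qed.

Lemma pick (x : Spec A) : U x -> exists k, ~ pideal x (j k).
Proof.
move=> Ux; apply: contrapT => no.
have rb k : exists e t, ~ pideal x t /\ f e = f t * beta k by exact: beta_reg Ux.
(* The sum is 1, so [t = e], although [t] lies outside [x] and [e] inside. The pair exists because
   all [j k] are supposed to lie in [x] and the [beta k] are regular at [x]. *)
suff [t [e [xt [xe E]]]] : exists t e, ~ pideal x t /\ pideal x e /\
    f e = f t * (\sum_k f (j k) * beta k).
  by apply: xt; rewrite -unit_sum mulr1 in E; rewrite -(finj E).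
elim/big_ind: _ => [|z w [t [e [xt [xe E]]]] [t' [e' [xt' [xe' E']]]]|k _].
- by exists 1, 0; rewrite mulr0 rmorph0; split; [exact: pideal_1|split=> //; exact: pideal_0].
- exists (t * t'), (e * t' + e' * t); split; first exact: pideal_NM.
  split; last by rewrite tofracD !tofracM E E'; ring.
  by apply: idealD; first exact: pideal_ideal; apply: idealMr => //; apply: pideal_ideal.
- have [e [t [xt E]]] := rb k; exists t, (j k * e); split=> //; split.
    apply: idealMr; first exact: pideal_ideal.
    by apply: contrapT => xj; apply: no; exists k.
  by rewrite tofracM E mulrCA.
Qed.

(** A prime containing all denominators of [z] but no power of [j k] would be a point of [U], where
    [z] has a denominator. Hence [A] and the ring of regular functions agree after inverting
    [j k]. *)
Lemma clear_denominators k z : regular_on U z -> exists N a, f (j k ^+ N) * z = f a.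
Proof.
move=> rz; pose D := [set t | exists a, f t * z = f a].
have iD : is_ideal D.
  split=> [|t u [a e] [b e']|t u [a e]].
  - by exists 0; rewrite !tofrac0 mul0r.
  - by exists (a + b); rewrite !tofracD mulrDl e e'.
  - by exists (t * a); rewrite !tofracM -mulrA e.
apply: contrapT => no.
have [||_ [N ->] [a e]|x [Dx xj]] := @prime_avoiding _ D [set t | exists N, t = j k ^+ N] iD.
- by exists 0%N; rewrite expr0.
- by move=> _ _ [N ->] [M ->]; exists (N + M)%N; rewrite exprD.
- by apply: no; exists N, a.
have xjk : ~ pideal x (j k) by apply: xj; exists 1%N; rewrite expr1.
have [e [t [xt E]]] := rz x (jU xjk).
by apply: xt; apply: Dx; exists e.
Qed.

Lemma clear_B k (b : B) : exists N a, iota (j k ^+ N) * b = iota a.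
Proof.
have [N [a e]] := clear_denominators k (regular_ringP b).
by exists N, a; apply: vinj; rewrite rmorphM.
Qed.

Lemma contract_inj : injective contract.
Proof.
move=> q q' e; apply: Spec_eq => b.
have qq' a : pideal q (iota a) <-> pideal q' (iota a).
  have : pideal (contract q) a <-> pideal (contract q') a by rewrite e.
  by [].
have [k qk] := contract_pick q; have [N [a E]] := clear_B k b.
have qk' : ~ pideal q' (iota (j k)) by move/qq'.
have half (p : Spec B) : ~ pideal p (iota (j k)) -> pideal p b <-> pideal p (iota a).
  move=> pk; rewrite -E; split=> [pb|/pideal_M[]//].
    by apply: idealMl => //; apply: pideal_ideal.
  by rewrite rmorphXn => /(pideal_NX pk).
by rewrite (half _ qk) (half _ qk').
Qed.

(** [B] is contained in [A_x], and [Q] is the contraction to [B] of the maximal ideal of [A_x]. *)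
Lemma extend_exists (x : Spec A) : U x -> exists q, contract q = x.
Proof.
move=> Ux.
pose Q := [set b : B | exists e t, [/\ ~ pideal x t, pideal x e & f e = f t * theta b]].
have QE (b : B) e t : ~ pideal x t -> f e = f t * theta b -> Q b <-> pideal x e.
  move=> xt E; split=> [[e' [t' [xt' xe' E']]]|xe]; last by exists e, t.
  have : pideal x (e * t').
    suff -> : e * t' = e' * t by apply: idealMr => //; apply: pideal_ideal.
    by apply: finj; rewrite !tofracM E E'; ring.
  by case/pideal_M.
have Qp : is_prime_ideal Q.
  split=> [|Q1|b c].
  - split=> [|b c [e [t [xt xe E]]] [e' [t' [xt' xe' E']]]|b c [e [t [xt xe E]]]].
    + exists 0, 1; split; [exact: pideal_1|exact: pideal_0|].
      by rewrite tofrac0 rmorph0 mulr0.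
    + exists (e * t' + e' * t), (t * t'); split; first exact: pideal_NM.
        by apply: idealD; first exact: pideal_ideal; apply: idealMr => //; apply: pideal_ideal.
      by rewrite tofracD !tofracM E E' rmorphD; ring.
    + have [e' [t' [xt' E']]] := regular_ringP b Ux.
      exists (e' * e), (t' * t); split; first exact: pideal_NM.
        by apply: idealMl => //; apply: pideal_ideal.
      by rewrite !tofracM E E' rmorphM; ring.
  - move: Q1; rewrite (QE 1 1 1) ?rmorph1 ?mulr1//; exact: pideal_1.
  - have [e [t [xt E]]] := regular_ringP b Ux.
    have [e' [t' [xt' E']]] := regular_ringP c Ux.
    rewrite (QE b e t)// (QE c e' t')// (QE _ (e * e') (t * t')).
    + exact: pideal_M.
    + exact: pideal_NM.
    + by rewrite !tofracM E E' rmorphM; ring.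
exists (MkSpec Qp); apply: Spec_eq => a /=.
rewrite (QE _ a 1)//; first exact: pideal_1.
by rewrite rmorph1 mul1r.
Qed.

(** Only the values on [U] matter; a prime over the generic point serves as default elsewhere. *)
Definition extend (x : Spec A) : Spec B :=
  xget (projT1 (cid (extend_exists Ug))) [set q | contract q = x].

Lemma extendK x : U x -> contract (extend x) = x.
Proof. by move=> /extend_exists[q e]; rewrite /extend; case: xgetP => // /(_ q). Qed.

Lemma contractK q : extend (contract q) = q.
Proof. exact/contract_inj/extendK/contractU. Qed.

Lemma contract_open (O : set (Spec A)) : open O -> open (contract @^-1` O).
Proof.
move=> [S ->]; apply/spec_openP; exists (iota @` S).
apply/seteqP; split=> q /= nS sub; apply: nS.
  by move=> a Sa; apply: sub; exists a.
by move=> _ [a Sa <-]; exact: sub.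
Qed.

(** Replacing [S] by those of its multiples that lie in [A] changes nothing: at a prime avoiding
    [j k], a power of [j k] brings an element of [S] into [A] without affecting its vanishing. *)
Lemma open_contract (W : set (Spec B)) : open W ->
  exists2 O : set (Spec A), open O & forall q, W q <-> O (contract q).
Proof.
move=> [S ->].
pose S' := [set a | exists b c, S b /\ iota a = iota c * b].
exists [set x | ~ (S' `<=` x)]; first by exists S'.
move=> q /=; split=> nS sub; apply: nS.
  move=> b Sb; have [k qk] := contract_pick q; have [N [a E]] := clear_B k b.
  have : pideal q (iota a) by apply: (sub a); exists b, (j k ^+ N).
  by rewrite -E => /pideal_M[]//; rewrite rmorphXn => /(pideal_NX qk).
move=> a [b [c [Sb E]]]; rewrite /= E; apply: idealMl; first exact: pideal_ideal.
exact: sub.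
Qed.

Section OnOpen.
Variable V : set (Spec B).
Local Notation W := (@open_img (SpecScheme A) U
  ((fun u : points X => extend (set_val u)) @^-1` V)).

Lemma imgP x : W x <-> U x /\ V (extend x).
Proof.
split=> [[u Vu <-]|[Ux Vx]]; first by split=> //; exact: set_valP.
by exists (SigSub (mem_set Ux)).
Qed.

Lemma pull_regfun (s : sections V) : regfun f W (fun x => secval theta s (extend x)).
Proof.
move=> x /imgP[Ux Vx].
have [O [oO Ox [b [c h]]]] := secval_regfun vinj s Vx.
have [O' oO' OE] := open_contract oO.
have [k xk] := pick Ux.
have [N [a Ea]] := clear_B k b; have [M [d Ed]] := clear_B k c.
exists (O' `&` [set y | ~ pideal y (j k)]); split.
- by apply: openI => //; apply: spec_open_D.
- by split=> //; rewrite -(extendK Ux) -OE.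
(* Since [b = a / j ^ N] and [c = d / j ^ M], this is the fraction [b / c] written with elements of
   [A]. *)
exists (j k ^+ M * a), (j k ^+ N * d) => y /imgP[Uy Vy] [O'y yk].
have [|yc ->] := h _ Vy; first by rewrite OE extendK.
have yd : ~ pideal y d.
  rewrite -{1}(extendK Uy) /= -Ed; apply: pideal_NM => //.
  by rewrite rmorphXn; apply: pideal_NX => h'; apply: yk; rewrite -(extendK Uy).
split; first by apply: pideal_NM => //; apply: pideal_NX.
have jk0 := theta_neq0 finj yk; have c0 := theta_neq0 vinj yc.
have fa : f a = f (j k) ^+ N * theta b by rewrite -[f a]/(theta (iota a)) -Ea rmorphM -tofracXn.
have fd : f d = f (j k) ^+ M * theta c by rewrite -[f d]/(theta (iota d)) -Ed rmorphM -tofracXn.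
rewrite !rmorphM !rmorphXn /= fa fd.
rewrite mulrA -exprD [_ ^+ N * _]mulrA -exprD addnC -mulf_div divff ?mul1r//.
exact: expf_neq0.
Qed.

Lemma push_regfun (t : sections W) : regfun theta V (fun q => secval f t (contract q)).
Proof.
move=> q Vq; have Wq : W (contract q).
  by apply/imgP; split; [exact: contractU|rewrite contractK].
have [O [oO Oq [a [d h]]]] := secval_regfun finj t Wq.
exists (contract @^-1` O); split=> //; first exact: contract_open.
exists (iota a), (iota d) => q' Vq' Oq'.
have [|qd ->] := h (contract q') _ Oq'; last by [].
by apply/imgP; split; [exact: contractU|rewrite contractK].
Qed.

Definition pull (s : sections V) : sections W :=
  projT1 (cid (section_of finj (pull_regfun s))).

Lemma secval_pull s x : W x -> secval f (pull s) x = secval theta s (extend x).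
Proof. by move=> Wx; rewrite /pull; case: cid => /= t ->. Qed.

Lemma pull_zmod : zmod_morphism pull.
Proof.
move=> s t; apply: (secval_inj finj) => x Wx.
by rewrite secval_pull// (secvalB finj) (secvalB vinj) !secval_pull.
Qed.

Lemma pull_monoid : monoid_morphism pull.
Proof.
split=> [|s t]; apply: (secval_inj finj) => x Wx; rewrite secval_pull//.
  have [_ Vx] := (imgP x).1 Wx.
  by rewrite (secval1 finj Wx) (secval1 vinj Vx).
by rewrite (secvalM finj) (secvalM vinj) !secval_pull.
Qed.

HB.instance Definition _ := GRing.isZmodMorphism.Build (sections V) (sections W)
  pull pull_zmod.
HB.instance Definition _ := GRing.isMonoidMorphism.Build (sections V) (sections W)
  pull pull_monoid.

Lemma pull_bij : bijective pull.
Proof.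
have WV q : V q -> W (contract q).
  by move=> Vq; apply/imgP; split; [exact: contractU|rewrite contractK].
exists (fun t => projT1 (cid (section_of vinj (push_regfun t)))) => s.
  apply: (secval_inj vinj) => q Vq; case: cid => /= t -> //.
  by rewrite secval_pull ?contractK//; apply: WV.
apply: (secval_inj finj) => x Wx; rewrite secval_pull//; case: cid => /= t.
by have [Ux Vx] := (imgP x).1 Wx; move=> ->//; rewrite extendK.
Qed.

End OnOpen.

(** The loci where some [j k] does not vanish cover both [U] and [Spec B], and over each of them [A]
    and [B] have the same localization; so contraction of primes is an isomorphism onto [U]. *)
Lemma affine_open_sufficient : affine_scheme X.
Proof.
exists B, (fun u : points X => extend (set_val u)),
  (fun q => SigSub (mem_set (contractU q))).
exists (fun V _ => [the {rmorphism sections V -> sections _} of @pull V]).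
split; split.
- by move=> u; apply: val_inj; rewrite /= extendK//; apply: set_valP.
- by move=> q; rewrite /= contractK.
- apply/continuousP => W oW; have [O oO OE] := open_contract oW.
  apply/subscheme_openP; exists O => //; apply/seteqP; split=> u /=;
    by rewrite OE extendK//; apply: set_valP.
- apply/continuousP => W /subscheme_openP[O oO ->].
  exact: contract_open.
- by move=> V oV; exact: pull_bij.
- move=> V W oV oW WV s; apply: (secval_inj finj) => x Wx.
  have [_ Vx] := (imgP W x).1 Wx.
  rewrite -[LHS]/(secval f (pull (section_res WV s)) x).
  rewrite -[RHS]/(secval f (section_res (image_subset set_val (preimage_subset WV))
    (pull s)) x).
  rewrite secval_pull// (secval_res _ WV s Vx) (secval_res _ _ _ Wx).
  apply/esym/secval_pull.
  by apply: image_subset Wx => u; apply: WV.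
Qed.

End AffineOpenSufficient.

(** * Complements of effective divisors *)

Section IdealProduct.
Variable R : comPzRingType.
Implicit Types I J : set R.

Definition ideal_prod I J : set R :=
  ideal_gen [set z | exists x y, [/\ I x, J y & z = x * y]].

Lemma ideal_prod_ideal I J : is_ideal (ideal_prod I J).
Proof. exact: ideal_gen_ideal. Qed.

Lemma mem_ideal_prod I J x y : I x -> J y -> ideal_prod I J (x * y).
Proof. by move=> Ix Jy; apply: sub_ideal_gen; exists x, y. Qed.

Lemma ideal_prodMl I J J' c r : (forall y, J y -> J' (c * y)) ->
  ideal_prod I J r -> ideal_prod I J' (c * r).
Proof.
move=> JJ'; apply: (ideal_gen_min (I := [set r | ideal_prod I J' (c * r)])).
  have iP := ideal_prod_ideal I J'.
  split=> [|u v /= hu hv|u v /= hv]; rewrite /= ?mulr0 ?mulrDr ?(mulrCA c).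
  - exact: ideal0 iP.
  - exact: (idealD iP).
  - exact: (idealMl _ iP).
move=> _ [x [y [Ix Jy ->]]] /=; rewrite mulrCA.
by apply: mem_ideal_prod => //; apply: JJ'.
Qed.

End IdealProduct.

Section AffineComplement.
Variable A : idomainType.
Hypotheses (noethA : noetherian A) (normA : normal_domain A).
Local Notation f := (@tofrac A).
Local Notation ordY Y x := (ord (set_val Y) x).
Local Hint Resolve prime_divisorP : core.

Variables (E : Div A) (a : A).
Hypotheses (effE : effective E) (a0 : a != 0) (aE : ideal_of E a).
Local Notation G := (div_elt a - E).

Lemma complementP (x : Spec A) :
  complement E x <-> exists2 e, ideal_of E e & ~ pideal x e.
Proof.
split=> [Ux|[e [->|Ee] xe] Y EY Yx].
- apply: contrapT => no; have [|Y EY Yx] := ideal_of_prime noethA normA (x := x) effE.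
    by move=> e Ee; apply: contrapT => xe; apply: no; exists e.
  exact: Ux EY Yx.
- by apply: xe; apply: pideal_0.
- apply/xe/Yx/(ord_gt0 noethA normA (prime_divisorP Y)); first exact: pideal_neq0 xe.
  by have := Ee Y; have := effE Y; lia.
Qed.

Lemma complement_generic : complement E (generic A).
Proof. by apply/complementP; exists a => //= h; move: a0; rewrite h eqxx. Qed.

Lemma complement_height_one Y : coeff Y E = 0 -> complement E (set_val Y).
Proof.
move=> EY Z EZ ZY; move: EZ; suff -> : Z = Y by rewrite EY eqxx.
apply: val_inj; apply: (height_one_sub (prime_divisorP Y) ZY).
exact: height_one_neq0 (prime_divisorP Z).
Qed.

Lemma a_mem_G : ideal_of G a.
Proof. by apply/(ideal_ofP noethA normA) => //; rewrite opprB addrCA subrr addr0. Qed.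

(** Write [z = c / d] and let [n] bound the orders of [d] along the components of [E]. The poles of
    [z] lie on [E] and have order at most [n]. The coefficients of [E] on its components are at
    least 1 and at most the orders of [a], so [a ^ n z] lies in [A] and has the orders required by
    [n G]. *)
Lemma regular_on_complement z : regular_on (complement E) z ->
  exists n s, ideal_of (G *+ n) s /\ f a ^+ n * z = f s.
Proof.
move=> rz; have [->|z0] := eqVneq z 0.
  by exists 0%N, 0; split; [left|rewrite mulr0 tofrac0].
have [c [d [/= /eqP d0 cd]]] := rz _ complement_generic.
have c0 : c != 0 by rewrite -(tofrac_eq0 c) cd mulf_neq0// tofrac_eq0.
have [n nP] : exists n, forall Y, Y \in dom E -> (ordY Y d <= n)%N.
  elim: (dom E) => [|Y s [n nP]]; first by exists 0%N.
  exists (n + ordY Y d)%N => Z; rewrite in_cons => /orP[/eqP->|/nP h]; lia.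
have ordE Y : [\/ 0 < coeff Y E /\ (ordY Y d <= n)%N |
                  coeff Y E = 0 /\ (ordY Y d <= ordY Y c)%N].
  have [YE|YE] := boolP (Y \in dom E); [left|right].
    by split; [rewrite lt_neqAle eq_sym -mem_dom YE effE|exact: nP].
  have EY := coeff_outdom YE; split=> //.
  have [e [t [Yt et]]] := rz _ (complement_height_one EY).
  have t0 := pideal_neq0 Yt.
  have E1 : e * d = t * c by apply: tofrac_inj; rewrite !tofracM et cd; ring.
  have e0 : e != 0 by apply: contra_neq (mulf_neq0 t0 c0) => e0; rewrite -E1 e0 mul0r.
  have := congr1 (ord (set_val Y)) E1; rewrite !ordM//.
  rewrite (ord_notin noethA normA (prime_divisorP Y) Yt) add0n => <-.
  exact: leq_addl.
have an0 : a ^+ n != 0 by apply: expf_neq0.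
have orda Y : coeff Y E <= (ordY Y a)%:Z.
  by case: aE => [/eqP|//]; rewrite (negbTE a0).
have ordan (Y : prime_divisor A) : ordY Y (a ^+ n * c) = (n * ordY Y a + ordY Y c)%N.
  have hY := prime_divisorP Y.
  by rewrite (ordM noethA normA hY an0 c0) (ordX noethA normA hY).
have [s sE] : divides d (a ^+ n * c).
  apply: ord_divides => //; rewrite ?mulf_neq0// => P hP.
  pose Y : prime_divisor A := SigSub (mem_set hP).
  rewrite -[P]/(set_val Y) ordan; move: (ordE Y) (orda Y).
  move: (coeff Y E) (ordY Y d) (ordY Y a) (ordY Y c) => k i1 i2 i3.
  case=> -[]; last lia.
  move=> k0 le1 le2; have i20 : (0 < i2)%N by lia.
  by apply: leq_trans le1 _; rewrite -[leqLHS]muln1; nia.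
have s0 : s != 0 by apply: contra_neq (mulf_neq0 an0 c0) => s0; rewrite sE s0 mul0r.
exists n, s; split.
  right=> Y; have := congr1 (ord (set_val Y)) sE; rewrite ordan ordM// => ordsE.
  rewrite coeffMn coeffB coeff_div_elt//.
  rewrite -mulr_natl natz; move: ordsE (ordE Y) (orda Y).
  move: (coeff Y E) (ordY Y d) (ordY Y a) (ordY Y c) (ordY Y s) => k i1 i2 i3 i4.
  move=> e h le2; rewrite mulrBr.
  have e' : n%:Z * i2%:Z + i3%:Z = i4%:Z + i1%:Z by rewrite -PoszM -!PoszD e.
  case: h => -[k0 le1]; last by rewrite k0 mulr0 subr0; lia.
  have nk : n%:Z <= n%:Z * k by rewrite ler_peMr//; lia.
  by move: (n%:Z * k) (n%:Z * i2%:Z) e' nk => u v; lia.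
have fd0 : f d != 0 by rewrite tofrac_eq0.
apply: (mulIf fd0); rewrite -tofracM -sE tofracM tofracXn cd; ring.
Qed.

(** The open set is affine exactly when [ideal_of E] generates the unit ideal of its ring of regular
    functions. This ring is the union of the [a ^ -n I(n G)], so the condition is an expression of 1
    by products from [I(E)] and [I(n G)], divided by [a ^ n]. *)
Lemma affine_complementP :
  affine_scheme (@open_subscheme (SpecScheme A) (complement E)) <->
  exists n, ideal_prod (ideal_of E) (ideal_of (G *+ n)) (a ^+ n).
Proof.
split=> [affU|[n /ideal_genP[m [c [s [sP aE']]]]]].
(* [T] is the ideal generated by [ideal_of E] in the ring of regular functions, as the union of the
   [a ^ -n I(E) I(n G)]. *)
- pose T z := exists n r, ideal_prod (ideal_of E) (ideal_of (G *+ n)) r /\ f a ^+ n * z = f r.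
  suff [n [r [rP e]]] : T 1.
    exists n; suff -> : a ^+ n = r by [].
    by apply: tofrac_inj; rewrite tofracXn -e mulr1.
  have iP n := ideal_prod_ideal (ideal_of E) (ideal_of (G *+ n)).
  have up n k r : ideal_prod (ideal_of E) (ideal_of (G *+ n)) r ->
      ideal_prod (ideal_of E) (ideal_of (G *+ (k + n))) (a ^+ k * r).
    apply: ideal_prodMl => y; rewrite mulrnDr.
    apply: ideal_ofM => //; apply: ideal_ofX => //; exact: a_mem_G.
  apply: (@affine_unit _ (complement E) T (ideal_of E)) affU.
  + exact: complement_generic.
  + by move=> x /complementP.
  + by exists 0%N, 0; split; [exact: ideal0 (iP _)|rewrite mulr0 tofrac0].
  + move=> z w [n [r [rP e]]] [m [s [sP e']]].
    exists (m + n)%N, (a ^+ m * r + a ^+ n * s); split.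
      by apply: (idealD (iP _)); [exact: up|rewrite addnC; exact: up].
    by rewrite tofracD !tofracM !tofracXn -e -e' exprD; ring.
  + move=> z w /regular_on_complement[n [s [sP e]]] [m [r [rP e']]].
    exists (n + m)%N, (s * r); split; last by rewrite tofracM -e -e' exprD; ring.
    apply: ideal_prodMl rP => y yP; rewrite mulrnDr.
    exact: ideal_ofM.
  + move=> j Ej; exists 0%N, (j * 1); split; last by rewrite mulr1 expr0 mul1r.
    apply: mem_ideal_prod => //; right=> Y.
    by rewrite mulr0n coeff0.
- have /choice[j /choice[g jgP]] : forall i, exists j g,
    [/\ ideal_of E j, ideal_of (G *+ n) g & s i = j * g] by [].
  have an0 : f a ^+ n != 0 by rewrite expf_neq0// tofrac_eq0.
  apply: (@affine_open_sufficient _ (complement E) m j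
    (fun k => f (c k * g k) / f a ^+ n)).
  + by move=> k x xj; apply/complementP; exists (j k) => //; case: (jgP k).
  + move=> k x /complementP[e Ee xe].
    have [_ gP _] := jgP k.
    (* The product lies in [I(n E + n G)], which is [a ^ n A]; so [e ^ n] is a denominator of the
       function at [x]. *)
    have : ideal_of (div_elt (a ^+ n)) (e ^+ n * (c k * g k)).
      rewrite div_eltX//; have -> : div_elt a *+ n = E *+ n + G *+ n.
        by rewrite -mulrnDl addrC subrK.
      apply: ideal_ofM => //; first exact: ideal_ofX.
      by apply: idealMl => //; apply: ideal_of_ideal.
    case/(ideal_of_div noethA normA _ (expf_neq0 n a0)) => b bE.
    exists b, (e ^+ n); split; first exact: pideal_NX.
    by rewrite mulrA -tofracM bE tofracM tofracXn mulfK.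
  + have fanE : f a ^+ n = \sum_k f (c k) * f (s k).
      by rewrite -tofracXn aE' rmorph_sum; apply: eq_bigr => k _ /=; rewrite tofracM.
    apply: (mulIf an0); rewrite mul1r [LHS]fanE big_distrl /=.
    apply: eq_bigr => k _; have [_ _ ->] := jgP k.
    by rewrite !tofracM -[RHS]mulrA divfK// mulrCA.
  + exact: complement_generic.
Qed.

End AffineComplement.

(** * Coaffine divisors *)

Section Coaffine.
Variable A : idomainType.
Hypotheses (noethA : noetherian A) (normA : normal_domain A).
Implicit Types (a b : A) (D E F H : Div A).

(* Writing [M_n] for [H^0(O(-nF)) = I(nF)], this says that [M_1] lies in the
   radical of the ideal of the [M_(-1) M_(n+1)], [n >= 0], in the graded ring of
   the [M_n].  The factor [b], a nonzero element of [I(F)], clears denominators: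
   [b M_(-1) = I(div b - F)]. *)
Definition radical_condition F b : Prop := forall a, ideal_of F a -> exists n,
  ideal_prod (ideal_of (div_elt b - F)) (ideal_of (F *+ n.+1)) (b * a ^+ n).

(** The ideals of [div a - F] and [div b - F] are [a] and [b] times the same fractional ideal, the
    sections of [O(F)]; multiplication by [b / a] passes from one to the other. *)
Lemma ideal_prod_transfer F a b (J : set A) r : a != 0 -> b != 0 ->
  ideal_of F b -> ideal_prod (ideal_of (div_elt a - F)) J r ->
  exists2 w, ideal_prod (ideal_of (div_elt b - F)) J w & b * r = a * w.
Proof.
move=> a0 b0 Fb; have iP := ideal_prod_ideal (ideal_of (div_elt b - F)) J.
apply: (ideal_gen_min (I := [set r | exists2 w,
  ideal_prod (ideal_of (div_elt b - F)) J w & b * r = a * w])).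
  split=> [|u v [w wP e] [w' wP' e']|u v [w wP e]].
  - by exists 0; [exact: ideal0 iP|rewrite !mulr0].
  - by exists (w + w'); [exact: (idealD iP)|rewrite !mulrDr e e'].
  - by exists (u * w); [exact: (idealMl _ iP)|rewrite mulrCA e mulrCA].
move=> _ [x [y [Ex Jy ->]]].
have : ideal_of (div_elt a) (b * x).
  have -> : div_elt a = F + (div_elt a - F) by rewrite addrC subrK.
  exact: ideal_ofM.
case/(ideal_of_div noethA normA _ a0) => c e.
exists (c * y); last by transitivity (b * x * y); [ring|rewrite e; ring].
apply: mem_ideal_prod => //.
have [x0|x0] := eqVneq x 0.
  left; move/eqP: e; rewrite x0 mulr0 eq_sym mulf_eq0 (negbTE a0) orbF.
  by move/eqP.
have c0 : c != 0.
  by apply: contra_neq (mulf_neq0 b0 x0) => c0; rewrite e c0 mul0r.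
apply/(ideal_ofP noethA normA) => // Y.
move/(ideal_ofP noethA normA _ x0): Ex => /(_ Y).
have := congr1 (fun z : A => coeff Y (div_elt z)) e.
by rewrite /= !div_eltM// !(coeffB, coeffD); lia.
Qed.

(** The effective divisors linearly equivalent to [D] are the [div a - F] with [a] nonzero in
    [I(F)]. For such a divisor the affineness criterion puts [a ^ n] in [a M_(-1) M_n]; replacing
    the outer [a] by [b] and cancelling one factor [a] gives the radical condition with exponent
    [n - 1]. *)
Lemma coaffineP D F b : b != 0 -> effective F -> principal (F + D) -> ideal_of F b ->
  coaffine D <-> radical_condition F b.
Proof.
move=> b0 eF pFD Fb.
have GE a : div_elt a - (div_elt a - F) = F by rewrite opprB addrC subrK.
split=> [cD a Fa|rF E eE pED].
- have [->|a0] := eqVneq a 0.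
    (* The exponent is 1 because [0 ^ 0 = 1]. *)
    exists 1%N; rewrite expr1 mulr0; exact: ideal0 (ideal_prod_ideal _ _).
  have eE : effective (div_elt a - F) by apply/(ideal_ofP noethA normA).
  have aE : ideal_of (div_elt a - F) a.
    by apply/(ideal_ofP noethA normA) => //; rewrite GE.
  have : affine_scheme (@open_subscheme (SpecScheme A) (complement (div_elt a - F))).
    apply: cD => //; rewrite /lin_equiv -addrA -opprD.
    by apply: principalD => //; [exact: principal_div_elt|exact: principalN].
  case/(affine_complementP noethA normA eE a0 aE) => n; rewrite GE.
  move=> /(ideal_prod_transfer a0 b0 Fb)[w wP e].
  case: n wP e => [|n] wP e.
    (* The exponent 0 cannot be lowered; instead [a], an element of [I(F)], raises the degree of the
       second factor by one. *)
    exists 0%N; rewrite e; apply: ideal_prodMl wP => y _; rewrite mulrC.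
    by rewrite mulr1n; apply: idealMl => //; exact: ideal_of_ideal.
  exists n; suff -> : b * a ^+ n = w by [].
  by apply: (mulfI a0); rewrite -e exprS mulrCA.
- have pEF : principal (E + F).
    have -> : E + F = (E - D) + (F + D) by rewrite addrACA addNr addr0.
    exact: principalD.
  have [|a a0 EFa] := effective_principal noethA normA pEF.
    by move=> Y; rewrite coeffD addr_ge0.
  have EE : E = div_elt a - F by rewrite -EFa addrK.
  have Fa : ideal_of F a.
    by apply/(ideal_ofP noethA normA) => //; rewrite -EE.
  have aE : ideal_of E a.
    by apply/(ideal_ofP noethA normA) => //; rewrite EE GE.
  have [n] := rF a Fa.
  move=> /(ideal_prod_transfer b0 a0 Fa)[w wP e].
  apply/(affine_complementP noethA normA eE a0 aE); exists n.+1.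
  rewrite EE GE; suff -> : a ^+ n.+1 = w by [].
  by apply: (mulfI b0); rewrite -e exprS mulrCA.
Qed.

(** With [F = div c] and [b = e c], the factor [e] lies in [I(div b - F)] and [c] in [I(F)], so the
    exponent 0 serves every [a]. *)
Lemma radical_condition_principal F b : b != 0 -> effective F -> principal F ->
  ideal_of F b -> radical_condition F b.
Proof.
move=> b0 eF pF Fb a Fa; exists 0%N; rewrite mulr1.
have [c c0 Fc] := effective_principal noethA normA pF eF.
move: Fb; rewrite Fc => /(ideal_of_div noethA normA _ c0)[e be].
have e0 : e != 0 by apply: contra_neq b0 => e0; rewrite be e0 mul0r.
rewrite {2}be; apply: mem_ideal_prod.
  by rewrite be div_eltM// addrK; right=> Y; rewrite coeff_div_elt.
by rewrite mulr1n; right=> Y; rewrite coeff_div_elt.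
Qed.

(** Taking [F = div c - D] with [c] in [I(D)] turns the sections of [O(D)] into an ideal of [A]:
    they form a module isomorphic to [I(F)]. *)
Lemma anti_effective D : exists F b, [/\ b != 0, effective F, principal (F + D) & ideal_of F b].
Proof.
have [c c0 Dc] := ideal_of_neq0 noethA normA D.
have eF : effective (div_elt c - D) by apply/(ideal_ofP noethA normA).
have [b b0 Fb] := ideal_of_neq0 noethA normA (div_elt c - D).
exists (div_elt c - D), b; split=> //.
by rewrite subrK; apply: principal_div_elt.
Qed.

Lemma principal_coaffine D : principal D -> coaffine D.
Proof.
move=> pD; have [F [b [b0 eF pFD Fb]]] := anti_effective D.
apply/(coaffineP b0 eF pFD Fb); apply: radical_condition_principal => //.
have -> : F = (F + D) - D by rewrite addrK.
by apply: principalD => //; apply: principalN.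
Qed.

(** Principal multiples are coaffine anyway, which absorbs the second alternative of the
    definition. *)
Lemma strongly_coaffineP D : strongly_coaffine D <-> forall n : int, coaffine (D *~ n).
Proof.
split=> [sD n|cD n]; last by left.
by case: (sD n) => //; apply: principal_coaffine.
Qed.

Lemma coaffine_lin_equiv D E : lin_equiv D E -> coaffine D -> coaffine E.
Proof.
move=> DE cD G eG GE; apply: cD => //.
by apply: (lin_equiv_trans noethA normA GE); apply: lin_equiv_sym.
Qed.

Lemma strongly_coaffine_lin_equiv D E : lin_equiv D E ->
  strongly_coaffine D -> strongly_coaffine E.
Proof.
move=> DE /strongly_coaffineP sD; apply/strongly_coaffineP => n.
apply: coaffine_lin_equiv (sD n).
by rewrite /lin_equiv -mulrzBl; apply: principalMz.
Qed.

Lemma principal_affine_trivial D : principal D -> affine_trivial D.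
Proof.
move=> pD E; apply: strongly_coaffine_lin_equiv.
by apply: lin_equiv_sym; rewrite /lin_equiv addrK.
Qed.

End Coaffine.

(** * Flatness *)

Lemma freeg_zmod_ind (K : choiceType) (P : {freeg K / int} -> Prop) :
  P 0 -> (forall z w, P z -> P w -> P (z - w)) -> (forall k, P << k >>) -> forall z, P z.
Proof.
move=> P0 PB Pk z.
have PN w : P w -> P (- w) by move=> Pw; rewrite -sub0r; apply: PB.
have PD w w' : P w -> P w' -> P (w + w').
  by move=> Pw Pw'; rewrite -[w']opprK; apply: PB => //; apply: PN.
have Pn n w : P w -> P (w *+ n).
  by move=> Pw; elim: n => [//|n ih]; rewrite mulrS; apply: PD.
rewrite -[z]freeg_sumE; apply: (big_ind P) => // k _.
have -> : << (coeff k z) *g k >> = << k >> *~ coeff k z by rewrite freeg_mulz intz.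
by case: (coeff k z) => n; [exact: Pn|rewrite NegzE mulrNz; apply/PN/Pn].
Qed.

Section TensorTheory.
Variables (R : comNzRingType) (M N : lmodType R).

Lemma tensor_classB (z w : {freeg (M * N)%type / int}) :
  tensor_class (z - w) = tensor_class z - tensor_class w.
Proof. exact: raddfB. Qed.

Lemma tensor_class_eq (z w : {freeg (M * N)%type / int}) :
  tensor_class z = tensor_class w <-> z - w \in @tensor_null R M N.
Proof.
rewrite Quotient.idealrBE; split=> [e|/eqP]; first exact/eqP.
by [].
Qed.

Definition tens (m : M) (n : N) : tensor M N := tensor_class << (m, n) >>.

Lemma tensor_null_rel z : @tensor_rel R M N z -> z \in @tensor_null R M N.
Proof. by move=> rz; apply/asboolP => S _; apply. Qed.

Lemma tensor_class0 z : z \in @tensor_null R M N -> tensor_class z = 0.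
Proof.
move=> z0; rewrite -(subrr (tensor_class z)) -tensor_classB subrr.
by apply/tensor_class_eq; rewrite subr0.
Qed.

Lemma tensDl m m' n : tens (m + m') n = tens m n + tens m' n.
Proof.
apply/eqP; rewrite -subr_eq0 opprD addrA /tens -!tensor_classB.
by apply/eqP/tensor_class0/tensor_null_rel; left; exists m, m', n.
Qed.

Lemma tensDr m n n' : tens m (n + n') = tens m n + tens m n'.
Proof.
apply/eqP; rewrite -subr_eq0 opprD addrA /tens -!tensor_classB.
by apply/eqP/tensor_class0/tensor_null_rel; right; left; exists m, n, n'.
Qed.

Lemma tensZ a m n : tens (a *: m) n = tens m (a *: n).
Proof.
apply/eqP; rewrite -subr_eq0 /tens -!tensor_classB.
by apply/eqP/tensor_class0/tensor_null_rel; right; right; exists a, m, n.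
Qed.

Lemma tens0l n : tens 0 n = 0.
Proof. by apply: (addrI (tens 0 n)); rewrite -tensDl !addr0. Qed.

Lemma tens0r m : tens m 0 = 0.
Proof. by apply: (addrI (tens m 0)); rewrite -tensDr !addr0. Qed.

Lemma tens_suml (I : Type) (r : seq I) (F : I -> M) n :
  tens (\sum_(i <- r) F i) n = \sum_(i <- r) tens (F i) n.
Proof. by apply: (big_morph (tens^~ n)) => [m m'|]; rewrite ?tensDl ?tens0l. Qed.

Lemma tens_sumr (I : Type) (r : seq I) (F : I -> N) m :
  tens m (\sum_(i <- r) F i) = \sum_(i <- r) tens m (F i).
Proof. by apply: (big_morph (tens m)) => [n n'|]; rewrite ?tensDr ?tens0r. Qed.

Lemma tensor_ind (P : tensor M N -> Prop) :
  P 0 -> (forall u v, P u -> P v -> P (u - v)) -> (forall m n, P (tens m n)) ->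
  forall u, P u.
Proof.
move=> P0 PB Pt u; rewrite -[u]reprK -/(tensor_class (repr u)).
apply: (freeg_zmod_ind (P := fun z => P (tensor_class z))).
- by rewrite -(subrr 0) tensor_classB subrr.
- by move=> z w; rewrite tensor_classB; apply: PB.
- by move=> [m n]; apply: Pt.
Qed.

End TensorTheory.

Section TensorMapTheory.
Variables (R : comNzRingType) (M N N' : lmodType R) (f : {linear N -> N'}).

Lemma tensor_mapB : {morph @tensor_map R M _ _ f : u v / u - v}.
Proof.
move=> u v; rewrite -[u]reprK -[v]reprK -!/(tensor_class _) -tensor_classB !tensor_mapE.
by rewrite tensor_funB tensor_classB.
Qed.

Lemma tensor_map0 : @tensor_map R M _ _ f 0 = 0.
Proof. by rewrite -(subrr 0) tensor_mapB subrr. Qed.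

Lemma tensor_mapD : {morph @tensor_map R M _ _ f : u v / u + v}.
Proof.
move=> u v; rewrite -{1}[v]opprK -[- v]sub0r !tensor_mapB tensor_map0.
by rewrite sub0r opprK.
Qed.

Lemma tensor_map_tens (m : M) n : tensor_map f (tens m n) = tens m (f n).
Proof. by rewrite tensor_mapE tensor_fun1. Qed.

Lemma tensor_map_sum (I : Type) (r : seq I) (F : I -> tensor M N) :
  tensor_map f (\sum_(i <- r) F i) = \sum_(i <- r) tensor_map f (F i).
Proof. exact: (big_morph _ tensor_mapD tensor_map0). Qed.

End TensorMapTheory.

Section KernelModule.
Variables (R : comNzRingType) (n r : nat) (G : 'M[R]_(n, r)).

Definition kernel_pred : {pred 'rV[R]_n} := fun v => v *m G == 0.

Lemma kernel_submod : submod_closed kernel_pred.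
Proof.
split=> [|a u v]; rewrite !unfold_in ?mul0mx// => /eqP u0 /eqP v0.
by rewrite mulmxDl -scalemxAl u0 v0 scaler0 addr0.
Qed.

HB.instance Definition _ := GRing.isSubmodClosed.Build R 'rV[R]_n kernel_pred
  kernel_submod.

Record kernel_module : Type := MkKernel {
  kernel_val :> 'rV[R]_n;
  kernel_valP : kernel_val \in kernel_pred
}.

HB.instance Definition _ := [isSub for kernel_val].
HB.instance Definition _ := [Choice of kernel_module by <:].
HB.instance Definition _ := [SubChoice_isSubLmodule of kernel_module by <:].

Definition kernel_incl : {linear kernel_module -> 'rV[R]_n} := val.

Lemma kernel_exact : exact kernel_incl (mulmxr G).
Proof.
move=> v; split=> [/= vG|[u <-]]; last exact/eqP/(kernel_valP u).
have vk : v \in kernel_pred by rewrite unfold_in vG.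
by exists (MkKernel vk).
Qed.

End KernelModule.

Section Flatness.
Variables (A A' : comNzRingType) (phi : {rmorphism A -> A'}).
Hypothesis ff : faithfully_flat phi.
Local Notation M := (restrict_scalars phi).
Local Notation "G ^phi" := (map_mx phi G) (at level 2).

Section Evaluation.
Variable n : nat.

(** This induces the canonical map from the tensor product of [A'] with [A^n] to [A'^n], which reads
    equalities of tensors as equalities of rows. [zmodule] supplies the integer scaling that
    [fglift] expects. *)
Definition eval_pair (k : M * 'rV[A]_n) : zmodule 'rV[A']_n := (k.1 : A') *: k.2^phi.

Definition eval_freeg (z : {freeg (M * 'rV[A]_n)%type / int}) : 'rV[A']_n :=
  fglift eval_pair z.

Lemma eval_freegB z w : eval_freeg (z - w) = eval_freeg z - eval_freeg w.
Proof. exact: (@lift_is_additive _ _ _ eval_pair z w). Qed.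

Lemma eval_freeg1 k : eval_freeg << k >> = eval_pair k.
Proof. by rewrite /eval_freeg liftU scale1r. Qed.

Lemma eval_freeg0 : eval_freeg 0 = 0.
Proof. by rewrite -(subrr 0) eval_freegB subrr. Qed.

Lemma eval_freeg_sum (I : Type) (r : seq I) F :
  eval_freeg (\sum_(i <- r) F i) = \sum_(i <- r) eval_freeg (F i).
Proof.
apply: (big_morph eval_freeg _ eval_freeg0) => z w.
by rewrite -{1}[w]opprK -[- w]sub0r !eval_freegB eval_freeg0 sub0r opprK.
Qed.

Lemma eval_freeg_null z : z \in @tensor_null A M 'rV[A]_n -> eval_freeg z = 0.
Proof.
move=> /asboolP zP; apply/eqP; apply: (zP (fun z => eval_freeg z == 0)).
  split=> [|u v]; rewrite !unfold_in.
    by rewrite eval_freeg0.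
  by move=> /eqP u0 /eqP v0; rewrite eval_freegB u0 v0 subr0.
move=> _ [[m [m' [v ->]]]|[[m [v [v' ->]]]|[a [m [v ->]]]]];
  rewrite unfold_in !eval_freegB !eval_freeg1 /eval_pair /=.
- by rewrite scalerDl addrAC addrK subrr.
- by rewrite map_mxD scalerDr addrAC addrK subrr.
- by rewrite map_mxZ scalerA [_ * phi a]mulrC subrr.
Qed.

Lemma eval_class z w : tensor_class z = tensor_class w -> eval_freeg z = eval_freeg w.
Proof.
move=> /tensor_class_eq/eval_freeg_null; rewrite eval_freegB => /eqP.
by rewrite subr_eq0 => /eqP.
Qed.

End Evaluation.

(** The sequence [ker G -> A^n -> A^r] stays exact after tensoring with [A']. A solution over [A']
    therefore comes from a tensor over [ker G], and decomposing this tensor into pure ones writes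
    [x] as a combination of solutions over [A], the rows of [N]. *)
Lemma flat_equational_criterion n r (G : 'M[A]_(n, r)) (x : 'rV[A']_n) : x *m G^phi = 0 ->
  exists k (N : 'M[A]_(k, n)) (m : 'rV[A']_k), N *m G = 0 /\ x = m *m N^phi.
Proof.
move=> xG; have [/(_ (@kernel_exact A n r G)) ex _] := ff (@kernel_incl A n r G) (mulmxr G).
pose z := \sum_k << (x 0 k : M, delta_mx 0 k : 'rV[A]_n) >> : {freeg (M * 'rV[A]_n)%type / int}.
have zE : tensor_class z = \sum_k tens (x 0 k : M) (delta_mx 0 k : 'rV[A]_n).
  exact: raddf_sum.
have zG : tensor_map (mulmxr G) (tensor_class z) = 0.
  rewrite zE tensor_map_sum.
  transitivity (\sum_k \sum_i tens (phi (G k i) * x 0 k : M) (delta_mx 0 i : 'rV[A]_r)).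
    apply: eq_bigr => k _; rewrite tensor_map_tens /= -rowE [row k G]row_sum_delta.
    rewrite tens_sumr; apply: eq_bigr => i _.
    by rewrite -tensZ mxE.
  rewrite exchange_big big1// => i _; rewrite -tens_suml.
  have -> : \sum_k (phi (G k i) * x 0 k : M) = 0; last exact: tens0l.
  suff h : \sum_k phi (G k i) * x 0 k = 0 by exact: h.
  have := congr1 (fun y : 'rV_r => y 0 i) xG; rewrite !mxE => xG0.
  by rewrite -[RHS]xG0; apply: eq_bigr => k _; rewrite mxE mulrC.
have [u uE] := (ex _).1 zG.
have xE : x = eval_freeg (tensor_fun (@kernel_incl A n r G) (repr u)).
  have := uE; rewrite -[u in LHS]reprK -/(tensor_class _) tensor_mapE.
  move/eval_class => ->; rewrite [LHS]row_sum_delta.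
  rewrite /z eval_freeg_sum.
  by apply: eq_bigr => k _; rewrite eval_freeg1 /eval_pair /= map_delta_mx.
rewrite {}xE; elim/freeg_zmod_ind: (repr u) => [|v w|[m v]].
- exists 0%N, 0, 0; rewrite mul0mx; split=> //.
  by rewrite mul0mx -[0 in LHS](subrr 0) tensor_funB subrr eval_freeg0.
- move=> [k [N [m [NG mN]]]] [k' [N' [m' [NG' mN']]]].
  exists (k + k')%N, (col_mx N N'), (row_mx m (- m')); split.
    by rewrite mul_col_mx NG NG' col_mx0.
  by rewrite map_col_mx mul_row_col tensor_funB eval_freegB mN mN' mulNmx.
- exists 1%N, (v : 'rV[A]_n), (m : A')%:M; split.
    exact/eqP/(kernel_valP v).
  by rewrite tensor_fun1 eval_freeg1 /eval_pair /= mul_scalar_mx.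
Qed.

(** Faithfulness applied to [A^n -> A -> 0]: after tensoring with [A'] the map given by [s] is onto,
    the entries of [x] providing preimages, so it was onto before. *)
Lemma unit_ideal_descent n (s : 'cV[A]_n) (x : 'rV[A']_n) : x *m s^phi = 1%:M ->
  exists a : 'rV[A]_n, a *m s = 1%:M.
Proof.
move=> xs; have [_ ex] := ff (mulmxr s : {linear 'rV[A]_n -> 'rV[A]_1})
  (mulmxr (0 : 'M[A]_(1, 0)) : {linear 'rV[A]_1 -> 'rV[A]_0}).
apply: (ex _ 1%:M).1; last by rewrite /= mulmx0.
move=> y; split=> [_|_].
  elim/tensor_ind: y => [|u v [u' <-] [v' <-]|m v].
  - by exists 0; apply: tensor_map0.
  - by exists (u' - v'); apply: tensor_mapB.
  - exists (\sum_k tens (x 0 k * m : M) (v 0 0 *: delta_mx 0 k : 'rV[A]_n)).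
    rewrite tensor_map_sum.
    transitivity (\sum_k tens (phi (s k 0) * (x 0 k * m) : M) v).
      apply: eq_bigr => k _; rewrite tensor_map_tens /= -scalemxAl -rowE.
      have -> : row k s = s k 0 *: 1%:M.
        by apply/matrixP => i j; rewrite !ord1 !mxE mulr1.
      rewrite scalerA [v 0 0 * _]mulrC -scalerA -tensZ.
      have -> : v 0 0 *: 1%:M = v by apply/matrixP => i j; rewrite !ord1 !mxE mulr1.
      by [].
    rewrite -tens_suml; congr tens.
    suff h : \sum_k phi (s k 0) * (x 0 k * m) = m by exact: h.
    have := congr1 (fun y : 'M_1 => y 0 0) xs; rewrite !mxE => /(congr1 (fun c => c * m)).
    rewrite mul1r => xsm; rewrite -[RHS]xsm big_distrl /=.
    by apply: eq_bigr => k _; rewrite mxE mulrA [phi _ * _]mulrC.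
elim/tensor_ind: y => [|u v u0 v0|m v].
- exact: tensor_map0.
- by rewrite tensor_mapB u0 v0 subrr.
- by rewrite tensor_map_tens /= mulmx0; apply: tens0r.
Qed.

End Flatness.

(** * Extension of ideals *)

Section Extension.
Variables (A A' : idomainType) (phi : {rmorphism A -> A'}).
Implicit Types I J : set A.

Definition ext_ideal I : set A' := ideal_gen (phi @` I).

Lemma ext_ideal_ideal I : is_ideal (ext_ideal I).
Proof. exact: ideal_gen_ideal. Qed.

Lemma mem_ext_ideal I a : I a -> ext_ideal I (phi a).
Proof. by move=> Ia; apply: sub_ideal_gen; exists a. Qed.

Lemma ext_idealS I J : I `<=` J -> ext_ideal I `<=` ext_ideal J.
Proof. by move=> IJ; apply: ideal_genS => _ [a /IJ Ja <-]; exists a. Qed.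

Lemma ext_ideal_prod I J : ideal_prod (ext_ideal I) (ext_ideal J) `<=` ext_ideal (ideal_prod I J).
Proof.
have iP := ext_ideal_ideal (ideal_prod I J).
apply: ideal_gen_min => // _ [x [y [Ix Jy ->]]].
move: x Ix; apply: (ideal_gen_min (I := [set x | ext_ideal (ideal_prod I J) (x * y)])).
  split=> [|u v /= uP vP|u v /= vP]; rewrite /= ?mul0r ?mulrDl -?mulrA.
  - exact: ideal0 iP.
  - exact: (idealD iP).
  - exact: (idealMl _ iP).
move=> _ [a Ia <-] /=; move: y Jy.
apply: (ideal_gen_min (I := [set y | ext_ideal (ideal_prod I J) (phi a * y)])).
  split=> [|u v /= uP vP|u v /= vP]; rewrite /= ?mulr0 ?mulrDr ?[phi a * (_ * _)]mulrCA.
  - exact: ideal0 iP.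
  - exact: (idealD iP).
  - exact: (idealMl _ iP).
move=> _ [b Jb <-] /=; rewrite -rmorphM; apply: mem_ext_ideal.
exact: mem_ideal_prod.
Qed.

Hypotheses (noethA : noetherian A) (ff : faithfully_flat phi).

(** With generators [s_i] of [J], the equations [x s_i = y_i b] form a linear system over [A] in the
    unknowns [x] and [y_i]. A solution over [A'] is a combination of solutions over [A], whose first
    coordinates lie in the colon ideal. *)
Lemma flat_colon J b x : is_ideal J ->
  (forall h, J h -> divides (phi b) (x * phi h)) ->
  ext_ideal [set c | forall h, J h -> divides b (c * h)] x.
Proof.
move=> iJ xJ; have [s sE] := noethA iJ.
have Js i : J s`_i.
  have [is_|is_] := ltnP i (size s); last by rewrite nth_default//; exact: ideal0.
  by rewrite {1}sE; apply: sub_ideal_gen; apply: mem_nth.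
have /choice[y yE] : forall i : 'I_(size s), exists y, x * phi s`_i = y * phi b.
  by move=> i; exact: xJ.
pose G := col_mx (\row_(i < size s) s`_i) (- b%:M).
have [|k [N [m [NG]]]] := flat_equational_criterion ff (G := G) (x := row_mx x%:M (\row_i y i)).
  rewrite map_col_mx mul_row_col mul_scalar_mx map_mxN map_scalar_mx mulmxN mul_mx_scalar.
  by apply/rowP => i; rewrite !mxE yE mulrC subrr.
rewrite -[N]hsubmxK map_row_mx mul_mx_row => /eq_row_mx[xE _].
have -> : x = \sum_l m 0 l * phi (lsubmx N l 0).
  have := congr1 (fun z : 'M_1 => z 0 0) xE; rewrite !mxE mulr1n => ->.
  by apply: eq_bigr => l _; rewrite !mxE.
apply: ideal_sum; first exact: ext_ideal_ideal.
move=> l _; apply: (idealMl _ (ext_ideal_ideal _)); apply: mem_ext_ideal => h Jh.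
have Ns i : divides b (lsubmx N l 0 * s`_i).
  have [is_|is_] := ltnP i (size s); last by rewrite nth_default// mulr0; exists 0; rewrite mul0r.
  exists (rsubmx N l (Ordinal is_)).
  move: NG; rewrite -[N]hsubmxK mul_row_col mulmxN mul_mx_scalar row_mxKl row_mxKr.
  move/(congr1 (fun z : 'M_(k, size s) => z l (Ordinal is_))); rewrite !mxE big_ord1 !mxE.
  by move/eqP; rewrite subr_eq0 => /eqP ->; rewrite mulrC.
move: h Jh; rewrite sE; apply: ideal_gen_min.
  split=> [|u v|u v]; rewrite /=.
  - by rewrite mulr0; exists 0; rewrite mul0r.
  - by rewrite mulrDr; apply: idealD; exact: (divides_ideal b).
  - by rewrite mulrCA; apply: idealMl; exact: (divides_ideal b).
by move=> h /= /(nthP 0)[i _ <-].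
Qed.

(** If [phi c] is the sum of the [x_k phi (i_k)], then [(1, x)] solves the system
    [t c = sum x_k i_k]. It is a combination of solutions over [A]; their first coordinates [t]
    generate the unit ideal over [A'], hence over [A], and each [t c] lies in [I]. *)
Lemma ext_contract I c : is_ideal I -> ext_ideal I (phi c) -> I c.
Proof.
move=> iI /ideal_genP[n [x [s [sI cE]]]].
have /choice[i /all_and2[Ii siE]] : forall k, exists i, I i /\ s k = phi i.
  by move=> k; have [i Ii <-] := sI k; exists i.
pose G := col_mx c%:M (- \col_k i k).
have [|k [N [m [NG]]]] := flat_equational_criterion ff (G := G) (x := row_mx 1%:M (\row_k x k)).
  rewrite map_col_mx mul_row_col mul1mx map_mxN mulmxN map_scalar_mx.
  apply/matrixP => r t; rewrite !ord1 !mxE cE mulr1n -sumrN -big_split big1// => l _.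
  by rewrite !mxE siE /= subrr.
rewrite -[N]hsubmxK map_row_mx mul_mx_row => /eq_row_mx[xE _].
have [a aE] := unit_ideal_descent ff (esym xE).
have -> : c = \sum_l a 0 l * (lsubmx N l 0 * c).
  rewrite -[LHS]mul1r; have := congr1 (fun z : 'M_1 => z 0 0) aE.
  rewrite !mxE mulr1n => <-; rewrite big_distrl /=.
  by apply: eq_bigr => l _; rewrite mulrA.
apply: ideal_sum => // l _; apply: idealMl => //.
suff -> : lsubmx N l 0 * c = \sum_k0 rsubmx N l k0 * i k0.
  by apply: ideal_sum => // k0 _; apply: idealMl.
move: NG; rewrite -[N]hsubmxK mul_row_col mulmxN mul_mx_scalar row_mxKl row_mxKr.
move/(congr1 (fun z : 'M_(k, 1) => z l 0)); rewrite !mxE => /eqP.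
rewrite subr_eq0 mulrC => /eqP ->.
by apply: eq_bigr => k0 _; rewrite !mxE.
Qed.

Lemma ff_inj : injective phi.
Proof.
move=> a b ab; apply/eqP; rewrite -subr_eq0; apply/eqP.
apply: (ext_contract (I := [set 0])); first by case: (zero_prime A).
rewrite rmorphB ab subrr; exact: ideal0 (ext_ideal_ideal _).
Qed.

Lemma ff_neq0 a : a != 0 -> phi a != 0.
Proof. by apply: contra_neq => h; apply: ff_inj; rewrite h rmorph0. Qed.

End Extension.

(** * Pull-back of divisors *)

Section ExactOrder.
Variable A : idomainType.
Hypotheses (noethA : noetherian A) (normA : normal_domain A).
Local Notation ordY Y x := (ord (set_val Y) x).

Lemma prime_divisor_eq (Y Z : prime_divisor A) : set_val Y `<=` set_val Z -> Y = Z.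
Proof.
move=> YZ; apply: val_inj; apply: (height_one_sub (prime_divisorP Z) YZ).
exact: height_one_neq0 (prime_divisorP Y).
Qed.

(** An element of [I(H')] outside [Y], where [H'] is [H] without its component [Y], is multiplied by
    a power of an element of order 1 at [Y]. Thus [H] can be recovered from the orders of the
    elements of its ideal. *)
Lemma ideal_of_exact (H : Div A) (Y : prime_divisor A) : effective H ->
  exists h, [/\ h != 0, ideal_of H h & (ordY Y h)%:Z = coeff Y H].
Proof.
move=> eH; pose H' := H - << coeff Y H *g Y >>.
have H'E Z : coeff Z H' = if Z == Y then 0 else coeff Z H.
  rewrite coeffB coeffU eq_sym; have [->|_] := eqVneq Z Y.
    by rewrite mulr1 subrr.
  by rewrite mulr0 subr0.
have eH' : effective H' by move=> Z; rewrite H'E; case: ifP.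
have [d H'd Yd] : exists2 d, ideal_of H' d & ~ pideal (set_val Y) d.
  apply: contrapT => no.
  have [|Z + ZY] := ideal_of_prime noethA normA (x := set_val Y) eH'.
    by move=> d H'd; apply: contrapT => Yd; apply: no; exists d.
  by rewrite H'E (prime_divisor_eq ZY) eqxx.
have d0 := pideal_neq0 Yd.
have [p p0 p1] := ord_eq1 noethA normA (prime_divisorP Y).
have pn0 : p ^+ `|coeff Y H|%N != 0 by apply: expf_neq0.
exists (p ^+ `|coeff Y H|%N * d); split; first exact: mulf_neq0.
- rewrite [X in ideal_of X _](_ : H = << coeff Y H *g Y >> + H'); last by rewrite addrC subrK.
  apply: ideal_ofM => //; right=> Z; rewrite coeffU; have [<-|_] := eqVneq Y Z.
    by rewrite (ordX noethA normA (prime_divisorP Y))// p1 mulr1 muln1; have := eH Y; lia.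
  by rewrite mulr0.
- rewrite (ordM noethA normA (prime_divisorP Y) pn0 d0).
  rewrite (ordX noethA normA (prime_divisorP Y))// p1.
  rewrite (ord_notin noethA normA (prime_divisorP Y) Yd).
  by have := eH Y; lia.
Qed.

End ExactOrder.

Section Pullback.
Variables (A A' : idomainType) (phi : {rmorphism A -> A'}).
Hypotheses (noethA : noetherian A) (normA : normal_domain A).
Hypotheses (noethA' : noetherian A') (normA' : normal_domain A').
Hypothesis ff : faithfully_flat phi.
Local Notation ordY Y x := (ord (set_val Y) x).
Implicit Types (D E F H : Div A) (a b : A).

Let ord_notin' (Z : prime_divisor A') x :=
  @ord_notin _ noethA' normA' _ (prime_divisorP Z) x.

Section Contraction.
Variable Z : prime_divisor A'.

Lemma contraction_prime : is_prime_ideal [set a | pideal (set_val Z) (phi a)].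
Proof.
split=> [||a b]; rewrite /= ?rmorph1 ?rmorphM; last 2 first.
- exact: pideal_1.
- exact: pideal_M.
split=> [|a b /= za zb|a b /= zb]; rewrite /= ?rmorph0 ?rmorphD ?rmorphM.
- exact: pideal_0.
- by apply: idealD => //; apply: pideal_ideal.
- by apply: idealMl => //; apply: pideal_ideal.
Qed.

Definition contraction : Spec A := MkSpec contraction_prime.

(* If [Q] is not of height one then [(b : Q)] is [b A_Q], so by flatness
   [(b : Q A')] is [b A'_Q]; but [(b : Z)] is not contained in [b A'_Z]. *)
Lemma contraction_height_one : (exists2 b, pideal contraction b & b != 0) ->
  height_one contraction.
Proof.
move=> [b Qb b0]; apply: contrapT => nQ.
have fb0 := ff_neq0 ff b0.
have [a' Za'] := height_one_colon noethA' (prime_divisorP Z) Qb fb0.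
have a'Q : ext_ideal phi [set c | forall h, pideal contraction h -> divides b (c * h)] a'.
  apply: (flat_colon noethA ff); first exact: pideal_ideal.
  by move=> h Qh; rewrite mulrC; apply/Za'.
have [t Qt dt] : exists2 t, ~ pideal contraction t & divides (phi b) (phi t * a').
  apply: (ideal_gen_min (I := [set a' | exists2 t, ~ pideal contraction t &
      divides (phi b) (phi t * a')])) a'Q.
    split=> [|u v [t Qt du] [s Qs dv]|u v [t Qt dv]].
    - by exists 1; [exact: pideal_1|exists 0; rewrite mulr0 mul0r].
    - exists (t * s); first exact: pideal_NM.
      rewrite mulrDr; apply: idealD; first exact: (divides_ideal (phi b)).
        by rewrite rmorphM mulrAC mulrC; apply: idealMl => //; exact: (divides_ideal (phi b)).
      by rewrite rmorphM -mulrA; apply: idealMl => //; exact: (divides_ideal (phi b)).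
    - by exists t => //; rewrite mulrCA; apply: idealMl => //; exact: (divides_ideal (phi b)).
  (* If no element outside [Q] brought [c] into [b A], the colon ideal [(b : c)] would be [Q], which
     would then have height one. *)
  move=> _ [c cQ <-]; apply: contrapT => no; apply: nQ.
  apply: (colon_height_one noethA normA (a := c) (b := b)) => // r; split=> [Qr|d].
    by rewrite mulrC; apply: cQ.
  apply: contrapT => Qr; apply: no; exists r => //.
  by case: d => e E; exists (phi e); rewrite -!rmorphM E.
by apply: Qt; apply/Za'.
Qed.

Definition ramification := mult (set_val Z) (phi @` contraction).

(** Elements outside the contraction map outside [Z], so orders at [Z] are orders below times the
    order of [phi p]. The latter is least among the images of the contraction and hence equals the
    multiplicity. *)
Lemma ord_contraction a : height_one contraction -> a != 0 ->
  ordY Z (phi a) = (ord contraction a * ramification)%N.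
Proof.
move=> hQ; have [p [Qp p0 [ordp _]]] := ord_uniformizer noethA normA hQ.
have ordpE x : x != 0 -> ordY Z (phi x) = (ord contraction x * ordY Z (phi p))%N.
  move=> x0; have [t [y [Qt Qy e]]] := ordp x x0.
  have := congr1 (fun z => ordY Z (phi z)) e; rewrite /= !rmorphM rmorphXn.
  rewrite !(ordM noethA' normA' (prime_divisorP Z)) ?expf_neq0 ?(ff_neq0 ff)
    ?(pideal_neq0 Qt) ?(pideal_neq0 Qy)//.
  rewrite (ord_notin' Qt) (ord_notin' Qy) addn0 add0n => ->.
  by rewrite (ordX noethA' normA' (prime_divisorP Z))// (ff_neq0 ff).
move=> a0; rewrite ordpE//; congr (_ * _)%N; apply/esym.
apply: (mult_ord noethA' normA' (prime_divisorP Z)); [by exists p|exact: (ff_neq0 ff)|].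
move=> _ [x Qx <-] fx0.
have x0 : x != 0 by apply: contra_neq fx0 => ->; rewrite rmorph0.
rewrite (ordpE x)// leq_pmull//.
exact/(ord_gt0 noethA normA hQ x0).
Qed.

(** If [Y] were inside the contraction, the latter would be nonzero, so of height one and equal to
    [Y]. Hence some element of [Y] becomes a unit at [Z]. *)
Lemma mult_neq_contraction (Y : prime_divisor A) : set_val Y <> contraction ->
  mult (set_val Z) (phi @` set_val Y) = 0%N.
Proof.
move=> YQ.
have [y Yy Zy] : exists2 y, pideal (set_val Y) y & ~ pideal (set_val Z) (phi y).
  apply: contrapT => no; apply: YQ.
  have YQ : set_val Y `<=` contraction.
    by move=> y Yy; apply: contrapT => Zy; apply: no; exists y.
  have [b Yb b0] := height_one_neq0 (prime_divisorP Y).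
  apply: (height_one_sub _ YQ); last by exists b.
  by apply: contraction_height_one; exists b => //; apply: YQ.
rewrite (mult_ord noethA' normA' (prime_divisorP Z) (s := phi y)); first exact: ord_notin'.
- by exists y.
- exact: pideal_neq0 Zy.
- by move=> *; rewrite ord_notin'.
Qed.

Lemma coeff_pullback_prime (Y : prime_divisor A) :
  coeff Z (pullback_prime phi Y) = (mult (set_val Z) (phi @` set_val Y))%:Z.
Proof.
rewrite /pullback_prime (@coeff_fsum _ (fun Z => (mult (set_val Z) (phi @` set_val Y))%:Z))//.
have [b Yb b0] := height_one_neq0 (prime_divisorP Y).
apply: sub_finite_set (finite_height_one noethA' (ff_neq0 ff b0)) => X /= h.
apply: contrapT => Xb; move/eqP: h; apply; congr Posz.
rewrite (mult_ord noethA' normA' (prime_divisorP X) (s := phi b)).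
- exact: ord_notin'.
- by exists b.
- exact: (ff_neq0 ff).
- by move=> s _ _; rewrite ord_notin'.
Qed.

End Contraction.

Lemma pullbackB D E : pullback phi (D - E) = pullback phi D - pullback phi E.
Proof. exact: (@lift_is_additive _ _ _ (pullback_prime phi) D E). Qed.

Lemma pullback0 : pullback phi 0 = 0.
Proof. by rewrite -(subrr 0) pullbackB subrr. Qed.

Lemma pullbackD D E : pullback phi (D + E) = pullback phi D + pullback phi E.
Proof. by rewrite -{1}[E]opprK -[- E]sub0r !pullbackB pullback0 sub0r opprK. Qed.

Lemma pullbackMn D n : pullback phi (D *+ n) = pullback phi D *+ n.
Proof. by elim: n => [|n ih]; rewrite ?pullback0// !mulrS pullbackD ih. Qed.

Lemma pullbackMz D (n : int) : pullback phi (D *~ n) = pullback phi D *~ n.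
Proof.
case: n => n; first exact: pullbackMn.
rewrite NegzE !mulrNz -[- (D *~ _)]sub0r pullbackB pullback0 sub0r; congr (- _).
exact: pullbackMn.
Qed.

Lemma coeff_pullback_sum Z D : coeff Z (pullback phi D) =
  \sum_(Y <- dom D) coeff Y D * (mult (set_val Z) (phi @` set_val Y))%:Z.
Proof.
have pullback_sum (I : Type) (r : seq I) (F : I -> Div A) :
    pullback phi (\sum_(i <- r) F i) = \sum_(i <- r) pullback phi (F i).
  exact: (big_morph _ pullbackD pullback0).
rewrite -{1}[D]freeg_sumE pullback_sum raddf_sum; apply: eq_bigr => Y _ /=.
by rewrite /pullback liftU coeffZ coeff_pullback_prime.
Qed.

Lemma coeff_pullback Z D (Q : prime_divisor A) : set_val Q = contraction Z ->
  coeff Z (pullback phi D) = coeff Q D * (ramification Z)%:Z.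
Proof.
move=> QZ; rewrite coeff_pullback_sum /ramification -QZ.
have zero Y : Y != Q -> mult (set_val Z) (phi @` set_val Y) = 0%N.
  by move=> YQ; apply: mult_neq_contraction; rewrite -QZ => /val_inj; apply/eqP.
have [Qd|Qd] := boolP (Q \in dom D).
  by rewrite (bigD1_seq Q) ?uniq_dom//= big1 ?addr0// => Y /zero ->; rewrite mulr0.
rewrite (coeff_outdom Qd) mul0r big_seq big1// => Y Yd.
by rewrite zero ?mulr0//; apply: contraNneq Qd => <-.
Qed.

Lemma coeff_pullback0 Z D : ~ height_one (contraction Z) -> coeff Z (pullback phi D) = 0.
Proof.
move=> nQ; rewrite coeff_pullback_sum big1// => Y _; rewrite mult_neq_contraction ?mulr0//.
by move=> e; apply: nQ; rewrite -e; apply: prime_divisorP.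
Qed.

Lemma contraction_case Z : (exists Q : prime_divisor A, set_val Q = contraction Z) \/
  ~ height_one (contraction Z).
Proof.
have [h|h] := pselect (height_one (contraction Z)); [left|by right].
by exists (SigSub (mem_set h)).
Qed.

Lemma ord_contraction0 Z a : ~ height_one (contraction Z) -> a != 0 -> ordY Z (phi a) = 0%N.
Proof.
move=> nQ a0; apply: ord_notin' => Za; apply: nQ.
by apply: contraction_height_one; exists a.
Qed.

Lemma effective_pullback D : effective D -> effective (pullback phi D).
Proof.
move=> eD Z; rewrite coeff_pullback_sum; apply: sumr_ge0 => Y _.
by apply: mulr_ge0 => //; apply: eD.
Qed.

Lemma pullback_div_elt a : a != 0 -> pullback phi (div_elt a) = div_elt (phi a).
Proof.
move=> a0; apply: Div_eqP => Z; rewrite (coeff_div_elt noethA' normA' _ (ff_neq0 ff a0)).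
have [[Q QZ]|nQ] := contraction_case Z.
  rewrite (coeff_pullback _ QZ) (coeff_div_elt noethA normA _ a0) ord_contraction//.
    by rewrite -QZ PoszM.
  by rewrite -QZ; apply: prime_divisorP.
by rewrite coeff_pullback0// ord_contraction0.
Qed.

Lemma principal_pullback D : principal D -> principal (pullback phi D).
Proof.
move=> [a [b [a0 b0 ->]]]; exists (phi a), (phi b); split; rewrite ?(ff_neq0 ff)//.
by rewrite pullbackB !pullback_div_elt.
Qed.

Lemma ideal_of_pullback_mem F x : ideal_of F x -> ideal_of (pullback phi F) (phi x).
Proof.
have [->|x0] := eqVneq x 0; first by rewrite rmorph0; left.
move=> [/eqP|Fx]; first by rewrite (negbTE x0).
right=> Z; have [[Q QZ]|nQ] := contraction_case Z.
  rewrite (coeff_pullback _ QZ) ord_contraction//; last first.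
    by rewrite -QZ; apply: prime_divisorP.
  by rewrite PoszM ler_wpM2r// -QZ.
by rewrite coeff_pullback0.
Qed.

(* [I(F)] is the colon ideal [(b : I(H))], where [H = div b - F], and
   forming colon ideals commutes with flat extensions. *)
Lemma ideal_of_pullback F b : effective F -> b != 0 -> ideal_of F b ->
  ideal_of (pullback phi F) `<=` ext_ideal phi (ideal_of F).
Proof.
move=> eF b0 Fb x F'x; pose H := div_elt b - F.
have eH : effective H by apply/(ideal_ofP noethA normA).
have FH : F + H = div_elt b by rewrite /H addrC subrK.
have xC : ext_ideal phi [set c | forall h, ideal_of H h -> divides b (c * h)] x.
  apply: (flat_colon noethA ff (ideal_of_ideal noethA normA H)) => h Hh.
  apply/(ideal_of_div noethA' normA' _ (ff_neq0 ff b0)).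
  rewrite -pullback_div_elt// -FH pullbackD; apply: ideal_ofM => //.
  exact: ideal_of_pullback_mem.
apply: ext_idealS xC => c cH; have [->|c0] := eqVneq c 0; first by left.
right=> Y; have [h [h0 Hh hY]] := ideal_of_exact noethA normA Y eH.
have := le_ord_divides noethA normA (prime_divisorP Y) b0 (mulf_neq0 c0 h0) (cH h Hh).
rewrite (ordM noethA normA (prime_divisorP Y))//.
have : coeff Y (F + H) = (ordY Y b)%:Z by rewrite FH coeff_div_elt.
by rewrite coeffD -hY; lia.
Qed.

End Pullback.

(** * Comparison of the affine class groups *)

Section RadicalIdeal.
Variable A : idomainType.
Hypotheses (noethA : noetherian A) (normA : normal_domain A).
Variables (F : Div A) (b : A).
Local Notation P n := (ideal_prod (ideal_of (div_elt b - F)) (ideal_of (F *+ n.+1))).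

Definition radical_set : set A := [set a | ideal_of F a /\ exists n, P n (b * a ^+ n)].

Lemma radical_step n k r c : ideal_of (F *+ k) c -> P n r -> P (n + k)%N (c * r).
Proof.
move=> Fc; apply: ideal_prodMl => y Fy; rewrite addnC -addnS mulrnDr.
exact: ideal_ofM.
Qed.

(** In each term of the expansion of [(x + y) ^ (n + m)] the exponent of [x] is at least [n] or that
    of [y] is at least [m]; the remaining factors only raise the degree, as in [radical_step]. *)
Lemma radical_set_ideal : is_ideal radical_set.
Proof.
have iF := ideal_of_ideal noethA normA F.
have iP n := ideal_prod_ideal (ideal_of (div_elt b - F)) (ideal_of (F *+ n.+1)).
have FX x k : ideal_of F x -> ideal_of (F *+ k) (x ^+ k) by exact: ideal_ofX.
split=> [|x y [Fx [n xn]] [Fy [m ym]]|r x [Fx [n xn]]].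
- split; first exact: ideal0.
  by exists 1%N; rewrite expr1 mulr0; exact: ideal0 (iP _).
- split; first exact: idealD.
  exists (n + m)%N; rewrite exprDn big_distrr /=; apply: (ideal_sum _ (iP _)) => i _.
  rewrite mulrnAr -mulr_natl; apply: (idealMl _ (iP _)).
  have [im|im] := leqP i m; last first.
    have e : (n + m)%N = (m + ((n + m - i) + (i - m)))%N by have := ltn_ord i; lia.
    have -> : b * (x ^+ (n + m - i) * y ^+ i) =
        x ^+ (n + m - i) * y ^+ (i - m) * (b * y ^+ m).
      have -> : y ^+ i = y ^+ (i - m) * y ^+ m by rewrite -exprD subnK// ltnW.
      ring.
    rewrite [X in P X _]e; apply: radical_step ym.
    by rewrite mulrnDr; apply: ideal_ofM => //; exact: FX.
  have e : (n + m)%N = (n + ((m - i) + i))%N by lia.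
  have -> : b * (x ^+ (n + m - i) * y ^+ i) = x ^+ (m - i) * y ^+ i * (b * x ^+ n).
    by have -> : (n + m - i = n + (m - i))%N; [lia|rewrite exprD; ring].
  rewrite [X in P X _]e; apply: radical_step xn.
  by rewrite mulrnDr; apply: ideal_ofM => //; exact: FX.
- split; first exact: idealMl.
  by exists n; rewrite exprMn mulrCA; apply: (idealMl _ (iP _)).
Qed.

End RadicalIdeal.

Section Comparison.
Variables (A A' : idomainType) (phi : {rmorphism A -> A'}).
Hypotheses (noethA : noetherian A) (normA : normal_domain A).
Hypotheses (noethA' : noetherian A') (normA' : normal_domain A').
Hypothesis ff : faithfully_flat phi.

Lemma coaffine_pullback (D : Div A) : coaffine (pullback phi D) <-> coaffine D.
Proof.
have [F [b [b0 eF pFD Fb]]] := anti_effective noethA normA D.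
have eF' := effective_pullback noethA' normA' ff eF.
have Fb' := ideal_of_pullback_mem noethA normA noethA' normA' ff Fb.
have b0' := ff_neq0 ff b0.
have pFD' : principal (pullback phi F + pullback phi D).
  by rewrite -pullbackD; apply: principal_pullback.
rewrite (coaffineP noethA normA b0 eF pFD Fb).
rewrite (coaffineP noethA' normA' b0' eF' pFD' Fb').
have HE : div_elt (phi b) - pullback phi F = pullback phi (div_elt b - F).
  by rewrite pullbackB (pullback_div_elt noethA normA noethA' normA' ff).
have eH : effective (div_elt b - F) by apply/(ideal_ofP noethA normA).
split=> [rF' a Fa|rF a' F'a'].
- have [n] := rF' _ (ideal_of_pullback_mem noethA normA noethA' normA' ff Fa).
  rewrite HE -pullbackMn -rmorphXn -rmorphM => h; exists n.
  (* Both factors of the product over [A'] are contained in extended ideals, so the membership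
     contracts to [A]. *)
  apply: (ext_contract ff (ideal_prod_ideal _ _)); apply: ext_ideal_prod.
  apply: ideal_genS h => _ [x [y [Hx Fy ->]]]; exists x, y; split=> //.
    apply: (ideal_of_pullback noethA normA noethA' normA' ff eH b0) Hx.
    by apply/(ideal_ofP noethA normA) => //; rewrite opprB addrC subrK.
  apply: (ideal_of_pullback noethA normA noethA' normA' ff _ (expf_neq0 n.+1 b0)) Fy.
    by move=> Y; rewrite coeffMn mulrn_wge0//; apply: eF.
  exact: ideal_ofX.
(* [a'] need not be the image of an element of [I(F)]; it is a combination of such images, which
   suffices because [radical_set] is an ideal. *)
- have h := ideal_of_pullback noethA normA noethA' normA' ff eF b0 Fb F'a'.
  suff [] : radical_set (pullback phi F) (phi b) a' by [].
  move: a' h {F'a'}; apply: ideal_gen_min; first exact: radical_set_ideal.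
  move=> _ [a Fa <-]; split; first exact: ideal_of_pullback_mem.
  have [n ban] := rF a Fa; exists n.
  rewrite HE -pullbackMn -rmorphXn -rmorphM.
  move: ban; move: (b * a ^+ n).
  apply: (ideal_gen_min (I := [set r | ideal_prod (ideal_of (pullback phi (div_elt b - F)))
    (ideal_of (pullback phi (F *+ n.+1))) (phi r)])).
    have iP := ideal_prod_ideal (ideal_of (pullback phi (div_elt b - F)))
      (ideal_of (pullback phi (F *+ n.+1))).
    split=> [|u v /= hu hv|u v /= hv]; rewrite /= ?rmorph0 ?rmorphD ?rmorphM.
    + exact: ideal0 iP.
    + exact: (idealD iP).
    + exact: (idealMl _ iP).
  move=> _ [x [y [Hx Fy ->]]] /=; rewrite rmorphM.
  by apply: mem_ideal_prod; apply: ideal_of_pullback_mem.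
Qed.

Lemma strongly_coaffine_pullback (D : Div A) :
  strongly_coaffine (pullback phi D) <-> strongly_coaffine D.
Proof.
rewrite (strongly_coaffineP noethA normA) (strongly_coaffineP noethA' normA').
by split=> h n; have := h n; rewrite -pullbackMz coaffine_pullback.
Qed.

Hypothesis Cl_surj : forall D' : Div A', exists D : Div A, lin_equiv D' (pullback phi D).

(** A test divisor on [A'] is linearly equivalent to a pull-back and strong coaffineness respects
    linear equivalence, so pull-backs suffice as test divisors. *)
Lemma affine_trivial_pullback (D : Div A) :
  affine_trivial (pullback phi D) <-> affine_trivial D.
Proof.
split=> aD E sE.
  apply/strongly_coaffine_pullback; rewrite pullbackD; apply: aD.
  exact/strongly_coaffine_pullback.
have [G EG] := Cl_surj E.
have : strongly_coaffine (pullback phi (D + G)).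
  apply/strongly_coaffine_pullback/aD/strongly_coaffine_pullback.
  exact: strongly_coaffine_lin_equiv EG sE.
apply: strongly_coaffine_lin_equiv => //.
rewrite pullbackD /lin_equiv opprD addrACA subrr add0r.
exact: lin_equiv_sym.
Qed.

Lemma affclB (B : idomainType) (D E : Div B) : affcl (D - E) = affcl D - affcl E.
Proof. exact: raddfB. Qed.

Lemma affcl_eqP (B : idomainType) (D E : Div B) : affcl D = affcl E <-> affine_trivial (D - E).
Proof.
split=> [/eqP|aDE].
  by rewrite -Quotient.idealrBE => /asboolP.
by apply/eqP; rewrite -Quotient.idealrBE; apply/asboolP.
Qed.

Definition affcl_pullback (u : AffCl A) : AffCl A' := affcl (pullback phi (repr u)).

Lemma affcl_pullbackE D : affcl_pullback (affcl D) = affcl (pullback phi D).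
Proof.
apply/affcl_eqP; rewrite -pullbackB; apply/affine_trivial_pullback/affcl_eqP.
exact: reprK.
Qed.

Lemma affcl_pullback_zmod : zmod_morphism affcl_pullback.
Proof.
move=> u v; rewrite -[u]reprK -[v]reprK -!/(affcl _) -affclB !affcl_pullbackE.
by rewrite pullbackB affclB.
Qed.

(** Surjectivity follows from [Cl_surj], principal divisors being affine trivial; injectivity is the
    descent of affine triviality from [A'] to [A]. *)
Lemma affcl_pullback_bij : bijective affcl_pullback.
Proof.
have lift_ex u' : exists u, affcl_pullback u = u'.
  have [D D'D] := Cl_surj (repr u'); exists (affcl D).
  rewrite affcl_pullbackE -[u']reprK; apply/affcl_eqP.
  by apply: principal_affine_trivial => //; apply: lin_equiv_sym.
pose g u' := projT1 (cid (lift_ex u')).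
have gK : cancel g affcl_pullback by move=> u'; rewrite /g; case: cid.
exists g => // u; have := gK (affcl_pullback u); move: (g _) => v.
rewrite -[u]reprK -[v]reprK -!/(affcl _) !affcl_pullbackE => /affcl_eqP.
by rewrite -pullbackB => /affine_trivial_pullback/affcl_eqP.
Qed.

End Comparison.

(* The surjectivity of Cl A -> Cl A' is written on representatives: every
   divisor of A' is linearly equivalent to a pull-back. *)
Theorem theorem2p4 (A A' : idomainType) (phi : {rmorphism A -> A'})
    (noethA : noetherian A) (normA : normal_domain A)
    (noethA' : noetherian A') (normA' : normal_domain A')
    (ff_phi : faithfully_flat phi)
    (Cl_surj : forall D' : Div A', exists D : Div A,
       lin_equiv D' (pullback phi D)) :
  exists F : {additive AffCl A -> AffCl A'},
    (forall D : Div A, F (affcl D) = affcl (pullback phi D)) /\ bijective F.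
Proof.
pose zM := affcl_pullback_zmod noethA normA noethA' normA' ff_phi Cl_surj.
pose F : {additive AffCl A -> AffCl A'} := HB.pack (affcl_pullback phi)
  (GRing.isZmodMorphism.Build _ _ (affcl_pullback phi) zM).
exists F; split; first exact: affcl_pullbackE.
exact: affcl_pullback_bij.
Qed.
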